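(* Let $\varphi:\Gamma\to\mathbb{C}$ be continuous, and let $$v(x)=\int_\Gamma\Phi(x,y)\,\varphi(y)\,ds_y,\qquad x\in\mathbb{R}^2\setminus\Gamma,$$ be the single layer potential with density $\varphi$. Then the derivative of $v$ in the direction $\tilde\nu$ can be continuously extended from $\Omega$ to $\bar\Omega$ and from $\mathbb{R}^2\setminus\bar\Omega$ to $\mathbb{R}^2\setminus\Omega$, respectively, in the sense that for every $x\in\Gamma$ the limits $$\frac{\partial v_\pm(x)}{\partial\tilde\nu}=\lim_{h>0,\,h\to0}\nabla v(x\pm h\nu(x))\cdot\tilde\nu(x)$$ exist and $$\frac{\partial v_\pm(x)}{\partial\tilde\nu}=\int_\Gamma\frac{\partial\Phi(x,y)}{\partial\tilde\nu(x)}\,\varphi(y)\,ds_y\mp\frac12\varphi(x),\qquad x\in\Gamma.$$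
   Context: Let $k_0>0$ be the free-space wavenumber and let $\varepsilon_1,\varepsilon_2\in\mathbb{C}$ be constants with $\mathrm{Re}\,\varepsilon_1\cdot\mathrm{Re}\,\varepsilon_2<0$ and $\mathrm{Im}\,\varepsilon_j>0$ for $j=1,2$ (lossy hyperbolic medium). Put $A=\mathrm{diag}(1/\varepsilon_1,1/\varepsilon_2)$. The square root $\sqrt z=|z|^{1/2}e^{\frac12 i\arg z}$ is the analytic branch on $\mathbb{C}\setminus\{-it: t\ge0\}$, i.e. $\arg z\in(-\pi/2,3\pi/2)$. Set $$\tilde r(x,y)=\sqrt{(x-y)^TA^{-1}(x-y)}=\sqrt{\varepsilon_1(x_1-y_1)^2+\varepsilon_2(x_2-y_2)^2},$$ $$\Phi(x,y)=\frac{i}{4}\sqrt{\varepsilon_1\varepsilon_2}\,H_0^{(1)}(k_0\tilde r(x,y)),\qquad x\ne y,$$ where $H_0^{(1)}$ is the Hankel function of the first kind of order zero. $\Phi$ is the outgoing fundamental solution of $\nabla\cdot(A\nabla u)+k_0^2u=0$. $\Omega\subset\mathbb{R}^2$ is a bounded simply connected domain with boundary $\Gamma$ of class $C^2$; $\nu$ is the unit normal on $\Gamma$ pointing out of $\Omega$; $\tilde\nu=A\nu$; and $\frac{\partial f}{\partial\tilde\nu}=\nabla f\cdot\tilde\nu$, with the bilinear dot product (no complex conjugation). $\frac{\partial\Phi(x,y)}{\partial\tilde\nu(x)}=\nabla_x\Phi(x,y)\cdot\tilde\nu(x)$, and $ds$ is arc length on $\Gamma$. *)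

(* Defs.v *)
From Stdlib Require Export Reals Factorial.
From Coquelicot Require Export Coquelicot.
Open Scope R_scope.

Notation plane := (R * R)%type.

(** * Complex functions *)

(* Principal argument, in (-PI, PI] for z <> 0. *)
Definition Carg (z : C) : R :=
  if Rle_dec 0 (Im z) then acos (Re z / Cmod z) else - acos (Re z / Cmod z).

Definition Clog (z : C) : C := (ln (Cmod z), Carg z).

(* Argument in (-PI/2, 3PI/2) off the half-line {-it : t >= 0}: rotating by
   -PI/2 carries this half-line to the cut of the principal argument. *)
Definition Carg_cut (z : C) : R := PI / 2 + Carg (- Ci * z)%C.

Definition Csqrt (z : C) : C :=
  (RtoC (sqrt (Cmod z)) * (cos (Carg_cut z / 2), sin (Carg_cut z / 2)))%C.

Definition CSeries (a : nat -> C) : C :=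
  (Series (fun n => Re (a n)), Series (fun n => Im (a n))).

Definition harmonic (n : nat) : R := sum_n_m (fun k => / INR k) 1 n.

Definition euler_gamma : R := real (Lim_seq (fun n => harmonic n - ln (INR n))).

(* (-1)^n / (n!)^2 * (z/2)^(2n) *)
Definition bessel_term (z : C) (n : nat) : C :=
  (RtoC ((-1) ^ n / (INR (fact n)) ^ 2) * (z / 2) ^ (2 * n))%C.

Definition besselJ0 (z : C) : C := CSeries (bessel_term z).

(* Classical series of the Bessel function of the second kind, order zero;
   the n = 0 term of the sum vanishes because harmonic 0 = 0. *)
Definition besselY0 (z : C) : C :=
  (RtoC (2 / PI) * (Clog (z / 2) + RtoC euler_gamma) * besselJ0 z
   - RtoC (2 / PI) * CSeries (fun n => RtoC (harmonic n) * bessel_term z n))%C.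

Definition hankel1_0 (z : C) : C := (besselJ0 z + Ci * besselY0 z)%C.

(** * Calculus for complex-valued functions of real variables *)

Definition CDerive (f : R -> C) (t : R) : C :=
  (Derive (fun s => Re (f s)) t, Derive (fun s => Im (f s)) t).

Definition ex_grad (f : plane -> C) (x : plane) : Prop :=
  ex_derive (V := C_R_NormedModule) (fun s => f (s, snd x)) (fst x) /\
  ex_derive (V := C_R_NormedModule) (fun s => f (fst x, s)) (snd x).

Definition grad (f : plane -> C) (x : plane) : C * C :=
  (CDerive (fun s => f (s, snd x)) (fst x),
   CDerive (fun s => f (fst x, s)) (snd x)).

(* Bilinear: no conjugation. *)
Definition cdot (a b : C * C) : C := (fst a * fst b + snd a * snd b)%C.

(** * Plane domains and their boundary curves *)

Definition closure (D : plane -> Prop) (p : plane) : Prop :=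
  forall eps : posreal, exists q, ball p eps q /\ D q.

Definition boundary (D : plane -> Prop) (p : plane) : Prop :=
  closure D p /\ closure (fun q => ~ D q) p.

Definition connected (D : plane -> Prop) : Prop :=
  forall U V : plane -> Prop, open U -> open V ->
    (forall p, D p -> U p \/ V p) ->
    (exists p, D p /\ U p) -> (exists p, D p /\ V p) ->
    exists p, D p /\ U p /\ V p.

Definition domain (D : plane -> Prop) : Prop :=
  open D /\ connected D /\ exists p, D p.

Definition unit_interval (t : R) : Prop := 0 <= t <= 1.

Definition unit_square (p : R * R) : Prop :=
  unit_interval (fst p) /\ unit_interval (snd p).

Definition loop_in (D : plane -> Prop) (c : R -> plane) : Prop :=
  continuous_on unit_interval c /\
  (forall t, unit_interval t -> D (c t)) /\ c 0 = c 1.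

Definition contractible_in (D : plane -> Prop) (c : R -> plane) : Prop :=
  exists H : R * R -> plane,
    continuous_on unit_square H /\
    (forall p, unit_square p -> D (H p)) /\
    (forall t, unit_interval t -> H (0, t) = c t /\ H (1, t) = c 0) /\
    (forall s, unit_interval s -> H (s, 0) = c 0 /\ H (s, 1) = c 0).

Definition simply_connected (D : plane -> Prop) : Prop :=
  connected D /\ forall c, loop_in D c -> contractible_in D c.

Definition bounded (D : plane -> Prop) : Prop :=
  exists M : R, forall p, D p -> ball ((0, 0) : plane) M p.

Definition velocity (g : R -> plane) (t : R) : plane :=
  (Derive (fun s => fst (g s)) t, Derive (fun s => snd (g s)) t).

Definition speed (g : R -> plane) (t : R) : R :=
  sqrt (fst (velocity g t) ^ 2 + snd (velocity g t) ^ 2).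

(* All orders k <= 2 are listed since ex_derive_n f 2 alone does not give the
   differentiability of f. *)
Definition C2 (f : R -> R) : Prop :=
  forall t, (forall k, (k <= 2)%nat -> ex_derive_n f k t) /\
            continuous (Derive_n f 2) t.

(* G is of class C^2: it is the trace of the regular simple closed curve g of
   class C^2, g being L-periodic. *)
Record C2_closed_curve (G : plane -> Prop) (g : R -> plane) (L : R) : Prop := {
  curve_period_pos : 0 < L;
  curve_periodic : forall t, g (t + L) = g t;
  curve_C2_fst : C2 (fun t => fst (g t));
  curve_C2_snd : C2 (fun t => snd (g t));
  curve_regular : forall t, velocity g t <> (0, 0);
  curve_simple : forall s t, 0 <= s < L -> 0 <= t < L -> g s = g t -> s = t;
  curve_trace : forall p, G p <-> exists t, 0 <= t < L /\ g t = p
}.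

(* Integrals with respect to arc length over the trace of g. *)
Definition is_curve_int (g : R -> plane) (L : R) (f : plane -> C) (I : C) : Prop :=
  is_RInt (V := C_R_NormedModule) (fun t => (f (g t) * RtoC (speed g t))%C) 0 L I.

Definition curve_int (g : R -> plane) (L : R) (f : plane -> C) : C :=
  RInt (V := C_R_CompleteNormedModule)
    (fun t => (f (g t) * RtoC (speed g t))%C) 0 L.

(* x + h n *)
Definition shift (x n : plane) (h : R) : plane :=
  (fst x + h * fst n, snd x + h * snd n).

Definition outward_unit_normal (D : plane -> Prop) (g : R -> plane)
    (nu : plane -> plane) : Prop :=
  forall x, boundary D x ->
    fst (nu x) ^ 2 + snd (nu x) ^ 2 = 1 /\
    (forall t, g t = x ->
       fst (nu x) * fst (velocity g t) + snd (nu x) * snd (velocity g t) = 0) /\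
    at_right 0 (fun h => D (shift x (nu x) (- h)) /\
                         ~ closure D (shift x (nu x) h)).

(** * Fundamental solution and single layer potential *)

(* A n with A = diag (1/e1, 1/e2) *)
Definition conormal (e1 e2 : C) (n : plane) : C * C :=
  (/ e1 * RtoC (fst n), / e2 * RtoC (snd n))%C.

Definition rtilde (e1 e2 : C) (x y : plane) : C :=
  Csqrt (e1 * RtoC ((fst x - fst y) ^ 2) + e2 * RtoC ((snd x - snd y) ^ 2))%C.

Definition Phi (k0 : R) (e1 e2 : C) (x y : plane) : C :=
  (Ci / 4 * Csqrt (e1 * e2) * hankel1_0 (RtoC k0 * rtilde e1 e2 x y))%C.

(* Derivative of Phi with respect to x in the direction A n; only meaningful for
   x <> y. *)
Definition dPhi (k0 : R) (e1 e2 : C) (n x y : plane) : C :=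
  cdot (grad (fun z => Phi k0 e1 e2 z y) x) (conormal e1 e2 n).

(* Only meaningful off the trace of g. *)
Definition single_layer (k0 : R) (e1 e2 : C) (g : R -> plane) (L : R)
    (phi : plane -> C) (x : plane) : C :=
  curve_int g L (fun y => (Phi k0 e1 e2 x y * phi y)%C).

(* grad v (x + h n) . w exists for small h > 0 and tends to l as h -> 0+. *)
Definition is_directional_trace (v : plane -> C) (x n : plane) (w : C * C)
    (l : C) : Prop :=
  at_right 0 (fun h => ex_grad v (shift x n h)) /\
  filterlim (fun h => cdot (grad v (shift x n h)) w) (at_right 0)
    (locally (T := C_UniformSpace) l).

(* Main.v *)
From Stdlib Require Import ZArith Lra Lia Psatz.
Require Import Defs.
Open Scope R_scope.

(** For [Im Q > 0] the Hankel function [H_0^(1)(k0 sqrt Q)] is built from entire power series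
    in [Q] and [log Q]; hence the conormal derivative of [Phi] at [z = x - y] is
    [- s / (2 PI) (z . n) / Q(z)], with [s = sqrt (e1 e2)] and [Q(z) = e1 z1^2 + e2 z2^2],
    plus a kernel that extends continuously by [0] to [z = 0].  Only the first part can jump.
    Near [x] write the curve as [x + t tau + t^2 kap(t)] with [kap] continuous.  At
    [x + h n] the singular kernel differs from its value at [h = 0] by
    [h / Q(h n - t tau)] up to an error bounded pointwise by [eps + eps h / (h^2 + t^2)],
    whose integral tends to [0] with [eps].  Finally [h / Q(h n - t tau)] is integrated by
    partial fractions and tends to [PI / (s |tau|)]: the two roots lie in opposite
    half-planes, and the branch of the square root fixes the sign of [s].  The interior trace
    is the same computation with [- n] in place of [n]. *)

(** * Power series with complex argument *)

(** The value of the square root enters twice and has to cancel: the singular kernel carries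
    [- s / (2 PI)], the line integral tends to [PI / (s |tau|)], and the arc length factor of the
    density is [|tau|] at [x], which leaves [- 1/2]. This is correct only if the partial fractions
    produce [Csqrt (e1 * e2)] itself and not its negative, and here [Re e1 * Re e2 < 0] decides.
    Since [n] is orthogonal to [tau], the numerator of the singular kernel is [h - t^2 (kap . n)]:
    on the curve it is of order [t^2], like [Q], so the boundary integral is an ordinary Riemann
    integral, and the jump comes from the term [h] alone. The obstacle is that replacing the curve
    by its tangent costs an error of the size [h (h + |t|) / (h^2 + t^2)], which is of order one for
    [|t|] near [h], however small [h] is. It is therefore split into a small constant and a small
    multiple of the Poisson kernel [h / (h^2 + t^2)], whose integral is at most [PI] for every [h].
    The Taylor form with continuous [kap] is exact on a whole period, so no cut-off between near and
    far parts of the curve is needed. *)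

Lemma Cmod_le_components (z : C) : Cmod z <= Rabs (Re z) + Rabs (Im z).
Proof.
  destruct z as [a b]; unfold Cmod; simpl.
  pose proof (Rabs_pos a); pose proof (Rabs_pos b).
  rewrite <- (sqrt_pow2 (Rabs a + Rabs b)) by lra.
  apply sqrt_le_1_alt.
  pose proof (pow2_abs a); pose proof (pow2_abs b); simpl in *; nra.
Qed.

Lemma Im_le_Cmod (z : C) : Rabs (Im z) <= Cmod z.
Proof. eapply Rle_trans; [apply Rmax_r | apply Rmax_Cmod]. Qed.

Lemma Cmod_pow (z : C) (n : nat) : Cmod (z ^ n)%C = Cmod z ^ n.
Proof.
  induction n as [|n IH]; simpl; [apply Cmod_1|].
  now rewrite Cmod_mult, IH.
Qed.

(** The real comparison test is applied to the real and to the imaginary part; this costs the factor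
    2, whose size never matters later. *)
Lemma CSeries_bound (c : nat -> C) (b : nat -> R) :
  ex_series b -> (forall n, Cmod (c n) <= b n) ->
  Cmod (CSeries c) <= 2 * Series b.
Proof.
  intros Hb Hc.
  assert (H : forall r : nat -> R, (forall n, Rabs (r n) <= Cmod (c n)) ->
                Rabs (Series r) <= Series b).
  { intros r Hr.
    assert (Hr' : ex_series (fun n => Rabs (r n))).
    { apply (ex_series_le (K := R_AbsRing) (V := R_CompleteNormedModule) _ b); auto.
      intros n; unfold norm; simpl; unfold abs; simpl; rewrite Rabs_Rabsolu.
      eapply Rle_trans; [apply Hr|apply Hc]. }
    eapply Rle_trans; [apply Series_Rabs; auto|].
    apply Series_le; auto.
    intros n; split; [apply Rabs_pos|].
    eapply Rle_trans; [apply Hr|apply Hc]. }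
  eapply Rle_trans; [apply Cmod_le_components|]; simpl.
  pose proof (H (fun n => Re (c n)) (fun n => re_le_Cmod (c n))).
  pose proof (H (fun n => Im (c n)) (fun n => Im_le_Cmod (c n))).
  lra.
Qed.

Definition Cabs_summable (c : nat -> C) : Prop := ex_series (fun n => Cmod (c n)).

Lemma Cabs_summable_components (c : nat -> C) :
  Cabs_summable c ->
  ex_series (fun n => Re (c n)) /\ ex_series (fun n => Im (c n)).
Proof.
  intros H; split;
  apply (ex_series_le (K := R_AbsRing) (V := R_CompleteNormedModule) _
           (fun n => Cmod (c n))); auto; intros n.
  - apply re_le_Cmod.
  - apply Im_le_Cmod.
Qed.

Lemma CSeries_plus (c d : nat -> C) :
  Cabs_summable c -> Cabs_summable d ->
  CSeries (fun n => c n + d n)%C = (CSeries c + CSeries d)%C.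
Proof.
  intros Hc Hd.
  destruct (Cabs_summable_components c Hc), (Cabs_summable_components d Hd).
  unfold CSeries; apply injective_projections; simpl;
    rewrite <- Series_plus; auto; now apply Series_ext.
Qed.

Lemma CSeries_scal (k : C) (c : nat -> C) :
  Cabs_summable c -> CSeries (fun n => k * c n)%C = (k * CSeries c)%C.
Proof.
  intros Hc.
  destruct (Cabs_summable_components c Hc) as [H1 H2].
  assert (K : forall x (r : nat -> R), ex_series r -> ex_series (fun n => x * r n)).
  { intros x r Hr; now apply (ex_series_scal x r). }
  unfold CSeries; apply injective_projections; simpl.
  - rewrite <- !Series_scal_l, <- Series_minus; auto.
  - rewrite <- !Series_scal_l, <- Series_plus; auto.
Qed.

Definition Cpower_series (a : nat -> R) (w : C) : C :=
  CSeries (fun n => RtoC (a n) * w ^ n)%C.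

Definition entire_coeffs (a : nat -> R) : Prop :=
  forall r, 0 <= r -> ex_series (fun n => Rabs (a n) * r ^ n).

Definition derived_coeffs (a : nat -> R) (n : nat) : R := INR (S n) * a (S n).

Lemma ex_series_dominated (a b : nat -> R) :
  (forall n, 0 <= a n <= b n) -> ex_series b -> ex_series a.
Proof.
  intros H Hb.
  apply (ex_series_le (K := R_AbsRing) (V := R_CompleteNormedModule) _ b); auto.
  intros n; unfold norm; simpl; unfold abs; simpl.
  rewrite Rabs_pos_eq; apply H.
Qed.

(** Lets the factors [n] and [n^2] that come from differentiation be absorbed by a larger radius. *)
Lemma INR_le_pow2 (n : nat) : INR n <= 2 ^ n.
Proof.
  induction n as [|n IH]; [simpl; lra|].
  rewrite S_INR; simpl.
  assert (1 <= 2 ^ n) by (apply pow_R1_Rle; lra). lra.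
Qed.

Lemma entire_derived (a : nat -> R) :
  entire_coeffs a -> entire_coeffs (derived_coeffs a).
Proof.
  intros Ha r Hr.
  (* [2 ^ S n] absorbs [INR (S n)]; with [r + 1] in place of [r] the power with exponent [S n]
     dominates [r ^ n] even when [r < 1]. *)
  assert (H : ex_series (fun n => Rabs (a (S n)) * (2 * (r + 1)) ^ S n)).
  { apply (ex_series_incr_1 (fun n => Rabs (a n) * (2 * (r + 1)) ^ n)).
    apply Ha; lra. }
  revert H; apply ex_series_dominated; intros n.
  unfold derived_coeffs; rewrite Rabs_mult, (Rabs_pos_eq (INR _)) by apply pos_INR.
  pose proof (Rabs_pos (a (S n))); pose proof (pos_INR (S n)).
  assert (0 <= r ^ n) by now apply pow_le.
  split; [apply Rmult_le_pos; auto; apply Rmult_le_pos; auto|].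
  rewrite (Rmult_comm (INR _)), Rmult_assoc.
  apply Rmult_le_compat_l; auto.
  rewrite Rpow_mult_distr.
  apply Rmult_le_compat; auto using INR_le_pow2.
  assert (r ^ n <= (r + 1) ^ n) by (apply pow_incr; lra).
  simpl; nra.
Qed.

Lemma entire_summable (a : nat -> R) (w : C) :
  entire_coeffs a -> Cabs_summable (fun n => RtoC (a n) * w ^ n)%C.
Proof.
  intros Ha; unfold Cabs_summable.
  eapply ex_series_ext; [|apply (Ha (Cmod w)), Cmod_ge_0].
  intros n; simpl; now rewrite Cmod_mult, Cmod_R, Cmod_pow.
Qed.

(** Brings the derived series to the index of the original one, so that the Taylor remainder can be
    formed term by term; the extra term [n = 0] vanishes because of its factor [INR 0]. *)
Lemma Cpower_series_derived (a : nat -> R) (w : C) :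
  entire_coeffs a ->
  Cpower_series (derived_coeffs a) w =
    CSeries (fun n => RtoC (INR n * a n) * w ^ pred n)%C /\
  Cabs_summable (fun n => RtoC (INR n * a n) * w ^ pred n)%C.
Proof.
  intros Ha.
  pose proof (entire_summable _ w (entire_derived a Ha)) as H.
  set (c := fun n => (RtoC (INR n * a n) * w ^ pred n)%C).
  assert (Hc : Cabs_summable c).
  { apply (ex_series_incr_1 (fun n => Cmod (c n))); exact H. }
  split; auto.
  destruct (Cabs_summable_components c Hc) as [H1 H2].
  unfold Cpower_series, CSeries; apply injective_projections; cbv beta iota delta [fst snd];
    rewrite (Series_incr_1 (fun n => _ (c n))) by auto.
  - replace (Re (c 0%nat)) with 0 by (unfold c; simpl; ring).
    rewrite Rplus_0_l; reflexivity.
  - replace (Im (c 0%nat)) with 0 by (unfold c; simpl; ring).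
    rewrite Rplus_0_l; reflexivity.
Qed.

(** Induction: the remainder for [S n] is [w'] times the remainder for [n] plus
    [n w^(n-1) (w' - w)^2], and [n^2 + n <= (n + 1)^2]. With [1 <= r] the lower powers of [r] are
    bounded by the higher ones. *)
Lemma pow_remainder_bound (r : R) (w w' : C) (n : nat) :
  1 <= r -> Cmod w <= r -> Cmod w' <= r ->
  Cmod (w' ^ n - w ^ n - RtoC (INR n) * w ^ pred n * (w' - w))%C
    <= INR n ^ 2 * r ^ n * Cmod (w' - w)%C ^ 2.
Proof.
  intros Hr Hw Hw'.
  pose proof (Cmod_ge_0 (w' - w)%C) as Hd.
  induction n as [|n IH].
  - replace (_ - _ - _)%C with (RtoC 0) by (simpl; ring).
    rewrite Cmod_0; simpl; lra.
  - replace (w' ^ S n - w ^ S n - RtoC (INR (S n)) * w ^ pred (S n) * (w' - w))%C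
      with (w' * (w' ^ n - w ^ n - RtoC (INR n) * w ^ pred n * (w' - w))
            + RtoC (INR n) * w ^ pred n * ((w' - w) * (w' - w)))%C.
    + eapply Rle_trans; [apply Cmod_triangle|].
      rewrite !Cmod_mult, Cmod_R, Cmod_pow, (Rabs_pos_eq (INR n)) by apply pos_INR.
      set (D := Cmod (_ - _ - _)%C) in *; set (d := Cmod (w' - w)%C) in *.
      assert (Hrn : 1 <= r ^ n) by now apply pow_R1_Rle.
      assert (H1 : Cmod w ^ pred n <= r ^ n).
      { apply Rle_trans with (r ^ pred n).
        - apply pow_incr; split; auto; apply Cmod_ge_0.
        - apply Rle_pow; auto; lia. }
      assert (H1' : 0 <= Cmod w ^ pred n) by apply pow_le, Cmod_ge_0.
      assert (H2 : Cmod w' * D <= r * (INR n ^ 2 * r ^ n * d ^ 2)).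
      { apply Rmult_le_compat; auto; apply Cmod_ge_0. }
      pose proof (pos_INR n).
      assert (H3 : INR n * Cmod w ^ pred n * (d * d) <= INR n * (r * r ^ n) * (d * d)).
      { apply Rmult_le_compat_r; [nra|]. apply Rmult_le_compat_l; nra. }
      rewrite S_INR; simpl pow in *.
      assert (0 <= r * r ^ n * (d * d)) by (apply Rmult_le_pos; nra).
      nra.
    + rewrite S_INR, RtoC_plus; destruct n as [|n]; simpl; [|]; ring.
Qed.

(** A quadratic remainder, uniform on a disc, stands in for complex differentiability: the
    derivative along real curves, continuity, and the bound of [(J - 1) / Q] near [Q = 0] are all
    drawn from it. *)
Lemma Cpower_series_taylor (a : nat -> R) (r : R) :
  entire_coeffs a ->
  exists M, 0 <= M /\ forall w w', Cmod w <= r -> Cmod w' <= r ->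
    Cmod (Cpower_series a w' - Cpower_series a w
          - Cpower_series (derived_coeffs a) w * (w' - w))%C
      <= M * Cmod (w' - w)%C ^ 2.
Proof.
  intros Ha; set (s := Rabs r + 1).
  assert (Hs : 1 <= s) by (unfold s; pose proof (Rabs_pos r); lra).
  assert (Hrs : r <= s) by (unfold s; pose proof (Rle_abs r); lra).
  set (b := fun n => Rabs (a n) * (INR n ^ 2 * s ^ n)).
  assert (Hb0 : forall n, 0 <= b n).
  { intros n; apply Rmult_le_pos; [apply Rabs_pos|].
    apply Rmult_le_pos; [apply pow2_ge_0|apply pow_le; lra]. }
  assert (Hb : ex_series b).
  (* Since [n^2 <= 4^n], the quadratic factor costs only a fourfold radius. *)
  { apply (ex_series_dominated _ (fun n => Rabs (a n) * (4 * s) ^ n)).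
    - intros n; split; [apply Hb0|].
      apply Rmult_le_compat_l; [apply Rabs_pos|].
      rewrite Rpow_mult_distr.
      apply Rmult_le_compat_r; [apply pow_le; lra|].
      replace 4 with (2 * 2) by ring; rewrite Rpow_mult_distr.
      pose proof (INR_le_pow2 n); pose proof (pos_INR n); simpl; nra.
    - apply Ha; lra. }
  assert (HSb : 0 <= Series b).
  { rewrite <- (Rmult_0_l (Series b)), <- Series_scal_l.
    apply Series_le; auto; intros n; specialize (Hb0 n); lra. }
  exists (2 * Series b); split; [lra|]; intros w w' Hw Hw'.
  destruct (Cpower_series_derived a w Ha) as [E Hder].
  assert (Hd2 : 0 <= Cmod (w' - w)%C ^ 2) by apply pow2_ge_0.
  replace (_ - _ - _)%C with
    (CSeries (fun n => (RtoC (a n) * w' ^ n + (- 1) * (RtoC (a n) * w ^ n))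
       + (- (w' - w)) * (RtoC (INR n * a n) * w ^ pred n))%C).
  - rewrite Rmult_assoc, (Rmult_comm (Series b)), <- Series_scal_l.
    apply CSeries_bound; [now apply (ex_series_scal (Cmod (w' - w)%C ^ 2) b)|].
    intros n.
    replace (_ + _)%C with
      (RtoC (a n) * (w' ^ n - w ^ n - RtoC (INR n) * w ^ pred n * (w' - w)))%C
      by (rewrite RtoC_mult; ring).
    rewrite Cmod_mult, Cmod_R; unfold b.
    replace (Cmod _ ^ 2 * _) with
      (Rabs (a n) * (INR n ^ 2 * s ^ n * Cmod (w' - w)%C ^ 2)) by ring.
    apply Rmult_le_compat_l; [apply Rabs_pos|].
    apply pow_remainder_bound; lra.
  - assert (Hsc : forall k c, Cabs_summable c -> Cabs_summable (fun n => k * c n)%C).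
    { intros k c Hc; unfold Cabs_summable.
      eapply ex_series_ext; [|apply (ex_series_scal (Cmod k) _ Hc)].
      intros n; now rewrite Cmod_mult. }
    assert (Hpl : forall c d, Cabs_summable c -> Cabs_summable d ->
                    Cabs_summable (fun n => c n + d n)%C).
    { intros c d Hc Hd; unfold Cabs_summable.
      apply (ex_series_dominated _ (fun n => Cmod (c n) + Cmod (d n))).
      - intros n; split; [apply Cmod_ge_0|apply Cmod_triangle].
      - apply (ex_series_plus (V := R_NormedModule) _ _ Hc Hd). }
    pose proof (entire_summable a w Ha); pose proof (entire_summable a w' Ha).
    rewrite CSeries_plus, CSeries_plus, !CSeries_scal; auto.
    rewrite E; unfold Cpower_series; ring.
Qed.

(** * Derivatives and continuity by components *)

(* Components rather than [is_derive (V := C_R_NormedModule)], because CDerive and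
   the real calculus tactics work on components. *)
Definition Cis_derive (f : R -> C) (t : R) (l : C) : Prop :=
  is_derive (fun s => Re (f s)) t (Re l) /\
  is_derive (fun s => Im (f s)) t (Im l).

Definition Ccontinuous {U : UniformSpace} (f : U -> C) (x : U) : Prop :=
  continuous (fun s => Re (f s)) x /\ continuous (fun s => Im (f s)) x.

(** Without a quotient the increment [h = 0] is no exception, and the estimates of the two
    components can be merged into one estimate of [Cmod]. *)
Lemma is_derive_approx (f : R -> R) (t l : R) :
  is_derive f t l <->
  forall eps, 0 < eps -> exists d, 0 < d /\
    forall h, Rabs h < d -> Rabs (f (t + h) - f t - l * h) <= eps * Rabs h.
Proof.
  rewrite is_derive_Reals; split.
  - intros H eps He; destruct (H eps He) as [d Hd].
    exists d; split; [apply cond_pos|]; intros h Hh.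
    destruct (Req_dec h 0) as [->|Hn].
    + rewrite Rplus_0_r, Rabs_R0, Rmult_0_r, Rmult_0_r, !Rminus_0_r, Rminus_diag, Rabs_R0; lra.
    + specialize (Hd h Hn Hh).
      replace (f (t + h) - f t - l * h) with (((f (t + h) - f t) / h - l) * h) by now field.
      rewrite Rabs_mult; apply Rmult_le_compat_r; [apply Rabs_pos|lra].
  - intros H eps He; destruct (H (eps / 2)) as [d [Hd H']]; [lra|].
    exists (mkposreal d Hd); intros h Hn Hh; simpl in Hh.
    specialize (H' h Hh).
    replace ((f (t + h) - f t) / h - l) with ((f (t + h) - f t - l * h) / h) by now field.
    unfold Rdiv at 1; rewrite Rabs_mult, Rabs_inv.
    assert (0 < Rabs h) by now apply Rabs_pos_lt.
    apply Rmult_lt_reg_r with (Rabs h); auto.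
    rewrite Rmult_assoc, Rinv_l by lra. nra.
Qed.

Lemma Cis_derive_approx (f : R -> C) (t : R) (l : C) :
  Cis_derive f t l <->
  forall eps, 0 < eps -> exists d, 0 < d /\
    forall h, Rabs h < d ->
      Cmod (f (t + h)%R - f t - l * RtoC h)%C <= eps * Rabs h.
Proof.
  unfold Cis_derive; rewrite !is_derive_approx; split.
  - intros [H1 H2] eps He.
    destruct (H1 (eps / 2)) as [d1 [Hd1 H1']]; [lra|].
    destruct (H2 (eps / 2)) as [d2 [Hd2 H2']]; [lra|].
    exists (Rmin d1 d2); split; [now apply Rmin_pos|]; intros h Hh.
    specialize (H1' h (Rlt_le_trans _ _ _ Hh (Rmin_l _ _))).
    specialize (H2' h (Rlt_le_trans _ _ _ Hh (Rmin_r _ _))).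
    eapply Rle_trans; [apply Cmod_le_components|].
    simpl. rewrite !Rmult_0_r.
    replace (_ + - _ + - _) with (Re (f (t + h)) - Re (f t) - Re l * h) by (unfold Re; ring).
    replace (_ + - _ + - _) with (Im (f (t + h)) - Im (f t) - Im l * h) by (unfold Im; ring).
    lra.
  - intros H; split; intros eps He; destruct (H eps He) as [d [Hd Hd']];
      exists d; (split; [auto|]); intros h Hh;
      (eapply Rle_trans; [|apply (Hd' h Hh)]).
    + replace (_ - _ - _) with (Re (f (t + h)%R - f t - l * RtoC h)%C)
        by (unfold Re; simpl; ring); apply re_le_Cmod.
    + replace (_ - _ - _) with (Im (f (t + h)%R - f t - l * RtoC h)%C)
        by (unfold Im; simpl; ring); apply Im_le_Cmod.
Qed.

(** Chain rule for an outer function of a complex variable that is known only through a quadratic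
    estimate around the one point [f t]. *)
Lemma Cis_derive_comp_taylor (F : C -> C) (f : R -> C) (t : R) (l l' : C) (r M : R) :
  0 < r -> 0 <= M ->
  (forall w, Cmod (w - f t)%C <= r ->
     Cmod (F w - F (f t) - l' * (w - f t))%C <= M * Cmod (w - f t)%C ^ 2) ->
  Cis_derive f t l -> Cis_derive (fun s => F (f s)) t (l' * l)%C.
Proof.
  rewrite !Cis_derive_approx; intros Hr HM HF Hf eps He.
  (* Because [e1 <= 1], the increment of [f] is at most [B |h|]. Half of [eps] pays for the linear
     error, through [e1]; the other half pays for the remainder [M B^2 h^2], through [d2]. The bound
     [r / B] keeps the increment inside the disc. *)
  set (B := Cmod l + 1).
  assert (HB : 1 <= B) by (unfold B; pose proof (Cmod_ge_0 l); lra).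
  assert (HL : 0 < Cmod l' + 1) by (pose proof (Cmod_ge_0 l'); lra).
  set (e1 := Rmin 1 (eps / (2 * (Cmod l' + 1)))).
  assert (He1 : 0 < e1) by (apply Rmin_pos; [lra|apply Rdiv_lt_0_compat; lra]).
  destruct (Hf e1 He1) as [d [Hd Hd']].
  set (d2 := eps / (2 * (M + 1) * B ^ 2)).
  assert (Hd2 : 0 < d2) by (apply Rdiv_lt_0_compat; [lra|]; simpl; nra).
  exists (Rmin d (Rmin (r / B) d2)); split.
  { repeat apply Rmin_pos; auto; apply Rdiv_lt_0_compat; lra. }
  intros h Hh.
  pose proof (Rmin_l d (Rmin (r / B) d2)); pose proof (Rmin_r d (Rmin (r / B) d2)).
  pose proof (Rmin_l (r / B) d2); pose proof (Rmin_r (r / B) d2).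
  specialize (Hd' h ltac:(lra)).
  pose proof (Rabs_pos h) as Hh0.
  pose proof (Rmin_l 1 (eps / (2 * (Cmod l' + 1)))) as Hm1.
  pose proof (Rmin_r 1 (eps / (2 * (Cmod l' + 1)))) as Hm2.
  fold e1 in Hm1, Hm2.
  set (w := f (t + h)) in *; set (z := f t) in *.
  assert (Hwz : Cmod (w - z)%C <= B * Rabs h).
  { replace (w - z)%C with ((w - z - l * RtoC h) + l * RtoC h)%C by ring.
    eapply Rle_trans; [apply Cmod_triangle|].
    rewrite Cmod_mult, Cmod_R; unfold B; nra. }
  assert (HrB : B * Rabs h <= r).
  { apply Rle_trans with (B * (r / B)); [apply Rmult_le_compat_l; lra|].
    right; field; lra. }
  specialize (HF w ltac:(lra)).
  replace (F w - F z - l' * l * RtoC h)%C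
    with ((F w - F z - l' * (w - z)) + l' * (w - z - l * RtoC h))%C by ring.
  eapply Rle_trans; [apply Cmod_triangle|]; rewrite Cmod_mult.
  assert (A1 : Cmod l' * Cmod (w - z - l * RtoC h)%C <= eps / 2 * Rabs h).
  { apply Rle_trans with (Cmod l' * (e1 * Rabs h));
      [apply Rmult_le_compat_l; auto; apply Cmod_ge_0|].
    rewrite <- Rmult_assoc; apply Rmult_le_compat_r; auto.
    apply Rle_trans with (Cmod l' * (eps / (2 * (Cmod l' + 1))));
      [apply Rmult_le_compat_l; auto; apply Cmod_ge_0|].
    apply Rle_trans with ((Cmod l' + 1) * (eps / (2 * (Cmod l' + 1))));
      [apply Rmult_le_compat_r; [apply Rlt_le, Rdiv_lt_0_compat|]; lra|].
    right; field; lra. }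
  assert (A2 : M * Cmod (w - z)%C ^ 2 <= eps / 2 * Rabs h).
  { pose proof (Cmod_ge_0 (w - z)%C).
    apply Rle_trans with ((M + 1) * ((B * Rabs h) * (B * Rabs h))).
    - apply Rmult_le_compat; try lra; [apply pow2_ge_0|simpl; nra].
    - replace ((M + 1) * _) with ((M + 1) * B ^ 2 * Rabs h * Rabs h) by ring.
      apply Rmult_le_compat_r; auto.
      apply Rle_trans with ((M + 1) * B ^ 2 * d2);
        [apply Rmult_le_compat_l; [simpl; nra|lra]|].
      unfold d2; right; field; split; lra. }
  lra.
Qed.

Lemma Cis_derive_const (c : C) (t : R) : Cis_derive (fun _ => c) t 0%C.
Proof. split; simpl; apply (is_derive_const (V := R_NormedModule)). Qed.

Lemma Cis_derive_plus (f g : R -> C) (t : R) (l m : C) :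
  Cis_derive f t l -> Cis_derive g t m ->
  Cis_derive (fun s => f s + g s)%C t (l + m)%C.
Proof.
  intros [H1 H2] [H3 H4]; split; simpl.
  - apply (is_derive_plus (V := R_NormedModule) _ _ _ _ _ H1 H3).
  - apply (is_derive_plus (V := R_NormedModule) _ _ _ _ _ H2 H4).
Qed.

Lemma Cis_derive_eq (f g : R -> C) (t : R) (l m : C) :
  (forall s, f s = g s) -> l = m -> Cis_derive f t l -> Cis_derive g t m.
Proof.
  intros E <- [H1 H2]; split.
  - eapply is_derive_ext; [|exact H1]; intros s; simpl; now rewrite E.
  - eapply is_derive_ext; [|exact H2]; intros s; simpl; now rewrite E.
Qed.

Lemma Cis_derive_mult (f g : R -> C) (t : R) (l m : C) :
  Cis_derive f t l -> Cis_derive g t m ->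
  Cis_derive (fun s => f s * g s)%C t (l * g t + f t * m)%C.
Proof.
  intros [H1 H2] [H3 H4].
  assert (P : forall (a b : R -> R) da db, is_derive a t da -> is_derive b t db ->
            is_derive (fun s => a s * b s) t (da * b t + a t * db)).
  { intros a b da db Ha Hb.
    apply (is_derive_mult (K := R_AbsRing)); auto; intros; apply Rmult_comm. }
  split; simpl.
  - evar_last; [apply (is_derive_minus (V := R_NormedModule));
      apply P; eassumption|]; unfold minus, plus, opp, Re, Im; simpl; ring.
  - evar_last; [apply (is_derive_plus (V := R_NormedModule));
      apply P; eassumption|]; unfold plus, Re, Im; simpl; ring.
Qed.

Lemma Cis_derive_scal (c : C) (f : R -> C) (t : R) (l : C) :
  Cis_derive f t l -> Cis_derive (fun s => c * f s)%C t (c * l)%C.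
Proof.
  intros H; eapply Cis_derive_eq; [reflexivity| |
    apply (Cis_derive_mult _ _ _ _ _ (Cis_derive_const c t) H)]; ring.
Qed.

Lemma Cis_derive_power_series (a : nat -> R) (f : R -> C) (t : R) (l : C) :
  entire_coeffs a -> Cis_derive f t l ->
  Cis_derive (fun s => Cpower_series a (f s)) t
    (Cpower_series (derived_coeffs a) (f t) * l)%C.
Proof.
  intros Ha Hf.
  destruct (Cpower_series_taylor a (Cmod (f t) + 1) Ha) as [M [HM H]].
  apply (Cis_derive_comp_taylor (Cpower_series a)) with (r := 1) (M := M); auto; [lra|].
  intros w Hw; apply H; [lra|].
  replace w with ((w - f t) + f t)%C by ring.
  eapply Rle_trans; [apply Cmod_triangle|lra].
Qed.

(* Logarithm of the upper half-plane, with imaginary part in (0, PI). *)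
Definition Clog_upper (z : C) : C :=
  (ln (Re z ^ 2 + Im z ^ 2) / 2, PI / 2 - atan (Re z / Im z)).

(** [atan (Re z / Im z)] is smooth on the whole upper half-plane, so the two components can be
    differentiated directly; they combine to those of [l / f t]. *)
Lemma Cis_derive_log_upper (f : R -> C) (t : R) (l : C) :
  0 < Im (f t) -> Cis_derive f t l ->
  Cis_derive (fun s => Clog_upper (f s)) t (/ f t * l)%C.
Proof.
  intros Hp [H1 H2].
  set (a := fun s => Re (f s)) in *; set (b := fun s => Im (f s)) in *.
  change (0 < b t) in Hp.
  change (is_derive a t (Re l)) in H1; change (is_derive b t (Im l)) in H2.
  assert (Da : Derive (fun x : R => a x) t = Re l) by exact (is_derive_unique _ _ _ H1).
  assert (Db : Derive (fun x : R => b x) t = Im l) by exact (is_derive_unique _ _ _ H2).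
  assert (0 < a t ^ 2 + b t ^ 2) by nra.
  assert (0 < b t * b t + a t * a t) by nra.
  split; cbn [Re Im fst snd Clog_upper Cmult Cinv].
  - change (is_derive (fun s => ln (a s ^ 2 + b s ^ 2) / 2) t
      (a t / (a t ^ 2 + b t ^ 2) * Re l - - b t / (a t ^ 2 + b t ^ 2) * Im l)).
    auto_derive.
    + repeat split; try (eexists; eassumption); simpl in *; lra.
    + rewrite Da, Db; field; simpl in *; lra.
  - change (is_derive (fun s => PI / 2 - atan (a s / b s)) t
      (a t / (a t ^ 2 + b t ^ 2) * Im l + - b t / (a t ^ 2 + b t ^ 2) * Re l)).
    auto_derive.
    + repeat split; try (eexists; eassumption); lra.
    + rewrite Da, Db; unfold Rsqr;
        field; repeat split; simpl in *; nra.
Qed.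

Section Continuity.
Context {U : UniformSpace}.
Implicit Types (f g : U -> C) (x : U).

Lemma Ccontinuous_const (c : C) x : Ccontinuous (fun _ => c) x.
Proof. split; apply continuous_const. Qed.

Lemma Ccontinuous_RtoC (f : U -> R) x :
  continuous f x -> Ccontinuous (fun s => RtoC (f s)) x.
Proof. intros H; split; simpl; [exact H|apply continuous_const]. Qed.

Lemma Ccontinuous_plus f g x :
  Ccontinuous f x -> Ccontinuous g x -> Ccontinuous (fun s => f s + g s)%C x.
Proof.
  intros [H1 H2] [H3 H4]; split; simpl.
  - apply (continuous_plus (V := R_NormedModule) _ _ _ H1 H3).
  - apply (continuous_plus (V := R_NormedModule) _ _ _ H2 H4).
Qed.

Lemma Ccontinuous_mult f g x :
  Ccontinuous f x -> Ccontinuous g x -> Ccontinuous (fun s => f s * g s)%C x.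
Proof.
  intros [H1 H2] [H3 H4]; split; simpl.
  - apply (continuous_minus (V := R_NormedModule));
      now apply (continuous_mult (K := R_AbsRing)).
  - apply (continuous_plus (V := R_NormedModule));
      now apply (continuous_mult (K := R_AbsRing)).
Qed.

Lemma Ccontinuous_ext f g x :
  (forall s, f s = g s) -> Ccontinuous f x -> Ccontinuous g x.
Proof.
  intros E [H1 H2]; split; eapply continuous_ext;
    [intros s; rewrite <- E; reflexivity| auto |intros s; rewrite <- E; reflexivity|auto].
Qed.

Lemma Ccontinuous_minus f g x :
  Ccontinuous f x -> Ccontinuous g x -> Ccontinuous (fun s => f s - g s)%C x.
Proof.
  intros H1 H2; apply (Ccontinuous_ext (fun s => f s + RtoC (-1) * g s)%C); [intros; ring|].
  apply Ccontinuous_plus; auto; apply Ccontinuous_mult; auto; apply Ccontinuous_const.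
Qed.

Lemma continuous_Rinv (f : U -> R) x :
  f x <> 0 -> continuous f x -> continuous (fun s => / f s) x.
Proof.
  intros Hn H; apply (continuous_comp f Rinv); auto.
  apply continuity_pt_filterlim, continuity_pt_inv; auto.
  apply continuity_pt_id.
Qed.

Lemma Ccontinuous_inv f x :
  f x <> 0%C -> Ccontinuous f x -> Ccontinuous (fun s => / f s)%C x.
Proof.
  intros Hn [H1 H2].
  assert (Hm : Re (f x) ^ 2 + Im (f x) ^ 2 <> 0).
  { intros E; apply Hn; apply injective_projections; simpl; unfold Re, Im in *; nra. }
  assert (Hd : continuous (fun s => / (Re (f s) ^ 2 + Im (f s) ^ 2)) x).
  { apply continuous_Rinv; auto.
    apply (continuous_ext (fun s => Re (f s) * Re (f s) + Im (f s) * Im (f s)));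
      [intros; simpl; ring|].
    apply (continuous_plus (V := R_NormedModule));
      now apply (continuous_mult (K := R_AbsRing)). }
  split; simpl.
  - now apply (continuous_mult (K := R_AbsRing)).
  - apply (continuous_mult (K := R_AbsRing)); auto.
    now apply (continuous_opp (V := R_NormedModule)).
Qed.

Lemma Ccontinuous_locally f x (eps : posreal) :
  Ccontinuous f x -> locally x (fun s => Cmod (f s - f x)%C < eps).
Proof.
  intros [H1 H2].
  assert (He : 0 < eps / 2) by (pose proof (cond_pos eps); lra).
  generalize (filter_and _ _
    (proj1 (filterlim_locally _ _) H1 (mkposreal _ He))
    (proj1 (filterlim_locally _ _) H2 (mkposreal _ He))).
  apply filter_imp; intros s [A B].
  eapply Rle_lt_trans; [apply Cmod_le_components|].
  unfold ball in *; simpl in *; unfold AbsRing_ball, abs, minus, plus, opp in *; simpl in *.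
  unfold Re, Im in *; lra.
Qed.

Lemma Ccontinuous_of_locally f x :
  (forall eps : posreal, locally x (fun s => Cmod (f s - f x)%C < eps)) ->
  Ccontinuous f x.
Proof.
  intros H; split; apply filterlim_locally; intros eps; generalize (H eps);
    apply filter_imp; intros s Hs;
    unfold ball; simpl; unfold AbsRing_ball, abs, minus, plus, opp; simpl;
    (eapply Rle_lt_trans; [|exact Hs]).
  - apply (re_le_Cmod (f s - f x)%C).
  - apply (Im_le_Cmod (f s - f x)%C).
Qed.

Lemma Ccontinuous_power_series (a : nat -> R) f x :
  entire_coeffs a -> Ccontinuous f x ->
  Ccontinuous (fun s => Cpower_series a (f s)) x.
Proof.
  intros Ha Hf; apply Ccontinuous_of_locally; intros eps.
  destruct (Cpower_series_taylor a (Cmod (f x) + 1) Ha) as [M [HM H]].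
  set (B := M + Cmod (Cpower_series (derived_coeffs a) (f x)) + 1).
  pose proof (Cmod_ge_0 (Cpower_series (derived_coeffs a) (f x))).
  assert (Hd : 0 < Rmin 1 (eps / B)).
  { apply Rmin_pos; [lra|]; apply Rdiv_lt_0_compat; [apply cond_pos|unfold B; lra]. }
  generalize (Ccontinuous_locally f x (mkposreal _ Hd) Hf).
  apply filter_imp; intros s Hs; simpl in Hs.
  set (d := Cmod (f s - f x)%C) in *.
  pose proof (Rmin_l 1 (eps / B)); pose proof (Rmin_r 1 (eps / B)).
  assert (Hd0 : 0 <= d) by apply Cmod_ge_0.
  assert (Hfs : Cmod (f s) <= Cmod (f x) + 1).
  { replace (f s) with ((f s - f x) + f x)%C by ring.
    eapply Rle_trans; [apply Cmod_triangle|unfold d in *; lra]. }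
  specialize (H (f x) (f s) ltac:(lra) Hfs).
  set (T := (_ - _ - _)%C) in H.
  replace (Cpower_series a (f s) - Cpower_series a (f x))%C with
    (T + Cpower_series (derived_coeffs a) (f x) * (f s - f x))%C by (unfold T; ring).
  eapply Rle_lt_trans; [apply Cmod_triangle|]; rewrite Cmod_mult; fold d in H |- *.
  apply Rle_lt_trans with (B * d).
  { unfold B.
    assert (M * d ^ 2 <= M * d) by (apply Rmult_le_compat_l; simpl; nra).
    nra. }
  apply Rlt_le_trans with (B * (eps / B)); [apply Rmult_lt_compat_l; unfold B in *; lra|].
  right; field; unfold B; lra.
Qed.

Lemma continuous_sqr (h : U -> R) x : continuous h x -> continuous (fun s => h s ^ 2) x.
Proof.
  intros H; apply (continuous_ext (fun s => h s * h s)); [intros s; simpl; ring|].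
  now apply (continuous_mult (K := R_AbsRing)).
Qed.

Lemma Ccontinuous_log_upper f x :
  0 < Im (f x) -> Ccontinuous f x -> Ccontinuous (fun s => Clog_upper (f s)) x.
Proof.
  intros Hp [H1 H2]; split; cbn [Re Im fst snd Clog_upper].
  - apply (continuous_mult (K := R_AbsRing)); [|apply continuous_const].
    apply (continuous_comp (fun s => Re (f s) ^ 2 + Im (f s) ^ 2) ln).
    + apply (continuous_plus (V := R_NormedModule) (fun s => Re (f s) ^ 2) (fun s => Im (f s) ^ 2));
        now apply continuous_sqr.
    + apply continuity_pt_filterlim, derivable_continuous_pt.
      eexists; apply derivable_pt_lim_ln; pose proof (pow2_ge_0 (Re (f x)));
        pose proof (pow_lt _ 2 Hp); lra.
  - apply (continuous_minus (V := R_NormedModule)); [apply continuous_const|].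
    apply (continuous_comp (fun s => Re (f s) / Im (f s)) atan).
    + apply (continuous_mult (K := R_AbsRing)); auto.
      apply (continuous_Rinv (fun s => Im (f s))); auto; lra.
    + apply continuity_pt_filterlim, derivable_continuous_pt, derivable_pt_atan.
Qed.

End Continuity.

Lemma Ccontinuous_comp {U V : UniformSpace} (f : U -> V) (g : V -> C) (x : U) :
  continuous f x -> Ccontinuous g (f x) -> Ccontinuous (fun s => g (f s)) x.
Proof.
  intros H [H1 H2]; split.
  - now apply (continuous_comp f (fun y => Re (g y))).
  - now apply (continuous_comp f (fun y => Im (g y))).
Qed.

(** * Square root, logarithm and Hankel function on the upper half-plane *)

Definition Cpolar (r a : R) : C := (r * cos a, r * sin a).

Lemma Cpolar_mult (r s a b : R) :
  (Cpolar r a * Cpolar s b)%C = Cpolar (r * s) (a + b).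
Proof.
  unfold Cpolar; rewrite cos_plus, sin_plus.
  apply injective_projections; simpl; ring.
Qed.

Lemma Cmod_polar (r a : R) : 0 <= r -> Cmod (Cpolar r a) = r.
Proof.
  intros Hr; unfold Cmod, Cpolar; simpl fst; simpl snd.
  replace ((r * cos a) ^ 2 + (r * sin a) ^ 2) with (r ^ 2 * ((sin a) ^ 2 + (cos a) ^ 2)) by ring.
  replace ((sin a) ^ 2 + (cos a) ^ 2) with 1 by (rewrite <- (sin2_cos2 a); unfold Rsqr; ring).
  now rewrite Rmult_1_r, sqrt_pow2.
Qed.

Lemma Carg_polar (r a : R) : 0 < r -> - PI < a <= PI -> Carg (Cpolar r a) = a.
Proof.
  intros Hr Ha; unfold Carg; rewrite Cmod_polar by lra; simpl.
  replace (r * cos a / r) with (cos a) by (field; lra).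
  destruct (Rle_dec 0 (r * sin a)) as [H|H].
  - apply acos_cos; split; [|lra].
    destruct (Rle_dec 0 a) as [|N]; auto.
    assert (sin a < 0) by (apply sin_lt_0_var; lra). nra.
  - rewrite <- (cos_neg a), acos_cos; [ring|].
    split; [|lra].
    destruct (Rle_dec 0 (- a)) as [|N]; auto.
    assert (0 <= sin a) by (apply sin_ge_0; lra). nra.
Qed.

(** On this half-plane [atan] alone gives the angle; the other half-planes below are carried to it
    by a rotation or a reflection. *)
Lemma polar_right_half_plane (x y : R) :
  0 < x -> (x, y) = Cpolar (Cmod (x, y)) (atan (y / x)).
Proof.
  intros Hx; set (t := y / x).
  assert (Hy : y = t * x) by (unfold t; field; lra).
  assert (Hm : Cmod (x, y) = x * sqrt (1 + t ^ 2)).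
  { unfold Cmod; simpl fst; simpl snd; rewrite Hy.
    replace (x ^ 2 + (t * x) ^ 2) with (x ^ 2 * (1 + t ^ 2)) by ring.
    rewrite sqrt_mult_alt by apply pow2_ge_0.
    rewrite sqrt_pow2 by lra; reflexivity. }
  assert (Hs : sqrt (1 + t ^ 2) <> 0).
  { apply Rgt_not_eq, sqrt_lt_R0; pose proof (pow2_ge_0 t); lra. }
  unfold Cpolar; rewrite Hm, cos_atan, sin_atan.
  replace (t²) with (t ^ 2) by (unfold Rsqr; ring).
  rewrite Hy; apply injective_projections; simpl fst; simpl snd; field; exact Hs.
Qed.

(** The doubled angle ranges over [(- PI / 2, 3 PI / 2]]; the rotation by [- Ci] moves this to
    [(- PI, PI]], the range of the principal argument. *)
Lemma Csqrt_polar (r a : R) :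
  0 < r -> - (PI / 4) < a <= 3 * (PI / 4) ->
  Csqrt (Cpolar r a * Cpolar r a)%C = Cpolar r a.
Proof.
  intros Hr Ha; rewrite Cpolar_mult.
  assert (E : (- Ci * Cpolar (r * r) (a + a))%C = Cpolar (r * r) (a + a - PI / 2)).
  { unfold Cpolar; rewrite cos_minus, sin_minus, cos_PI2, sin_PI2.
    apply injective_projections; simpl; ring. }
  unfold Csqrt, Carg_cut; rewrite E, Carg_polar, Cmod_polar, sqrt_square by nra.
  replace ((PI / 2 + (a + a - PI / 2)) / 2) with a by field.
  apply injective_projections; unfold Cpolar; simpl; ring.
Qed.

(** The open half-plane consists of the angles in [(- PI / 4, 3 PI / 4)]. It is the image of the cut
    plane under this branch, so a square root found there is the right one. *)
Lemma Csqrt_unique (w : C) : 0 < Re w + Im w -> Csqrt (w * w)%C = w.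
Proof.
  intros H.
  (* rotate the half-plane Re + Im > 0 onto the right half-plane *)
  pose proof (polar_right_half_plane (Re w + Im w) (Im w - Re w) H) as E.
  set (a := atan _) in E; set (m := Cmod _) in E.
  assert (Ha : - PI / 2 < a < PI / 2) by apply atan_bound.
  assert (Hm : 0 < m) by (apply Cmod_gt_0; intros K; apply (f_equal fst) in K; simpl in K; lra).
  assert (Hs : 0 < sqrt 2) by (apply sqrt_lt_R0; lra).
  assert (Hss : sqrt 2 * sqrt 2 = 2) by (apply sqrt_sqrt; lra).
  assert (Ew : w = Cpolar (m / sqrt 2) (a + PI / 4)).
  { unfold Cpolar in E |- *; rewrite cos_plus, sin_plus, cos_PI4, sin_PI4.
    pose proof (f_equal fst E) as E1; pose proof (f_equal snd E) as E2; simpl in E1, E2.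
    apply injective_projections; simpl.
    - transitivity ((m * cos a - m * sin a) / (sqrt 2 * sqrt 2)); [|field; lra].
      rewrite Hss, <- E1, <- E2; unfold Re, Im; field.
    - transitivity ((m * cos a + m * sin a) / (sqrt 2 * sqrt 2)); [|field; lra].
      rewrite Hss, <- E1, <- E2; unfold Re, Im; field. }
  rewrite Ew; apply Csqrt_polar; [now apply Rdiv_lt_0_compat|lra].
Qed.

(** Exchanging the coordinates maps the upper to the right half-plane and replaces the angle by its
    complement, whence [PI / 2 - atan (Re z / Im z)]. *)
Lemma upper_polar (z : C) : 0 < Im z ->
  z = Cpolar (Cmod z) (Im (Clog_upper z)) /\ 0 < Im (Clog_upper z) < PI.
Proof.
  intros H; simpl.
  pose proof (atan_bound (Re z / Im z)).
  split; [|lra].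
  pose proof (polar_right_half_plane (Im z) (Re z) H) as E.
  unfold Cpolar in *; rewrite cos_shift, sin_shift.
  pose proof (f_equal fst E) as E1; pose proof (f_equal snd E) as E2; simpl in E1, E2.
  replace (Cmod (Im z, Re z)) with (Cmod z) in E1, E2
    by (unfold Cmod, Re, Im; simpl; f_equal; ring).
  apply injective_projections; simpl; [exact E2|exact E1].
Qed.

Lemma Csqrt_upper (z : C) : 0 < Im z ->
  Csqrt z = Cpolar (sqrt (Cmod z)) (Im (Clog_upper z) / 2).
Proof.
  intros H; destruct (upper_polar z H) as [E Hb].
  assert (Hm : 0 < Cmod z) by (apply Cmod_gt_0; intros K; rewrite K in H; simpl in H; lra).
  set (m := Cmod z) in *; set (a := Im (Clog_upper z)) in *.
  rewrite E at 1.
  replace (Cpolar m a) with (Cpolar (sqrt m) (a / 2) * Cpolar (sqrt m) (a / 2))%C.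
  - apply Csqrt_polar; [now apply sqrt_lt_R0|lra].
  - rewrite Cpolar_mult, sqrt_sqrt by lra; f_equal; field.
Qed.

Lemma Csqrt_upper_sqr (z : C) : 0 < Im z -> (Csqrt z * Csqrt z)%C = z.
Proof.
  intros H; destruct (upper_polar z H) as [E _].
  rewrite (Csqrt_upper z H), Cpolar_mult, sqrt_sqrt by apply Cmod_ge_0.
  transitivity (Cpolar (Cmod z) (Im (Clog_upper z))); [f_equal; field|now symmetry].
Qed.

(** [Csqrt] and [Clog] have different cuts, but for [Im z > 0] the root has its angle in
    [(0, PI / 2)], far from the cut of the principal logarithm; halving the angle therefore halves
    the logarithm without a jump. *)
Lemma Clog_sqrt_upper (k : R) (z : C) : 0 < k -> 0 < Im z ->
  Clog (RtoC k * Csqrt z)%C = (RtoC (ln k) + / 2 * Clog_upper z)%C.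
Proof.
  intros Hk H; destruct (upper_polar z H) as [_ Hb].
  assert (Hm : 0 < Cmod z) by (apply Cmod_gt_0; intros K; rewrite K in H; simpl in H; lra).
  rewrite (Csqrt_upper z H).
  assert (Hs : 0 < sqrt (Cmod z)) by now apply sqrt_lt_R0.
  replace (RtoC k) with (Cpolar k 0)
    by (unfold Cpolar; rewrite cos_0, sin_0; apply injective_projections; simpl; ring).
  rewrite Cpolar_mult, Rplus_0_l; unfold Clog.
  assert (0 < k * sqrt (Cmod z)) by now apply Rmult_lt_0_compat.
  rewrite Carg_polar, Cmod_polar, ln_mult by lra.
  assert (E : ln (Re z ^ 2 + Im z ^ 2) = 4 * ln (sqrt (Cmod z))).
  { rewrite <- Cmod2_alt.
    replace (Cmod z ^ 2) with (sqrt (Cmod z) ^ 4).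
    - rewrite ln_pow by auto; simpl INR; ring.
    - transitivity ((sqrt (Cmod z) * sqrt (Cmod z)) ^ 2); [ring|].
      now rewrite sqrt_sqrt by lra. }
  unfold Clog_upper; rewrite E.
  apply injective_projections; simpl; field.
Qed.

(** Coefficients in the variable [(z / 2)^2]. For [z = k0 sqrt Q] this variable is [k0^2 Q / 4], so
    the square root disappears from the power series. *)
Definition bessel_coeff (n : nat) : R := (-1) ^ n / INR (fact n) ^ 2.
Definition neumann_coeff (n : nat) : R := harmonic n * bessel_coeff n.

Lemma Rabs_bessel_coeff (n : nat) : Rabs (bessel_coeff n) = / INR (fact n) ^ 2.
Proof.
  unfold bessel_coeff, Rdiv; rewrite Rabs_mult, pow_1_abs, Rmult_1_l.
  apply Rabs_pos_eq, Rlt_le, Rinv_0_lt_compat, pow_lt, INR_fact_lt_0.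
Qed.

Lemma INR_fact_ge_1 (n : nat) : 1 <= INR (fact n).
Proof. apply (le_INR 1), lt_O_fact. Qed.

(** The exponential series at [r] is a majorant. *)
Lemma entire_of_fact (a : nat -> R) :
  (forall n, Rabs (a n) <= / INR (fact n)) -> entire_coeffs a.
Proof.
  intros H r Hr; apply (ex_series_dominated _ (fun n => r ^ n / INR (fact n))).
  - intros n; split; [apply Rmult_le_pos; [apply Rabs_pos|now apply pow_le]|].
    unfold Rdiv; rewrite Rmult_comm.
    apply Rmult_le_compat_l; [now apply pow_le|apply H].
  - exists (exp r).
    eapply is_series_ext; [|apply (proj1 (is_pseries_R _ _ _) (is_exp_Reals r))].
    intros n; simpl; unfold Rdiv; ring.
Qed.

Lemma entire_bessel : entire_coeffs bessel_coeff.
Proof.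
  apply entire_of_fact; intros n; rewrite Rabs_bessel_coeff.
  pose proof (INR_fact_ge_1 n).
  apply Rinv_le_contravar; [lra|simpl; nra].
Qed.

Lemma harmonic_bounds (n : nat) : 0 <= harmonic n <= INR n.
Proof.
  unfold harmonic; induction n as [|n IH].
  - rewrite sum_n_m_zero by lia; unfold zero; simpl; lra.
  - rewrite sum_n_Sm by lia; rewrite S_INR; unfold plus; simpl.
    rewrite <- (S_INR n).
    assert (1 <= INR (S n)) by (rewrite S_INR; pose proof (pos_INR n); lra).
    assert (0 < / INR (S n)) by (apply Rinv_0_lt_compat; lra).
    assert (/ INR (S n) <= 1) by (rewrite <- Rinv_1; apply Rinv_le_contravar; lra).
    rewrite S_INR in *; lra.
Qed.

(** [harmonic n <= n <= n!] uses up one of the two factorials of the Bessel coefficient; the other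
    one remains for the exponential majorant. *)
Lemma entire_neumann : entire_coeffs neumann_coeff.
Proof.
  apply entire_of_fact; intros n; unfold neumann_coeff.
  rewrite Rabs_mult, Rabs_bessel_coeff.
  pose proof (harmonic_bounds n); pose proof (INR_fact_ge_1 n).
  rewrite Rabs_pos_eq by lra.
  assert (INR n <= INR (fact n)).
  { apply le_INR; clear; induction n as [|n IH]; [simpl; lia|].
    simpl; pose proof (lt_O_fact n); nia. }
  assert (0 < / INR (fact n)) by (apply Rinv_0_lt_compat; lra).
  apply Rle_trans with (INR (fact n) * / INR (fact n) ^ 2).
  - apply Rmult_le_compat_r; [apply Rlt_le, Rinv_0_lt_compat, pow_lt|]; lra.
  - right; field; lra.
Qed.

Lemma Cpow_sqr (z : C) (n : nat) : (z ^ (2 * n))%C = ((z * z) ^ n)%C.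
Proof.
  induction n as [|n IH]; [reflexivity|].
  replace (2 * S n)%nat with (S (S (2 * n))) by lia.
  simpl Cpow at 1 2; simpl Cpow in IH; rewrite <- IH; simpl; ring.
Qed.

Lemma bessel_term_eq (z : C) (n : nat) :
  bessel_term z n = (RtoC (bessel_coeff n) * (z * z / 4) ^ n)%C.
Proof.
  unfold bessel_term; rewrite Cpow_sqr; unfold bessel_coeff; do 2 f_equal.
  field; split; intros E; apply (f_equal fst) in E; simpl in E; lra.
Qed.

Lemma CSeries_ext (a b : nat -> C) : (forall n, a n = b n) -> CSeries a = CSeries b.
Proof.
  intros H; unfold CSeries; apply injective_projections; simpl;
    apply Series_ext; intros n; now rewrite H.
Qed.

(* The function Q |-> H_0^(1)(k0 sqrt Q) for Im Q > 0, in terms of entire functions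
   of k0^2 Q / 4 and of log Q. *)
Definition hankel_sqrt (k0 : R) (Q : C) : C :=
  let w := (RtoC (k0 ^ 2 / 4) * Q)%C in
  ((1 + (Ci * RtoC (2 / PI)) * (RtoC (ln (k0 / 2) + euler_gamma) + / 2 * Clog_upper Q))
     * Cpower_series bessel_coeff w
   - (Ci * RtoC (2 / PI)) * Cpower_series neumann_coeff w)%C.

Lemma hankel1_0_sqrt (k0 : R) (Q : C) : 0 < k0 -> 0 < Im Q ->
  hankel1_0 (RtoC k0 * Csqrt Q)%C = hankel_sqrt k0 Q.
Proof.
  intros Hk H.
  set (z := (RtoC k0 * Csqrt Q)%C).
  assert (Ez : (z * z / 4)%C = (RtoC (k0 ^ 2 / 4) * Q)%C).
  { transitivity (RtoC (k0 ^ 2 / 4) * (Csqrt Q * Csqrt Q))%C;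
      [|now rewrite Csqrt_upper_sqr].
    unfold z; apply injective_projections; simpl; field. }
  unfold hankel1_0, besselY0, besselJ0, hankel_sqrt.
  rewrite (CSeries_ext (bessel_term z)
            (fun n => RtoC (bessel_coeff n) * (RtoC (k0 ^ 2 / 4) * Q) ^ n)%C)
    by (intros n; now rewrite bessel_term_eq, Ez).
  rewrite (CSeries_ext (fun n => RtoC (harmonic n) * bessel_term z n)%C
            (fun n => RtoC (neumann_coeff n) * (RtoC (k0 ^ 2 / 4) * Q) ^ n)%C)
    by (intros n; rewrite bessel_term_eq, Ez; unfold neumann_coeff;
        rewrite RtoC_mult; ring).
  replace (z / 2)%C with (RtoC (k0 / 2) * Csqrt Q)%C.
  - rewrite Clog_sqrt_upper by lra.
    fold (Cpower_series bessel_coeff (RtoC (k0 ^ 2 / 4) * Q)).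
    fold (Cpower_series neumann_coeff (RtoC (k0 ^ 2 / 4) * Q)).
    rewrite RtoC_plus; ring.
  - unfold z; apply injective_projections; simpl; field.
Qed.

Lemma Cpower_series_0 (a : nat -> R) :
  entire_coeffs a -> Cpower_series a 0%C = RtoC (a 0%nat).
Proof.
  intros Ha.
  destruct (Cabs_summable_components _ (entire_summable a 0%C Ha)) as [H1 H2].
  assert (Z : forall r : nat -> R, (forall n, r n = 0) -> Series r = 0).
  { intros r Hr; rewrite <- (Rmult_0_l (Series r)), <- Series_scal_l.
    apply Series_ext; intros n; rewrite Hr; ring. }
  unfold Cpower_series, CSeries.
  rewrite (Series_incr_1 _ H1), (Series_incr_1 _ H2).
  rewrite !Z by (intros n; simpl; ring).
  apply injective_projections; simpl; ring.
Qed.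

Lemma bessel_coeff_0 : bessel_coeff 0 = 1.
Proof. unfold bessel_coeff; simpl; field. Qed.

(* The derivative of hankel_sqrt without its singular part i / (PI Q). *)
Definition hankel_sqrt_deriv_reg (k0 : R) (Q : C) : C :=
  let q := RtoC (k0 ^ 2 / 4) in
  let w := (q * Q)%C in
  let kap := (Ci * RtoC (2 / PI))%C in
  (kap / 2 * ((Cpower_series bessel_coeff w - 1) / Q)
   + (1 + kap * (RtoC (ln (k0 / 2) + euler_gamma) + / 2 * Clog_upper Q))
       * (Cpower_series (derived_coeffs bessel_coeff) w * q)
   - kap * (Cpower_series (derived_coeffs neumann_coeff) w * q))%C.

(** Differentiating [log Q] gives [(Ci / PI) J / Q]. Writing [J = 1 + (J - 1)] isolates the pole,
    because [J - 1] is of order [Q]. *)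
Definition hankel_sqrt_deriv (k0 : R) (Q : C) : C :=
  (Ci * RtoC (/ PI) / Q + hankel_sqrt_deriv_reg k0 Q)%C.

Lemma Im_pos_neq_0 (z : C) : 0 < Im z -> z <> 0%C.
Proof. intros H E; rewrite E in H; simpl in H; lra. Qed.

Lemma Cis_derive_hankel_sqrt (k0 : R) (f : R -> C) (t : R) (l : C) :
  0 < Im (f t) -> Cis_derive f t l ->
  Cis_derive (fun s => hankel_sqrt k0 (f s)) t (hankel_sqrt_deriv k0 (f t) * l)%C.
Proof.
  intros Hp Hf.
  set (q := RtoC (k0 ^ 2 / 4)); set (kap := (Ci * RtoC (2 / PI))%C).
  pose proof (Cis_derive_scal q f t l Hf) as Hw.
  pose proof (Cis_derive_power_series _ _ _ _ entire_bessel Hw) as HJ.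
  pose proof (Cis_derive_power_series _ _ _ _ entire_neumann Hw) as HS.
  pose proof (Cis_derive_log_upper f t l Hp Hf) as HL.
  set (c := RtoC (ln (k0 / 2) + euler_gamma)).
  pose proof (Cis_derive_plus _ _ _ _ _ (Cis_derive_const 1%C t)
    (Cis_derive_scal kap _ _ _
      (Cis_derive_plus _ _ _ _ _ (Cis_derive_const c t)
        (Cis_derive_scal (/ 2)%C _ _ _ HL)))) as HA.
  pose proof (Cis_derive_plus _ _ _ _ _ (Cis_derive_mult _ _ _ _ _ HA HJ)
    (Cis_derive_scal (- kap)%C _ _ _ HS)) as HB.
  revert HB; apply Cis_derive_eq.
  - intros s; unfold hankel_sqrt; fold q kap c; ring.
  - unfold hankel_sqrt_deriv, hankel_sqrt_deriv_reg; fold q kap c.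
    replace (Ci * RtoC (/ PI))%C with (kap / 2)%C.
    + field; now apply Im_pos_neq_0.
    + unfold kap; pose proof PI_RGT_0.
      apply injective_projections; simpl; field; lra.
Qed.

(* Syntax-directed, since [apply Ccontinuous_plus] and the like unfold the operations
   of C and the series when they do not match. *)
Ltac Ccontinuity :=
  repeat match goal with
  | |- Ccontinuous (fun _ => ?c) _ => apply Ccontinuous_const
  | |- Ccontinuous (fun _ => Cminus _ _) _ => apply Ccontinuous_minus
  | |- Ccontinuous (fun _ => Cplus _ _) _ => apply Ccontinuous_plus
  | |- Ccontinuous (fun _ => Cmult _ _) _ => apply Ccontinuous_mult
  | |- Ccontinuous (fun _ => Cinv _) _ => apply Ccontinuous_inv
  | |- Ccontinuous (fun _ => Clog_upper _) _ => apply Ccontinuous_log_upper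
  | |- Ccontinuous (fun _ => Cpower_series (derived_coeffs _) _) _ =>
      apply Ccontinuous_power_series; [apply entire_derived|]
  | |- Ccontinuous (fun _ => Cpower_series _ _) _ => apply Ccontinuous_power_series
  | |- _ => assumption
  end.

Lemma Ccontinuous_hankel_sqrt_deriv_reg {U : UniformSpace} (k0 : R) (f : U -> C) (x : U) :
  0 < Im (f x) -> Ccontinuous f x ->
  Ccontinuous (fun s => hankel_sqrt_deriv_reg k0 (f s)) x.
Proof.
  intros Hp Hf; unfold hankel_sqrt_deriv_reg, Cdiv.
  pose proof (Im_pos_neq_0 _ Hp).
  pose proof entire_bessel; pose proof entire_neumann.
  Ccontinuity.
Qed.

Lemma Ccontinuous_hankel_sqrt_deriv {U : UniformSpace} (k0 : R) (f : U -> C) (x : U) :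
  0 < Im (f x) -> Ccontinuous f x ->
  Ccontinuous (fun s => hankel_sqrt_deriv k0 (f s)) x.
Proof.
  intros Hp Hf; unfold hankel_sqrt_deriv, Cdiv.
  apply Ccontinuous_plus; [|now apply Ccontinuous_hankel_sqrt_deriv_reg].
  apply Ccontinuous_mult; [apply Ccontinuous_const|].
  apply Ccontinuous_inv; auto; now apply Im_pos_neq_0.
Qed.

Lemma Ccontinuous_hankel_sqrt {U : UniformSpace} (k0 : R) (f : U -> C) (x : U) :
  0 < Im (f x) -> Ccontinuous f x ->
  Ccontinuous (fun s => hankel_sqrt k0 (f s)) x.
Proof.
  intros Hp Hf; unfold hankel_sqrt.
  pose proof entire_bessel; pose proof entire_neumann.
  Ccontinuity.
Qed.

(** * Growth of the regular part near [Q = 0] *)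

Lemma Cpower_series_bounded (a : nat -> R) (r : R) :
  entire_coeffs a -> exists M, 0 <= M /\
    forall w, Cmod w <= r -> Cmod (Cpower_series a w) <= M.
Proof.
  intros Ha.
  assert (H : ex_series (fun n => Rabs (a n) * Rabs r ^ n)) by apply Ha, Rabs_pos.
  exists (Rabs (2 * Series (fun n => Rabs (a n) * Rabs r ^ n))).
  split; [apply Rabs_pos|]; intros w Hw.
  eapply Rle_trans; [|apply Rle_abs].
  apply CSeries_bound; auto; intros n.
  rewrite Cmod_mult, Cmod_R, Cmod_pow.
  apply Rmult_le_compat_l; [apply Rabs_pos|].
  apply pow_incr; split; [apply Cmod_ge_0|].
  eapply Rle_trans; [exact Hw|apply Rle_abs].
Qed.

(** With [mu] the fourth root of the modulus, [|ln |z|| = 4 ln (1 / mu) <= 4 / mu], and the angle is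
    below [PI <= 4 / mu]. A growth like [|z|^(-1/4)] is weak enough: it will be multiplied by a
    factor of order [|Q|^(1/2)]. *)
Lemma Clog_upper_bound (z : C) (mu : R) :
  0 < Im z -> 0 < mu <= 1 -> Cmod z = mu ^ 4 ->
  Cmod (Clog_upper z) <= 8 / mu.
Proof.
  intros H Hmu E.
  destruct (upper_polar z H) as [_ Hb].
  eapply Rle_trans; [apply Cmod_le_components|].
  rewrite (Rabs_pos_eq (Im _)) by lra.
  assert (E1 : Re (Clog_upper z) = 4 * ln mu).
  { simpl.
    replace (Re z * (Re z * 1) + Im z * (Im z * 1)) with (Cmod z ^ 2) by now rewrite Cmod2_alt.
    rewrite E, !ln_pow by (try apply pow_lt; lra); simpl; field. }
  rewrite E1, Rabs_mult, (Rabs_pos_eq 4), Rabs_left1 by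
    (try lra; rewrite <- ln_1; apply ln_le; lra).
  rewrite <- ln_Rinv by lra.
  assert (Hi : 1 <= / mu) by (rewrite <- Rinv_1 at 1; apply Rinv_le_contravar; lra).
  assert (ln (/ mu) < / mu).
  { pose proof (exp_ineq1_le (ln (/ mu))) as K; rewrite exp_ln in K by lra; lra. }
  pose proof PI_4; unfold Rdiv; lra.
Qed.

(** Only the logarithm is unbounded. For [|Q| <= 1] the argument [w] stays in the disc of radius
    [k0^2 / 4], where the power series are bounded, and [(J - 1) / Q] is bounded by Taylor's formula
    at [0]. *)
Lemma hankel_sqrt_deriv_reg_bound (k0 : R) :
  exists M, 0 <= M /\ forall Q mu, 0 < Im Q -> 0 < mu <= 1 -> Cmod Q = mu ^ 4 ->
    Cmod (hankel_sqrt_deriv_reg k0 Q) <= M / mu.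
Proof.
  set (q := k0 ^ 2 / 4).
  assert (Hq : 0 <= q) by (unfold q; pose proof (pow2_ge_0 k0); lra).
  destruct (Cpower_series_taylor _ q entire_bessel) as [M1 [H1 T1]].
  destruct (Cpower_series_bounded _ q (entire_derived _ entire_bessel)) as [M2 [H2 T2]].
  destruct (Cpower_series_bounded _ q (entire_derived _ entire_neumann)) as [M3 [H3 T3]].
  set (kap := (Ci * RtoC (2 / PI))%C); set (c := RtoC (ln (k0 / 2) + euler_gamma)).
  set (k := Cmod kap).
  assert (Hk : 0 <= k) by apply Cmod_ge_0.
  pose proof (Cmod_ge_0 c) as Hc.
  (* One summand for each of the three terms: [M1 q + M2] comes from remainder and linear part of
     [J - 1], the [8] from [Clog_upper_bound], and [M3] from the Neumann series. *)
  exists (k * ((M1 * q + M2) * q) + (1 + k * (Cmod c + 8)) * (M2 * q) + k * (M3 * q)).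
  split.
  { assert (0 <= k * (Cmod c + 8)) by (apply Rmult_le_pos; lra).
    pose proof (Rmult_le_pos _ _ H1 Hq); pose proof (Rmult_le_pos _ _ H2 Hq).
    assert (0 <= (M1 * q + M2) * q) by (apply Rmult_le_pos; lra).
    assert (0 <= k * ((M1 * q + M2) * q)) by (apply Rmult_le_pos; lra).
    assert (0 <= (1 + k * (Cmod c + 8)) * (M2 * q)) by (apply Rmult_le_pos; lra).
    assert (0 <= k * (M3 * q)) by (apply Rmult_le_pos; auto; apply Rmult_le_pos; auto).
    lra. }
  intros Q mu Hp Hmu E.
  assert (Hi : 1 <= / mu) by (rewrite <- Rinv_1 at 1; apply Rinv_le_contravar; lra).
  assert (HQ0 : 0 < Cmod Q) by (rewrite E; apply pow_lt; lra).
  assert (HQ1 : Cmod Q <= 1).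
  { rewrite E, <- (pow1 4); apply pow_incr; lra. }
  set (w := (RtoC q * Q)%C).
  assert (Ew : Cmod w = q * Cmod Q) by (unfold w; now rewrite Cmod_mult, Cmod_R, Rabs_pos_eq).
  assert (Hw : Cmod w <= q) by (rewrite Ew; nra).
  specialize (T2 w Hw) as T2w; specialize (T3 w Hw).
  assert (H0q : Cmod (RtoC 0) <= q) by now rewrite Cmod_0.
  specialize (T2 _ H0q); specialize (T1 _ w H0q Hw).
  rewrite (Cpower_series_0 _ entire_bessel), bessel_coeff_0 in T1.
  replace (w - 0)%C with w in T1 by ring.
  assert (B1 : Cmod ((Cpower_series bessel_coeff w - 1) / Q)%C <= (M1 * q + M2) * q).
  { rewrite Cmod_div by (now apply Im_pos_neq_0).
    apply Rmult_le_reg_r with (Cmod Q); auto.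
    unfold Rdiv; rewrite Rmult_assoc, Rinv_l, Rmult_1_r by lra.
    set (D := Cpower_series (derived_coeffs bessel_coeff) 0%C) in *.
    replace (_ - 1)%C with ((Cpower_series bessel_coeff w - 1 - D * w) + D * w)%C by ring.
    eapply Rle_trans; [apply Cmod_triangle|]; rewrite Cmod_mult.
    assert (M1 * Cmod w ^ 2 <= M1 * q * q * Cmod Q).
    { replace (M1 * Cmod w ^ 2) with (M1 * q * (q * (Cmod Q * Cmod Q))) by (rewrite Ew; ring).
      replace (M1 * q * q * Cmod Q) with (M1 * q * (q * Cmod Q)) by ring.
      apply Rmult_le_compat_l; [apply Rmult_le_pos; lra|].
      apply Rmult_le_compat_l; nra. }
    assert (Cmod D * Cmod w <= M2 * (q * Cmod Q)).
    { rewrite <- Ew; apply Rmult_le_compat_r; [apply Cmod_ge_0|exact T2]. }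
    lra. }
  pose proof (Clog_upper_bound Q mu Hp Hmu E) as BL.
  unfold hankel_sqrt_deriv_reg; fold q kap c; fold w.
  unfold Cminus at 1.
  eapply Rle_trans; [apply Cmod_triangle|]; rewrite Cmod_opp.
  set (A := (kap / 2 * _)%C); set (B := ((1 + _) * _)%C); set (D := (kap * _)%C).
  assert (HA : Cmod A <= k * ((M1 * q + M2) * q)).
  { unfold A; rewrite Cmod_mult; fold k.
    apply Rmult_le_compat; try apply Cmod_ge_0; auto.
    unfold Cdiv; rewrite Cmod_mult, Cmod_inv, Cmod_R, Rabs_pos_eq by
      (try lra; intros K; apply (f_equal fst) in K; simpl in K; lra).
    fold k; lra. }
  assert (HD : Cmod D <= k * (M3 * q)).
  { unfold D; rewrite !Cmod_mult, Cmod_R, (Rabs_pos_eq q) by auto; fold k.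
    apply Rmult_le_compat_l; auto; apply Rmult_le_compat_r; auto. }
  assert (HB : Cmod B <= (1 + k * (Cmod c + 8)) * / mu * (M2 * q)).
  { unfold B; rewrite !Cmod_mult, Cmod_R, (Rabs_pos_eq q) by auto.
    apply Rmult_le_compat; try apply Cmod_ge_0.
    - apply Rmult_le_pos; auto; apply Cmod_ge_0.
    - eapply Rle_trans; [apply Cmod_triangle|].
      rewrite Cmod_1, Cmod_mult; fold k.
      assert (Hs : Cmod (c + / 2 * Clog_upper Q)%C <= Cmod c + 8 / mu).
      { eapply Rle_trans; [apply Cmod_triangle|].
        rewrite Cmod_mult, Cmod_inv, Cmod_R, Rabs_pos_eq by
          (try lra; intros K; apply (f_equal fst) in K; simpl in K; lra).
        pose proof (Cmod_ge_0 (Clog_upper Q)); lra. }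
      assert (k * Cmod (c + / 2 * Clog_upper Q)%C <= k * (Cmod c + 8 / mu))
        by now apply Rmult_le_compat_l.
      assert (k * Cmod c <= k * Cmod c * / mu).
      { rewrite <- (Rmult_1_r (k * Cmod c)) at 1; apply Rmult_le_compat_l; auto.
        now apply Rmult_le_pos. }
      unfold Rdiv in *; nra.
    - apply Rmult_le_compat_r; auto. }
  pose proof (Cmod_triangle A B).
  assert (Hpos : forall a b, 0 <= a -> b <= a -> b <= a * / mu).
  { intros a b Ha Hab; apply Rle_trans with (a * 1); [lra|].
    now apply Rmult_le_compat_l. }
  assert (HA' : Cmod A <= k * ((M1 * q + M2) * q) * / mu).
  { apply Hpos; auto; eapply Rle_trans; [apply Cmod_ge_0|exact HA]. }
  assert (HD' : Cmod D <= k * (M3 * q) * / mu).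
  { apply Hpos; auto; eapply Rle_trans; [apply Cmod_ge_0|exact HD]. }
  unfold Rdiv; nra.
Qed.

(** * The fundamental solution *)

Definition qform (e1 e2 : C) (z : plane) : C :=
  (e1 * RtoC (fst z ^ 2) + e2 * RtoC (snd z ^ 2))%C.

Definition psub (x y : plane) : plane := (fst x - fst y, snd x - snd y).
Definition pdot (x y : plane) : R := fst x * fst y + snd x * snd y.

(** [plane] and [C] are the same type of pairs, so [Cmod] serves as the Euclidean norm of the
    plane. *)
Lemma Cmod_sqr (z : plane) : Cmod z ^ 2 = fst z ^ 2 + snd z ^ 2.
Proof. exact (Cmod2_alt z). Qed.

Lemma pdot_bound (z n : plane) : Rabs (pdot z n) <= Cmod z * Cmod n.
Proof.
  apply Rsqr_incr_0_var; [|apply Rmult_le_pos; apply Cmod_ge_0].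
  rewrite <- Rsqr_abs; unfold pdot, Rsqr.
  replace (Cmod z * Cmod n * (Cmod z * Cmod n)) with (Cmod z ^ 2 * Cmod n ^ 2) by ring.
  rewrite !Cmod_sqr.
  pose proof (pow2_ge_0 (fst z * snd n - snd z * fst n)); simpl in *; nra.
Qed.

Section Forms.
Variables e1 e2 : C.
Hypotheses (Hi1 : 0 < Im e1) (Hi2 : 0 < Im e2).

Lemma Im_qform (z : plane) :
  Im (qform e1 e2 z) = Im e1 * fst z ^ 2 + Im e2 * snd z ^ 2.
Proof. unfold qform; simpl; unfold Im, Re; ring. Qed.

(** The absorption makes the form coercive: [|Q(z)|] is bounded below by a multiple of [|z|^2] even
    when the real part of [Q] is indefinite. *)
Lemma Im_qform_lower (z : plane) :
  Rmin (Im e1) (Im e2) * Cmod z ^ 2 <= Im (qform e1 e2 z).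
Proof.
  rewrite Im_qform, Cmod_sqr.
  pose proof (Rmin_l (Im e1) (Im e2)); pose proof (Rmin_r (Im e1) (Im e2)).
  pose proof (pow2_ge_0 (fst z)); pose proof (pow2_ge_0 (snd z)); nra.
Qed.

Lemma qform_lower (z : plane) :
  Rmin (Im e1) (Im e2) * Cmod z ^ 2 <= Cmod (qform e1 e2 z).
Proof.
  eapply Rle_trans; [apply Im_qform_lower|].
  eapply Rle_trans; [apply Rle_abs|apply Im_le_Cmod].
Qed.

Lemma Im_qform_pos (z : plane) : z <> (0, 0) -> 0 < Im (qform e1 e2 z).
Proof.
  intros Hz; eapply Rlt_le_trans; [|apply Im_qform_lower].
  apply Rmult_lt_0_compat; [now apply Rmin_pos|].
  apply pow_lt, Cmod_gt_0; exact Hz.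
Qed.
End Forms.

(** A difference of squares in each coordinate. The factor [|u - v|] later supplies the [t^2],
    respectively the [h], that is gained when two kernels are compared. *)
Lemma qform_diff_bound (e1 e2 : C) (u v : plane) :
  Cmod (qform e1 e2 u - qform e1 e2 v)%C
    <= (Cmod e1 + Cmod e2) * (Cmod (psub u v) * (Cmod u + Cmod v)).
Proof.
  replace (_ - _)%C with (e1 * RtoC ((fst u - fst v) * (fst u + fst v))
    + e2 * RtoC ((snd u - snd v) * (snd u + snd v)))%C
    by (unfold qform; apply injective_projections; simpl; ring).
  eapply Rle_trans; [apply Cmod_triangle|].
  rewrite !Cmod_mult, !Cmod_R, !Rabs_mult.
  pose proof (re_le_Cmod (psub u v)) as A1; pose proof (Im_le_Cmod (psub u v)) as A2.
  pose proof (re_le_Cmod u); pose proof (Im_le_Cmod u).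
  pose proof (re_le_Cmod v); pose proof (Im_le_Cmod v).
  unfold psub, Re, Im in *; simpl in A1, A2.
  pose proof (Rabs_triang (fst u) (fst v)); pose proof (Rabs_triang (snd u) (snd v)).
  pose proof (Cmod_ge_0 e1); pose proof (Cmod_ge_0 e2).
  rewrite Rmult_plus_distr_r.
  apply Rplus_le_compat; apply Rmult_le_compat_l; auto;
    apply Rmult_le_compat; auto using Rabs_pos; lra.
Qed.

Section Continuity.
Context {U : UniformSpace}.

Lemma Ccontinuous_qform (e1 e2 : C) (f : U -> plane) (x : U) :
  continuous (fun s => fst (f s)) x -> continuous (fun s => snd (f s)) x ->
  Ccontinuous (fun s => qform e1 e2 (f s)) x.
Proof.
  intros H1 H2; unfold qform.
  apply Ccontinuous_plus; (apply Ccontinuous_mult; [apply Ccontinuous_const|]);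
    now apply Ccontinuous_RtoC, continuous_sqr.
Qed.

Lemma continuous_pdot (n : plane) (f : U -> plane) (x : U) :
  continuous (fun s => fst (f s)) x -> continuous (fun s => snd (f s)) x ->
  continuous (fun s => pdot (f s) n) x.
Proof.
  intros H1 H2; unfold pdot.
  apply (continuous_plus (V := R_NormedModule));
    apply (continuous_mult (K := R_AbsRing)); auto; apply continuous_const.
Qed.
End Continuity.

Lemma continuous_fst_pt {U V : UniformSpace} (p : U * V) : continuous fst p.
Proof. destruct p; apply continuous_fst. Qed.

Lemma continuous_snd_pt {U V : UniformSpace} (p : U * V) : continuous snd p.
Proof. destruct p; apply continuous_snd. Qed.

Lemma Cis_derive_ext_loc (f g : R -> C) (t : R) (l : C) :
  locally t (fun s => f s = g s) -> Cis_derive f t l -> Cis_derive g t l.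
Proof.
  intros H [H1 H2]; split; [eapply is_derive_ext_loc; [|exact H1]|
                            eapply is_derive_ext_loc; [|exact H2]];
    revert H; apply filter_imp; intros s E; now rewrite E.
Qed.

Section FundamentalSolution.
Variables (k0 : R) (e1 e2 : C).
Hypotheses (Hk : 0 < k0) (Hi1 : 0 < Im e1) (Hi2 : 0 < Im e2).

Let c := (Ci / 4 * Csqrt (e1 * e2))%C.

Lemma Phi_hankel_sqrt (x y : plane) : x <> y ->
  Phi k0 e1 e2 x y = (c * hankel_sqrt k0 (qform e1 e2 (psub x y)))%C.
Proof.
  intros H; unfold Phi, rtilde.
  rewrite <- hankel1_0_sqrt; auto.
  apply Im_qform_pos; auto; intros E; apply H.
  injection E; intros; apply injective_projections; lra.
Qed.

Lemma psub_neq_0 (x y : plane) : x <> y -> psub x y <> (0, 0).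
Proof.
  intros H E; apply H; injection E; intros; apply injective_projections; lra.
Qed.

Lemma Cis_derive_sqr_shift (y t : R) :
  Cis_derive (fun s => RtoC ((s - y) ^ 2)) t (RtoC (2 * (t - y))).
Proof.
  split; simpl.
  - auto_derive; auto; ring.
  - apply (is_derive_const (V := R_NormedModule)).
Qed.

Lemma Cis_derive_Phi_fst (x y : plane) : x <> y ->
  Cis_derive (fun s => Phi k0 e1 e2 (s, snd x) y) (fst x)
    (c * hankel_sqrt_deriv k0 (qform e1 e2 (psub x y)) * (e1 * RtoC (2 * (fst x - fst y))))%C.
Proof.
  intros H; pose proof (psub_neq_0 x y H) as Hz.
  pose proof (Im_qform_pos e1 e2 Hi1 Hi2 _ Hz) as Hp.
  assert (Hq : Cis_derive (fun s => qform e1 e2 (psub (s, snd x) y)) (fst x)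
                 (e1 * RtoC (2 * (fst x - fst y)))%C).
  { eapply Cis_derive_eq; [| |apply Cis_derive_plus;
      [apply (Cis_derive_scal e1), (Cis_derive_sqr_shift (fst y))|
       apply (Cis_derive_const (e2 * RtoC ((snd x - snd y) ^ 2))%C)]];
      [intros s; reflexivity|ring]. }
  apply (Cis_derive_hankel_sqrt k0) in Hq; [|exact Hp].
  apply (Cis_derive_scal c) in Hq.
  eapply Cis_derive_ext_loc; [|eapply Cis_derive_eq; [reflexivity| |exact Hq]];
    [|unfold psub; simpl; ring].
  (* The closed form of [Phi] is known only off [y]. Positivity of [Im Q] is an open condition that
     excludes [y], so the closed form is valid near the point. *)
  assert (Hc : continuous (fun s => Im (qform e1 e2 (psub (s, snd x) y))) (fst x)).
  { apply (Ccontinuous_qform e1 e2 (fun s => psub (s, snd x) y)); simpl;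
      [|apply continuous_const].
    apply (continuous_minus (V := R_NormedModule)); [apply continuous_id|apply continuous_const]. }
  assert (Ho : locally (fst x) (fun s => 0 < Im (qform e1 e2 (psub (s, snd x) y))))
    by exact (Hc _ (open_gt 0 _ Hp)).
  revert Ho; apply filter_imp; intros s Hs; symmetry; apply Phi_hankel_sqrt.
  intros E; rewrite Im_qform, <- E in Hs; simpl in Hs; lra.
Qed.

Lemma Cis_derive_Phi_snd (x y : plane) : x <> y ->
  Cis_derive (fun s => Phi k0 e1 e2 (fst x, s) y) (snd x)
    (c * hankel_sqrt_deriv k0 (qform e1 e2 (psub x y)) * (e2 * RtoC (2 * (snd x - snd y))))%C.
Proof.
  intros H; pose proof (psub_neq_0 x y H) as Hz.
  pose proof (Im_qform_pos e1 e2 Hi1 Hi2 _ Hz) as Hp.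
  assert (Hq : Cis_derive (fun s => qform e1 e2 (psub (fst x, s) y)) (snd x)
                 (e2 * RtoC (2 * (snd x - snd y)))%C).
  { eapply Cis_derive_eq; [| |apply Cis_derive_plus;
      [apply (Cis_derive_const (e1 * RtoC ((fst x - fst y) ^ 2))%C)|
       apply (Cis_derive_scal e2), (Cis_derive_sqr_shift (snd y))]];
      [intros s; reflexivity|ring]. }
  apply (Cis_derive_hankel_sqrt k0) in Hq; [|exact Hp].
  apply (Cis_derive_scal c) in Hq.
  eapply Cis_derive_ext_loc; [|eapply Cis_derive_eq; [reflexivity| |exact Hq]];
    [|unfold psub; simpl; ring].
  assert (Hc : continuous (fun s => Im (qform e1 e2 (psub (fst x, s) y))) (snd x)).
  { apply (Ccontinuous_qform e1 e2 (fun s => psub (fst x, s) y)); simpl;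
      [apply continuous_const|].
    apply (continuous_minus (V := R_NormedModule)); [apply continuous_id|apply continuous_const]. }
  assert (Ho : locally (snd x) (fun s => 0 < Im (qform e1 e2 (psub (fst x, s) y))))
    by exact (Hc _ (open_gt 0 _ Hp)).
  revert Ho; apply filter_imp; intros s Hs; symmetry; apply Phi_hankel_sqrt.
  intros E; rewrite Im_qform, <- E in Hs; simpl in Hs; lra.
Qed.

Lemma CDerive_unique (f : R -> C) (t : R) (l : C) : Cis_derive f t l -> CDerive f t = l.
Proof.
  intros [H1 H2]; unfold CDerive; apply injective_projections; simpl;
    now apply is_derive_unique.
Qed.

(** The derivative of [Q] in the direction [A n] is [2 (z . n)], the entries of [A] cancelling [e1]
    and [e2]. At [z = 0] the factor [pdot z n] is zero, so the formula takes the value of the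
    continuous extension there. *)
Definition dPhi_reg (n z : plane) : C :=
  (RtoC (pdot z n) * (2 * c * hankel_sqrt_deriv_reg k0 (qform e1 e2 z)))%C.

(** The constant is [2 * (Ci / 4 * s) * (Ci / PI) = - s / (2 PI)] with [s = Csqrt (e1 * e2)]. *)
Lemma dPhi_decomp (n x y : plane) : x <> y ->
  dPhi k0 e1 e2 n x y =
    (- RtoC (/ (2 * PI)) * Csqrt (e1 * e2) * (RtoC (pdot (psub x y) n) / qform e1 e2 (psub x y))
     + dPhi_reg n (psub x y))%C.
Proof.
  intros H; pose proof (psub_neq_0 x y H) as Hz.
  pose proof (Im_pos_neq_0 _ (Im_qform_pos e1 e2 Hi1 Hi2 _ Hz)) as Hq.
  pose proof (Im_pos_neq_0 _ Hi1); pose proof (Im_pos_neq_0 _ Hi2).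
  unfold dPhi, cdot, grad; simpl fst; simpl snd.
  rewrite (CDerive_unique _ _ _ (Cis_derive_Phi_fst x y H)).
  rewrite (CDerive_unique _ _ _ (Cis_derive_Phi_snd x y H)).
  unfold dPhi_reg, hankel_sqrt_deriv.
  set (Q := qform e1 e2 (psub x y)) in *; set (D := hankel_sqrt_deriv_reg k0 Q).
  transitivity (c * (Ci * RtoC (/ PI) / Q + D) * (2 * RtoC (pdot (psub x y) n)))%C.
  - unfold pdot, psub; simpl fst; simpl snd.
    rewrite !RtoC_plus, !RtoC_mult; field; auto.
  - unfold c.
    replace (RtoC (/ PI)) with (2 * RtoC (/ (2 * PI)))%C
      by (apply injective_projections; simpl; pose proof PI_RGT_0; field; lra).
    assert (Hi : (Ci * Ci = -1)%C) by (apply injective_projections; simpl; ring).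
    transitivity (Ci * Ci * RtoC (/ (2 * PI)) * Csqrt (e1 * e2) * (RtoC (pdot (psub x y) n) / Q)
      + RtoC (pdot (psub x y) n) * (2 * (Ci / 4 * Csqrt (e1 * e2)) * D))%C.
    + field; auto.
    + rewrite Hi; ring.
Qed.

Lemma Ccontinuous_dPhi_reg (n z : plane) : Ccontinuous (dPhi_reg n) z.
Proof.
  assert (Hq : Ccontinuous (fun p => qform e1 e2 p) z)
    by (apply (Ccontinuous_qform e1 e2 (fun p => p)); [apply continuous_fst_pt|apply continuous_snd_pt]).
  assert (Hd : Ccontinuous (fun p => RtoC (pdot p n)) z)
    by (apply Ccontinuous_RtoC, (continuous_pdot n (fun p => p));
        [apply continuous_fst_pt|apply continuous_snd_pt]).
  assert (Hz : z <> (0, 0) \/ z = (0, 0)).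
  { destruct z as [a b]; destruct (Req_dec a 0), (Req_dec b 0); subst; auto;
      left; intros E; injection E; intros; auto. }
  destruct Hz as [Hz| ->].
  - unfold dPhi_reg; apply Ccontinuous_mult; auto.
    apply Ccontinuous_mult; [apply Ccontinuous_const|].
    apply Ccontinuous_hankel_sqrt_deriv_reg; auto; now apply Im_qform_pos.
  - apply Ccontinuous_of_locally; intros eps.
    replace (dPhi_reg n (0, 0)) with (RtoC 0)
      by (unfold dPhi_reg, pdot; simpl; rewrite !Rmult_0_l, Rplus_0_l; ring).
    destruct (hankel_sqrt_deriv_reg_bound k0) as [M [HM HB]].
    set (m := Rmin (Im e1) (Im e2)).
    assert (Hm : 0 < m) by now apply Rmin_pos.
    (* With mu = |Q|^(1/4), |z| <= mu^2 / sqrt m while the other factor is at most M / mu *)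
    set (A := Cmod n * Cmod (2 * c)%C * M / sqrt m).
    assert (Hsm : 0 < sqrt m) by now apply sqrt_lt_R0.
    assert (HA : 0 <= A).
    { unfold A; apply Rmult_le_pos; [|apply Rlt_le, Rinv_0_lt_compat; auto].
      repeat apply Rmult_le_pos; auto; apply Cmod_ge_0. }
    set (d := Rmin 1 (eps / (A + 1))).
    assert (Hd0 : 0 < d)
      by (apply Rmin_pos; [lra|apply Rdiv_lt_0_compat; [apply cond_pos|lra]]).
    (* The neighbourhood of the origin is measured by [|Q|]: the condition [|Q| < d^4] says exactly
       that [mu < d]. *)
    assert (Hd4 : 0 < d ^ 4) by now apply pow_lt.
    generalize (Ccontinuous_locally _ _ (mkposreal _ Hd4) Hq).
    apply filter_imp; intros p Hp; simpl in Hp.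
    replace (qform e1 e2 (0, 0)) with (RtoC 0) in Hp
      by (unfold qform; apply injective_projections; simpl; ring).
    replace (qform e1 e2 p - 0)%C with (qform e1 e2 p) in Hp by ring.
    replace (dPhi_reg n p - 0)%C with (dPhi_reg n p) by ring.
    assert (Hpz : p <> (0, 0) \/ p = (0, 0)).
    { destruct p as [a b]; destruct (Req_dec a 0), (Req_dec b 0); subst; auto;
        left; intros E; injection E; intros; auto. }
    destruct Hpz as [Hpz| ->].
    2: { unfold dPhi_reg, pdot; simpl; rewrite !Rmult_0_l, Rplus_0_l, Cmult_0_l, Cmod_0;
         apply cond_pos. }
    pose proof (Im_qform_pos e1 e2 Hi1 Hi2 p Hpz) as HI.
    set (Q := qform e1 e2 p) in *.
    assert (HQ : 0 < Cmod Q) by (now apply Cmod_gt_0, Im_pos_neq_0).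
    set (mu := sqrt (sqrt (Cmod Q))).
    assert (Hs : 0 < sqrt (Cmod Q)) by now apply sqrt_lt_R0.
    assert (Hmu : 0 < mu) by now apply sqrt_lt_R0.
    assert (Hmu2 : mu ^ 2 = sqrt (Cmod Q)) by (unfold mu; rewrite pow2_sqrt; lra).
    assert (Hmu4 : Cmod Q = mu ^ 4).
    { replace (mu ^ 4) with ((mu ^ 2) ^ 2) by ring; rewrite Hmu2, pow2_sqrt; lra. }
    assert (Hmd : mu < d).
    { apply Rnot_le_lt; intros K; assert (d ^ 4 <= mu ^ 4) by (apply pow_incr; lra); lra. }
    pose proof (Rmin_l 1 (eps / (A + 1))) as L1; pose proof (Rmin_r 1 (eps / (A + 1))) as L2.
    fold d in L1, L2.
    specialize (HB Q mu HI ltac:(lra) Hmu4).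
    assert (Hp2 : Cmod p <= mu ^ 2 / sqrt m).
    { rewrite Hmu2; apply Rmult_le_reg_r with (sqrt m); auto.
      unfold Rdiv; rewrite Rmult_assoc, Rinv_l, Rmult_1_r by lra.
      rewrite <- (sqrt_pow2 (Cmod p)) by apply Cmod_ge_0.
      rewrite <- sqrt_mult_alt by apply pow2_ge_0.
      apply sqrt_le_1_alt; rewrite Rmult_comm; apply qform_lower; auto. }
    unfold dPhi_reg; fold Q; rewrite Cmod_mult, Cmod_R, Cmod_mult.
    apply Rle_lt_trans with (mu ^ 2 / sqrt m * Cmod n * (Cmod (2 * c)%C * (M / mu))).
    + apply Rmult_le_compat; [apply Rabs_pos|apply Rmult_le_pos; apply Cmod_ge_0| |].
      * eapply Rle_trans; [apply pdot_bound|].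
        apply Rmult_le_compat_r; auto; apply Cmod_ge_0.
      * apply Rmult_le_compat_l; auto; apply Cmod_ge_0.
    + replace (_ * _) with (A * mu) by (unfold A; field; lra).
      apply Rle_lt_trans with (A * (eps / (A + 1))); [apply Rmult_le_compat_l; lra|].
      pose proof (cond_pos eps).
      apply Rmult_lt_reg_r with (A + 1); [lra|].
      replace (A * (eps / (A + 1)) * (A + 1)) with (A * eps) by (field; lra); nra.
Qed.

End FundamentalSolution.

(** * The line integral *)

Definition Cis_RInt (f : R -> C) (a b : R) (I : C) : Prop :=
  is_RInt (fun t => Re (f t)) a b (Re I) /\ is_RInt (fun t => Im (f t)) a b (Im I).

Lemma Cis_RInt_spec (f : R -> C) (a b : R) (I : C) :
  Cis_RInt f a b I <-> is_RInt (V := C_R_NormedModule) f a b I.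
Proof.
  split.
  - intros [H1 H2]; destruct I as [x y]; now apply is_RInt_fct_extend_pair.
  - intros H; split; [exact (is_RInt_fct_extend_fst f a b I H)
                     |exact (is_RInt_fct_extend_snd f a b I H)].
Qed.

Lemma Cis_RInt_plus (f g : R -> C) (a b : R) (I J : C) :
  Cis_RInt f a b I -> Cis_RInt g a b J -> Cis_RInt (fun t => f t + g t)%C a b (I + J)%C.
Proof.
  rewrite !Cis_RInt_spec; apply (is_RInt_plus (V := C_R_NormedModule)).
Qed.

Lemma Cis_RInt_scal (k : C) (f : R -> C) (a b : R) (I : C) :
  Cis_RInt f a b I -> Cis_RInt (fun t => k * f t)%C a b (k * I)%C.
Proof.
  intros [H1 H2]; split; simpl.
  - apply (is_RInt_minus (V := R_NormedModule));
      now apply (is_RInt_scal (V := R_NormedModule)).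
  - apply (is_RInt_plus (V := R_NormedModule));
      now apply (is_RInt_scal (V := R_NormedModule)).
Qed.

Lemma Cis_RInt_ext (f g : R -> C) (a b : R) (I : C) :
  (forall t, Rmin a b < t < Rmax a b -> f t = g t) ->
  Cis_RInt f a b I -> Cis_RInt g a b I.
Proof. rewrite !Cis_RInt_spec; apply is_RInt_ext. Qed.

Lemma Cis_RInt_minus (f g : R -> C) (a b : R) (I J : C) :
  Cis_RInt f a b I -> Cis_RInt g a b J -> Cis_RInt (fun t => f t - g t)%C a b (I - J)%C.
Proof.
  rewrite !Cis_RInt_spec; apply (is_RInt_minus (V := C_R_NormedModule)).
Qed.

Lemma Cis_RInt_bound (f : R -> C) (b : R -> R) (x y : R) (I : C) (J : R) :
  x <= y -> (forall t, x <= t <= y -> Cmod (f t) <= b t) ->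
  Cis_RInt f x y I -> is_RInt b x y J -> Cmod I <= 2 * J.
Proof.
  intros Hxy Hb [H1 H2] HJ.
  pose proof (norm_RInt_le (V := R_NormedModule) _ b x y _ J Hxy
    (fun t Ht => Rle_trans _ _ _ (re_le_Cmod (f t)) (Hb t Ht)) H1 HJ) as B1.
  pose proof (norm_RInt_le (V := R_NormedModule) _ b x y _ J Hxy
    (fun t Ht => Rle_trans _ _ _ (Im_le_Cmod (f t)) (Hb t Ht)) H2 HJ) as B2.
  eapply Rle_trans; [apply Cmod_le_components|].
  unfold norm in B1, B2; simpl in B1, B2; unfold abs in B1, B2; simpl in B1, B2; lra.
Qed.

Lemma Cis_RInt_continuous (f : R -> C) (a b : R) :
  (forall t, Rmin a b <= t <= Rmax a b -> Ccontinuous f t) -> exists I, Cis_RInt f a b I.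
Proof.
  intros H.
  destruct (ex_RInt_continuous (V := R_CompleteNormedModule) (fun t => Re (f t)) a b) as [x Hx];
    [intros t Ht; apply (proj1 (H t Ht))|].
  destruct (ex_RInt_continuous (V := R_CompleteNormedModule) (fun t => Im (f t)) a b) as [y Hy];
    [intros t Ht; apply (proj2 (H t Ht))|].
  exists (x, y); now split.
Qed.

(** [atan (t / h)] is a primitive of the Poisson kernel and oscillates by less than [PI] whatever
    [h] is; a small factor [B] is thus as good as a small constant [A]. *)
Lemma kernel_RInt (h l A B : R) :
  0 < h -> 0 <= l -> 0 <= B ->
  exists J, is_RInt (fun t => A + B * (h / (h ^ 2 + t ^ 2))) (- l) l J /\
            J <= 2 * l * A + PI * B.
Proof.
  intros Hh Hl HB.
  exists (minus (A * l + B * atan (l / h)) (A * (- l) + B * atan (- l / h))).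
  split.
  - apply (is_RInt_derive (V := R_CompleteNormedModule) (fun t => A * t + B * atan (t / h))).
    + intros t _; auto_derive; [lra|].
      unfold Rsqr; field; split; [|lra]; pose proof (pow2_ge_0 t); simpl in *; nra.
    + intros t _; apply (@ex_derive_continuous R_AbsRing R_NormedModule); auto_derive; pose proof (pow2_ge_0 t); simpl in *; nra.
  - unfold minus, plus, opp; simpl.
    pose proof (atan_bound (l / h)); pose proof (atan_bound (- l / h)).
    assert (B * (atan (l / h) - atan (- l / h)) <= B * PI) by (apply Rmult_le_compat_l; lra).
    lra.
Qed.

Lemma Cis_RInt_kernel_bound (f : R -> C) (I : C) (h l A B : R) :
  0 < h -> 0 <= l -> 0 <= B ->
  (forall t, - l <= t <= l -> Cmod (f t) <= A + B * (h / (h ^ 2 + t ^ 2))) ->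
  Cis_RInt f (- l) l I -> Cmod I <= 4 * l * A + 2 * PI * B.
Proof.
  intros Hh Hl HB Hf HI.
  destruct (kernel_RInt h l A B Hh Hl HB) as [J [HJ HJ']].
  pose proof (Cis_RInt_bound f _ (- l) l I J ltac:(lra) Hf HI HJ); lra.
Qed.

(** Integration by real components avoids following a branch of the complex logarithm; the sign of
    [b], that is the half-plane of the pole, is carried by [atan]. *)
Lemma Cinv_line_RInt (l a b : R) : b <> 0 ->
  Cis_RInt (fun t => / (RtoC t - (a, b)))%C (- l) l
    (ln ((l - a) ^ 2 + b ^ 2) / 2 - ln ((l + a) ^ 2 + b ^ 2) / 2,
     atan ((l - a) / b) + atan ((l + a) / b)).
Proof.
  intros Hb.
  assert (Hp : forall t, 0 < (t - a) ^ 2 + b ^ 2).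
  { intros t; pose proof (pow2_ge_0 (t - a)); assert (0 < b ^ 2) by now apply pow2_gt_0.
    lra. }
  split; cbn [Re Im fst snd].
  - apply (is_RInt_ext (fun t => (t - a) / ((t - a) ^ 2 + b ^ 2)));
      [intros t _; unfold Re; simpl; field; specialize (Hp t); simpl in Hp; repeat split; nra|].
    replace ((l + a) ^ 2) with ((- l - a) ^ 2) by ring.
    apply (is_RInt_derive (V := R_CompleteNormedModule) (fun t => ln ((t - a) ^ 2 + b ^ 2) / 2)).
    + intros t _; auto_derive; [apply Hp|]; field; specialize (Hp t); simpl in Hp; nra.
    + intros t _; apply (@ex_derive_continuous R_AbsRing R_NormedModule); auto_derive; specialize (Hp t); simpl in Hp; nra.
  - apply (is_RInt_ext (fun t => b / ((t - a) ^ 2 + b ^ 2)));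
      [intros t _; unfold Im; simpl; field; specialize (Hp t); simpl in Hp; repeat split; nra|].
    replace (_ + _) with (minus (atan ((l - a) / b)) (atan ((- l - a) / b))).
    + apply (is_RInt_derive (V := R_CompleteNormedModule) (fun t => atan ((t - a) / b))).
      * intros t _; auto_derive; auto; unfold Rsqr; field; specialize (Hp t); simpl in Hp;
          repeat split; nra.
      * intros t _; apply (@ex_derive_continuous R_AbsRing R_NormedModule); auto_derive; specialize (Hp t); simpl in Hp; nra.
    + unfold minus, plus, opp; simpl.
      rewrite <- atan_opp; do 2 f_equal; field; auto.
Qed.

Definition line_value (l a b : R) : C :=
  (ln ((l - a) ^ 2 + b ^ 2) / 2 - ln ((l + a) ^ 2 + b ^ 2) / 2,
   atan ((l - a) / b) + atan ((l + a) / b)).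

(** The quotients inside [atan] blow up as [h] tends to [0]. With [atan u = PI / 2 - atan (1 / u)]
    for [u > 0] the expression becomes [G h], which is continuous at [h = 0] with value [i PI]. *)
Lemma line_value_limit_pos (l a b : R) : 0 < l -> 0 < b ->
  forall eps, 0 < eps -> exists eta, 0 < eta /\ forall h, 0 < h < eta ->
    Cmod (line_value l (h * a) (h * b) - (0, PI))%C < eps.
Proof.
  intros Hl Hb eps He.
  set (G := fun h => (ln ((l - h * a) ^ 2 + (h * b) ^ 2) / 2
                      - ln ((l + h * a) ^ 2 + (h * b) ^ 2) / 2,
                      PI - atan (h * b / (l - h * a)) - atan (h * b / (l + h * a))) : C).
  assert (HG : Ccontinuous G 0).
  { split; apply (@ex_derive_continuous R_AbsRing R_NormedModule); unfold G; simpl;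
      auto_derive; repeat split; auto; nra. }
  assert (G0 : G 0 = (0, PI)).
  { unfold G; rewrite !Rmult_0_l, Rminus_0_r, Rplus_0_r; unfold Rdiv.
    rewrite Rmult_0_l, atan_0; apply injective_projections; simpl; ring. }
  destruct (Ccontinuous_locally G 0 (mkposreal eps He) HG) as [d Hd].
  (* Below this bound [|h a| < l], so both [l - h a] and [l + h a] are positive and the reciprocal
     rule applies. *)
  assert (Ha : 0 < l / (Rabs a + 1))
    by (apply Rdiv_lt_0_compat; auto; pose proof (Rabs_pos a); lra).
  exists (Rmin d (l / (Rabs a + 1))); split; [apply Rmin_pos; auto; apply cond_pos|].
  intros h [Hh Hh'].
  pose proof (Rmin_l d (l / (Rabs a + 1))); pose proof (Rmin_r d (l / (Rabs a + 1))).
  assert (Hha : Rabs (h * a) < l).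
  { rewrite Rabs_mult, (Rabs_pos_eq h) by lra; pose proof (Rabs_pos a).
    apply Rlt_le_trans with (l / (Rabs a + 1) * (Rabs a + 1)); [nra|right; field; lra]. }
  apply Rabs_def2 in Hha.
  assert (Hhb : 0 < h * b) by nra.
  specialize (Hd h); simpl in Hd; rewrite G0 in Hd.
  replace (line_value l (h * a) (h * b)) with (G h).
  - apply Hd; unfold ball; simpl; unfold AbsRing_ball, abs, minus, plus, opp; simpl.
    rewrite Ropp_0, Rplus_0_r, Rabs_pos_eq; lra.
  - assert (A : forall x, 0 < x -> atan (x / (h * b)) = PI / 2 - atan (h * b / x)).
    { intros x Hx; rewrite <- atan_inv by now apply Rdiv_lt_0_compat.
      f_equal; field; lra. }
    unfold G, line_value; rewrite !A by lra; apply injective_projections; simpl; field.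
Qed.

(** Complex conjugation moves the pole to the upper half-plane. *)
Lemma line_value_limit_neg (l a b : R) : 0 < l -> b < 0 ->
  forall eps, 0 < eps -> exists eta, 0 < eta /\ forall h, 0 < h < eta ->
    Cmod (line_value l (h * a) (h * b) - (0, (- PI)%R))%C < eps.
Proof.
  intros Hl Hb eps He.
  destruct (line_value_limit_pos l a (- b) Hl ltac:(lra) eps He) as [eta [Heta H]].
  exists eta; split; auto; intros h Hh; specialize (H h Hh).
  rewrite <- Cmod_conj.
  replace (Cconj _) with (line_value l (h * a) (h * - b) - (0, PI))%C; auto.
  assert (A : forall x, atan (x / (h * - b)) = - atan (x / (h * b))).
  { intros x; rewrite <- atan_opp; f_equal; field; split; lra. }
  unfold line_value; rewrite !A; apply injective_projections; simpl; [|ring].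
  do 5 f_equal; ring.
Qed.

(** * Factorization of the quadratic form and the sign of the square root *)

Lemma sqrt_first_quadrant (z : C) : 0 < Im z ->
  exists p, (p * p)%C = z /\ 0 < Re p /\ 0 < Im p.
Proof.
  intros H; exists (Csqrt z); split; [now apply Csqrt_upper_sqr|].
  destruct (upper_polar z H) as [_ Hb].
  assert (0 < sqrt (Cmod z)) by (apply sqrt_lt_R0, Cmod_gt_0, Im_pos_neq_0, H).
  rewrite Csqrt_upper by auto; set (a := Im (Clog_upper z)) in *; clearbody a; unfold Cpolar; simpl.
  split; apply Rmult_lt_0_compat; auto; [apply cos_gt_0|apply sin_gt_0]; lra.
Qed.

(** The angle of [p r] could be anything below [PI], while the branch stops at [3 PI / 4]. The
    opposite signs of the real parts force one angle below [PI / 4]; the other is below [PI / 2], so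
    the sum stays in range. *)
Lemma Csqrt_mult_first_quadrant (p r : C) :
  0 < Re p -> 0 < Im p -> 0 < Re r -> 0 < Im r ->
  Re (p * p)%C * Re (r * r)%C < 0 ->
  Csqrt (p * p * (r * r))%C = (p * r)%C.
Proof.
  intros H1 H2 H3 H4 H.
  replace (p * p * (r * r))%C with (p * r * (p * r))%C by ring.
  apply Csqrt_unique.
  destruct p as [a b], r as [c d]; simpl in *.
  (* exactly one of p, r lies below the diagonal *)
  destruct (Rlt_le_dec b a), (Rlt_le_dec d c).
  - assert (0 < (a - b) * (a + b) * ((c - d) * (c + d)))
      by (repeat apply Rmult_lt_0_compat; lra); lra.
  - assert (0 < a * c) by now apply Rmult_lt_0_compat.
    assert (b * (d - c) <= a * (d - c)) by (apply Rmult_le_compat_r; lra); lra.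
  - assert (0 < a * c) by now apply Rmult_lt_0_compat.
    assert (d * (b - a) <= c * (b - a)) by (apply Rmult_le_compat_r; lra); lra.
  - assert (0 <= (b - a) * (b + a) * ((d - c) * (d + c)))
      by (repeat apply Rmult_le_pos; lra); lra.
Qed.

(** [k] is the cross product of [tau] and [n] divided by [|tau|]; its sign tells the side of the
    tangent. Only [k^2] survives in the line integral, so one computation serves both sides. *)
Lemma unit_orthogonal (tau n : plane) :
  Cmod n = 1 -> pdot n tau = 0 -> tau <> (0, 0) ->
  exists k, k ^ 2 = 1 /\ n = (- (k * snd tau) / Cmod tau, k * fst tau / Cmod tau).
Proof.
  intros Hn Ho Ht.
  assert (Hs : 0 < Cmod tau) by now apply Cmod_gt_0.
  pose proof (Cmod_sqr tau) as E; pose proof (Cmod_sqr n) as En; rewrite Hn in En.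
  destruct tau as [a b], n as [c d]; unfold pdot in Ho; simpl fst in *; simpl snd in *.
  set (s := Cmod (a, b)) in *.
  exists ((a * d - b * c) / s); split.
  - transitivity (((a ^ 2 + b ^ 2) * (c ^ 2 + d ^ 2) - (c * a + d * b) ^ 2) / s ^ 2);
      [field; lra|]; rewrite <- En, <- E, Ho; field; lra.
  - apply injective_projections; simpl.
    + transitivity ((c * (a ^ 2 + b ^ 2) - a * (c * a + d * b)) / s ^ 2);
        [rewrite <- E, Ho; field; lra|field; lra].
    + transitivity ((d * (a ^ 2 + b ^ 2) - b * (c * a + d * b)) / s ^ 2);
        [rewrite <- E, Ho; field; lra|field; lra].
Qed.

Lemma Im_quotient (x y : C) : y <> 0%C ->
  Im (x / y)%C * Cmod y ^ 2 = Im x * Re y - Re x * Im y.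
Proof.
  intros Hy; pose proof (Cmod_gt_0 y) as [K _]; specialize (K Hy).
  pose proof (Cmod2_alt y) as E; assert (0 < Cmod y ^ 2) by now apply pow_lt.
  rewrite E in *; destruct x as [a b], y as [c d]; simpl in *; field; nra.
Qed.

(** The vector to [x + h n] from the point with parameter [t] on the tangent at [x]: the model for
    [layer_pt], with the curvature removed. *)
Definition line_pt (n tau : plane) (h t : R) : plane :=
  (h * fst n - t * fst tau, h * snd n - t * snd tau).

(* Partial fractions: with e1 = p^2, e2 = r^2 the roots of the quadratic polynomial
   t |-> Q(h n - t tau) are h alpha and h beta, in opposite half-planes because p and r
   lie in the same quadrant. *)
Lemma line_integral_limit (e1 e2 : C) (tau n : plane) (l : R) :
  Re e1 * Re e2 < 0 -> 0 < Im e1 -> 0 < Im e2 ->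
  Cmod n = 1 -> pdot n tau = 0 -> tau <> (0, 0) -> 0 < l ->
  exists Lam : R -> C,
    (forall h, 0 < h ->
       Cis_RInt (fun t => RtoC h / qform e1 e2 (line_pt n tau h t))%C
         (- l) l (Lam h)) /\
    forall eps, 0 < eps -> exists eta, 0 < eta /\ forall h, 0 < h < eta ->
      Cmod (Lam h - RtoC (PI / Cmod tau) / Csqrt (e1 * e2))%C <= eps.
Proof.
  intros Hre Hi1 Hi2 Hn Ho Ht Hl.
  assert (Hs : 0 < Cmod tau) by now apply Cmod_gt_0.
  destruct (unit_orthogonal tau n Hn Ho Ht) as [k [Hk En]].
  destruct (sqrt_first_quadrant e1 Hi1) as [p [Ep [P1 P2]]].
  destruct (sqrt_first_quadrant e2 Hi2) as [r [Er [R1 R2]]].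
  assert (ES : Csqrt (e1 * e2) = (p * r)%C).
  { rewrite <- Ep, <- Er; apply Csqrt_mult_first_quadrant; auto; now rewrite Ep, Er. }
  set (s := Cmod tau) in *; set (a := fst tau); set (b := k * snd tau).
  assert (Hab : a ^ 2 + b ^ 2 = s ^ 2).
  { unfold a, b, s; rewrite Rpow_mult_distr, Hk, Cmod_sqr; ring. }
  (* [(p u)^2 + (r v)^2 = (p u + i r v) (p u - i r v)] with [u = a t + (h / s) b] and
     [v = b t - (h / s) a]. The factors are [Dp t - (h / s) Np] and [Dm t - (h / s) Nm]. *)
  set (Dp := (p * RtoC a + Ci * r * RtoC b)%C); set (Dm := (p * RtoC a - Ci * r * RtoC b)%C).
  set (Np := (Ci * r * RtoC a - p * RtoC b)%C); set (Nm := (- (Ci * r * RtoC a) - p * RtoC b)%C).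
  assert (HD : (Dp * Dm)%C <> 0%C).
  { replace (Dp * Dm)%C with (qform e1 e2 (a, b)).
    - apply Im_pos_neq_0, Im_qform_pos; auto; intros E; injection E; intros E1 E2.
      assert (0 < s ^ 2) by now apply pow_lt. rewrite <- Hab, E1, E2 in *; simpl in *; lra.
    - assert (Hi : (Ci * Ci = - (1))%C) by (apply injective_projections; simpl; ring).
      transitivity (p * p * RtoC (a ^ 2) - (Ci * Ci) * (r * r) * RtoC (b ^ 2))%C.
      + rewrite Hi, Ep, Er; unfold qform; simpl fst; simpl snd; ring.
      + unfold Dp, Dm; simpl; rewrite !RtoC_mult; ring. }
  assert (HDp : Dp <> 0%C) by (intros E; apply HD; rewrite E; ring).
  assert (HDm : Dm <> 0%C) by (intros E; apply HD; rewrite E; ring).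
  assert (Hsc : RtoC s <> 0%C) by (intros E; apply (f_equal fst) in E; simpl in E; lra).
  assert (Hpr : (p * r)%C <> 0%C) by (apply Cmult_neq_0; now apply Im_pos_neq_0).
  assert (Hp0 : p <> 0%C) by now apply Im_pos_neq_0.
  assert (Hr0 : r <> 0%C) by now apply Im_pos_neq_0.
  set (al := (Np / Dp / RtoC s)%C); set (be := (Nm / Dm / RtoC s)%C).
  assert (Hquot : forall x y : C, y <> 0%C -> 0 < Im x * Re y - Re x * Im y ->
                    0 < Im (x / y / RtoC s)%C).
  { intros x y Hy H; rewrite <- Im_quotient in H by auto.
    assert (0 < Cmod y ^ 2) by (apply pow_lt; now apply Cmod_gt_0).
    assert (0 < Im (x / y)%C) by nra.
    unfold Cdiv at 1; rewrite <- RtoC_inv by lra; unfold Im, Re in *; simpl in *.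
    rewrite Rmult_0_r, Rplus_0_l; apply Rmult_lt_0_compat; auto.
    now apply Rinv_0_lt_compat. }
  (* [Re p * Re r + Im p * Im r] is the real part of [p] times the conjugate of [r]. Up to positive
     denominators this product is the imaginary part both of [al] and of [- be]. *)
  assert (Hpos : 0 < (Re p * Re r + Im p * Im r) * (a ^ 2 + b ^ 2)).
  { rewrite Hab; apply Rmult_lt_0_compat; [nra|now apply pow_lt]. }
  assert (Hal : 0 < Im al).
  { apply Hquot; auto; unfold Np, Dp; unfold Re, Im in *; simpl in *; nra. }
  assert (Hbe : Im be < 0).
  { assert (0 < Im (- Nm / Dm / RtoC s)%C).
    { apply Hquot; auto; unfold Nm, Dm; unfold Re, Im in *; simpl in *; nra. }
    replace (- Nm / Dm / RtoC s)%C with (- be)%C in H by (unfold be; field; auto).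
    unfold Im in *; simpl in *; lra. }
  (* The coefficient of the partial fractions: [Dp Dm (al - be) = 2 i p r s]. Multiplied by
     [2 i PI], the difference of the limits from the two half-planes, it gives [PI / (p r s)]. *)
  set (c0 := (/ (2 * Ci * (p * r) * RtoC s))%C).
  set (V := fun h => line_value l (h * Re al) (h * Im al)).
  set (W := fun h => line_value l (h * Re be) (h * Im be)).
  exists (fun h => c0 * (V h - W h))%C; split.
  - intros h Hh.
    assert (HI : Cis_RInt (fun t => c0 * (/ (RtoC t - RtoC h * al) - / (RtoC t - RtoC h * be)))%C
              (- l) l (c0 * (V h - W h))%C).
    { apply Cis_RInt_scal, Cis_RInt_minus.
      - eapply Cis_RInt_ext; [|apply (Cinv_line_RInt l (h * Re al) (h * Im al)); nra].
        intros t _; apply (f_equal Cinv), injective_projections; unfold Re, Im; simpl; ring.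
      - eapply Cis_RInt_ext; [|apply (Cinv_line_RInt l (h * Re be) (h * Im be)); nra].
        intros t _; apply (f_equal Cinv), injective_projections; unfold Re, Im; simpl; ring. }
    revert HI; apply Cis_RInt_ext; intros t _.
    assert (Hta : (RtoC t - RtoC h * al)%C <> 0%C).
    { intros E; apply (f_equal snd) in E; unfold Re, Im in *; simpl in *; nra. }
    assert (Htb : (RtoC t - RtoC h * be)%C <> 0%C).
    { intros E; apply (f_equal snd) in E; unfold Re, Im in *; simpl in *; nra. }
    assert (Hi : (Ci * Ci = - (1))%C) by (apply injective_projections; simpl; ring).
    replace (qform e1 e2 _) with
      (Dp * Dm * ((RtoC t - RtoC h * al) * (RtoC t - RtoC h * be)))%C.
    + assert (HN : (Np * Dm - Nm * Dp)%C = (2 * Ci * (p * r) * (RtoC s * RtoC s))%C).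
      { rewrite <- RtoC_mult; replace (s * s) with (a * a + b * b) by (simpl in Hab; lra).
        rewrite RtoC_plus, !RtoC_mult.
        unfold Np, Nm, Dp, Dm; ring. }
      assert (HN' : (al - be)%C = (2 * Ci * (p * r) * RtoC s / (Dp * Dm))%C).
      { transitivity ((Np * Dm - Nm * Dp) / (RtoC s * (Dp * Dm)))%C;
          [unfold al, be; field; auto|rewrite HN; field; auto]. }
      assert (HC : (2 * Ci * (p * r) * RtoC s)%C <> 0%C).
      { repeat apply Cmult_neq_0; auto; intros E;
          [apply (f_equal fst) in E|apply (f_equal snd) in E]; simpl in E; lra. }
      transitivity (c0 * (RtoC h * (al - be)) /
          ((RtoC t - RtoC h * al) * (RtoC t - RtoC h * be)))%C; [field; auto|].
      rewrite HN'; unfold c0; field; repeat split; auto.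
      intros E; apply (f_equal snd) in E; simpl in E; lra.
    + transitivity ((Dp * RtoC t - RtoC (h / s) * Np) * (Dm * RtoC t - RtoC (h / s) * Nm))%C.
      { replace (RtoC (h / s)) with (RtoC h / RtoC s)%C
          by (unfold Rdiv; rewrite RtoC_mult, RtoC_inv by lra; reflexivity).
        unfold al, be; field; auto. }
      rewrite En; fold s; unfold qform, line_pt; simpl fst; simpl snd; fold a.
      set (u := (a * t + h / s * b)); set (v := (b * t - h / s * a)).
      transitivity ((p * p) * RtoC (u ^ 2) - (Ci * Ci) * (r * r) * RtoC (v ^ 2))%C.
      * simpl; unfold u, v; rewrite !Rmult_1_r, !RtoC_mult, !RtoC_minus, !RtoC_plus, !RtoC_mult.
        unfold Dp, Dm, Np, Nm; ring.
      * rewrite Hi, Ep, Er.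
        replace ((h * (- (k * snd tau) / s) - t * a) ^ 2) with (u ^ 2)
          by (unfold u, b; field; lra).
        replace ((h * (k * a / s) - t * snd tau) ^ 2) with (v ^ 2); [ring|].
        transitivity (k ^ 2 * (h * (k * a / s) - t * snd tau) ^ 2); [|rewrite Hk; ring].
        transitivity ((h * (k ^ 2 * a / s) - t * (k * snd tau)) ^ 2); [|field; lra].
        rewrite Hk; unfold v, b; field; lra.
  - intros eps He.
    set (e := eps / (2 * (Cmod c0 + 1))).
    pose proof (Cmod_ge_0 c0).
    assert (He' : 0 < e) by (apply Rdiv_lt_0_compat; lra).
    destruct (line_value_limit_pos l (Re al) (Im al) Hl Hal e He') as [h1 [Hh1 L1]].
    destruct (line_value_limit_neg l (Re be) (Im be) Hl Hbe e He') as [h2 [Hh2 L2]].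
    exists (Rmin h1 h2); split; [now apply Rmin_pos|]; intros h Hh.
    pose proof (Rmin_l h1 h2); pose proof (Rmin_r h1 h2).
    specialize (L1 h ltac:(lra)); specialize (L2 h ltac:(lra)); fold (V h) in L1; fold (W h) in L2.
    replace (RtoC (PI / s) / Csqrt (e1 * e2))%C with (c0 * ((0, PI) - (0, (- PI)%R)))%C.
    + replace (_ - _)%C with (c0 * ((V h - (0, PI)) + - (W h - (0, (- PI)%R))))%C by ring.
      rewrite Cmod_mult.
      apply Rle_trans with (Cmod c0 * (e + e)).
      * apply Rmult_le_compat_l; auto.
        eapply Rle_trans; [apply Cmod_triangle|]; rewrite Cmod_opp; lra.
      * replace (e + e) with (eps / (Cmod c0 + 1)) by (unfold e; field; lra).
        apply Rmult_le_reg_r with (Cmod c0 + 1); [lra|].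
        replace (Cmod c0 * (eps / (Cmod c0 + 1)) * (Cmod c0 + 1)) with (Cmod c0 * eps)
          by (field; lra). nra.
    + rewrite ES.
      replace ((0, PI) - (0, (- PI)%R))%C with (2 * Ci * RtoC PI)%C
        by (apply injective_projections; simpl; ring).
      replace (RtoC (PI / s)) with (RtoC PI / RtoC s)%C
        by (unfold Rdiv; rewrite RtoC_mult, RtoC_inv by lra; reflexivity).
      unfold c0; field; repeat split; auto.
      intros E; apply (f_equal snd) in E; simpl in E; lra.
Qed.

(** * The jump of the singular kernel *)

Lemma Cmod_inv_diff_bound (x y : C) (a b d : R) :
  0 < a -> 0 < b -> a <= Cmod x -> b <= Cmod y -> Cmod (y - x)%C <= d ->
  Cmod (/ x - / y)%C <= d / (a * b).
Proof.
  intros Ha Hb Hx Hy Hd.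
  assert (Hx0 : x <> 0%C) by (apply Cmod_gt_0; lra).
  assert (Hy0 : y <> 0%C) by (apply Cmod_gt_0; lra).
  replace (/ x - / y)%C with ((y - x) / (x * y))%C by (field; auto).
  rewrite Cmod_div, Cmod_mult by now apply Cmult_neq_0.
  unfold Rdiv; apply Rmult_le_compat; auto.
  - apply Cmod_ge_0.
  - apply Rlt_le, Rinv_0_lt_compat; nra.
  - apply Rinv_le_contravar; nra.
Qed.

(** Three comparisons: curve against tangent in the term with [h], distance [h] against distance [0]
    in the term with [q], and [psi] against [psi0]. In the second one [|q| <= M t^2] cancels the
    singularity of [1 / Q0]; the first two then have the same size [h (h + |t|) / (h^2 + t^2)]. *)
Lemma jump_pointwise (Qh Q0 P psi psi0 : C) (h t q m B M Psi : R) :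
  0 < h -> t <> 0 -> 0 < m -> 0 <= B -> 0 <= M ->
  m * (h ^ 2 + t ^ 2) <= Cmod Qh -> m * (h ^ 2 + t ^ 2) <= Cmod P -> m * t ^ 2 <= Cmod Q0 ->
  Cmod (P - Qh)%C <= B * (t ^ 2 * (h + Rabs t)) ->
  Cmod (Q0 - Qh)%C <= B * (h * (h + Rabs t)) ->
  Rabs q <= M * t ^ 2 -> Cmod psi <= Psi ->
  Cmod (RtoC (h - q) / Qh * psi - RtoC (- q) / Q0 * psi - RtoC h / P * psi0)%C
    <= B * (1 + M) * Psi / m ^ 2 * (h * (h + Rabs t) / (h ^ 2 + t ^ 2))
       + h / (m * (h ^ 2 + t ^ 2)) * Cmod (psi - psi0)%C.
Proof.
  intros Hh Ht Hm HB HM HQ HP HQ0 D1 D2 Hq Hpsi.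
  assert (Ht2 : 0 < t ^ 2) by now apply pow2_gt_0.
  assert (Hh2 : 0 < h ^ 2) by now apply pow_lt.
  set (r2 := h ^ 2 + t ^ 2) in *.
  assert (Hr : 0 < r2) by (unfold r2; lra).
  assert (Hmr : 0 < m * r2) by now apply Rmult_lt_0_compat.
  assert (Hmt : 0 < m * t ^ 2) by now apply Rmult_lt_0_compat.
  assert (NQ : Qh <> 0%C) by (apply Cmod_gt_0; lra).
  assert (NP : P <> 0%C) by (apply Cmod_gt_0; lra).
  assert (N0 : Q0 <> 0%C) by (apply Cmod_gt_0; lra).
  assert (HPsi : 0 <= Psi) by (eapply Rle_trans; [apply Cmod_ge_0|exact Hpsi]).
  pose proof (Rabs_pos t) as Hat.
  replace (_ - _ - _)%C with
    (RtoC h * (/ Qh - / P) * psi + (- (RtoC q * (/ Qh - / Q0) * psi)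
       + RtoC h / P * (psi - psi0)))%C
    by (rewrite RtoC_minus, RtoC_opp; field; auto).
  pose proof (Cmod_inv_diff_bound Qh P _ _ _ Hmr Hmr HQ HP D1) as E1.
  pose proof (Cmod_inv_diff_bound Qh Q0 _ _ _ Hmr Hmt HQ HQ0 D2) as E2.
  set (X := h * (h + Rabs t) / r2).
  assert (HX : 0 <= X).
  { unfold X; apply Rmult_le_pos; [nra|apply Rlt_le, Rinv_0_lt_compat, Hr]. }
  assert (T1 : Cmod (RtoC h * (/ Qh - / P) * psi)%C <= B * Psi / m ^ 2 * X).
  { rewrite !Cmod_mult, Cmod_R, (Rabs_pos_eq h) by lra.
    apply Rle_trans with (h * (B * (t ^ 2 * (h + Rabs t)) / (m * r2 * (m * r2))) * Psi).
    - apply Rmult_le_compat; auto; try apply Cmod_ge_0.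
      + apply Rmult_le_pos; [lra|apply Cmod_ge_0].
      + apply Rmult_le_compat_l; lra.
    - replace (h * _ * Psi) with (B * Psi / m ^ 2 * X * (t ^ 2 / r2))
        by (unfold X; field; lra).
      assert (0 <= B * Psi / m ^ 2 * X).
      { apply Rmult_le_pos; auto; apply Rmult_le_pos; [nra|].
        apply Rlt_le, Rinv_0_lt_compat, pow_lt, Hm. }
      assert (t ^ 2 / r2 <= 1).
      { apply Rmult_le_reg_r with r2; auto.
        unfold Rdiv; rewrite Rmult_assoc, Rinv_l by lra; unfold r2; lra. }
      rewrite <- (Rmult_1_r (B * Psi / m ^ 2 * X)) at 2.
      now apply Rmult_le_compat_l. }
  assert (T2 : Cmod (RtoC q * (/ Qh - / Q0) * psi)%C <= B * M * Psi / m ^ 2 * X).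
  { rewrite !Cmod_mult, Cmod_R.
    apply Rle_trans with (M * t ^ 2 * (B * (h * (h + Rabs t)) / (m * r2 * (m * t ^ 2))) * Psi).
    - apply Rmult_le_compat; auto; try apply Cmod_ge_0.
      + apply Rmult_le_pos; [apply Rabs_pos|apply Cmod_ge_0].
      + apply Rmult_le_compat; auto; [apply Rabs_pos|apply Cmod_ge_0].
    - right; unfold X; field; repeat split; lra. }
  assert (T3 : Cmod (RtoC h / P * (psi - psi0))%C <= h / (m * r2) * Cmod (psi - psi0)%C).
  { rewrite Cmod_mult, Cmod_div, Cmod_R, (Rabs_pos_eq h) by (auto; lra).
    apply Rmult_le_compat_r; [apply Cmod_ge_0|].
    apply Rmult_le_compat_l; [lra|]; apply Rinv_le_contravar; auto. }
  eapply Rle_trans; [apply Cmod_triangle|].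
  eapply Rle_trans; [apply Rplus_le_compat_l, Cmod_triangle|]; rewrite Cmod_opp.
  replace (B * (1 + M) * Psi / m ^ 2 * X) with (B * Psi / m ^ 2 * X + B * M * Psi / m ^ 2 * X)
    by (unfold Rdiv; ring).
  lra.
Qed.

(** Young's inequality [h |t| <= e t^2 + h^2 / e]. For fixed [e] the coefficient [(1 + 1 / e) h] of
    the Poisson kernel vanishes with [h]. *)
Lemma Rabs_mixed_bound (h t e : R) : 0 < h -> 0 < e ->
  h * (h + Rabs t) / (h ^ 2 + t ^ 2)
    <= e + (1 + / e) * h * (h / (h ^ 2 + t ^ 2)).
Proof.
  intros Hh He.
  pose proof (pow2_ge_0 t); assert (0 < h ^ 2) by now apply pow_lt.
  apply Rmult_le_reg_r with (h ^ 2 + t ^ 2); [lra|].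
  replace (_ / _ * _) with (h * (h + Rabs t)) by (field; lra).
  replace (_ * (h ^ 2 + t ^ 2)) with (e * (h ^ 2 + t ^ 2) + (1 + / e) * h ^ 2) by (field; lra).
  rewrite <- (pow2_abs t); set (x := Rabs t).
  assert (Hx : 0 <= x) by apply Rabs_pos.
  assert (Hi : 0 < / e) by now apply Rinv_0_lt_compat.
  assert (Hei : e * / e = 1) by (field; lra).
  set (i := / e) in *; clearbody i.
  assert (h * x <= e * x ^ 2 + i * h ^ 2).
  { assert (K : 0 <= i * (e * x - h / 2) ^ 2)
      by (apply Rmult_le_pos; [lra|apply pow2_ge_0]).
    replace (i * (e * x - h / 2) ^ 2)
      with (e * i * (e * x ^ 2) - e * i * (h * x) + i * h ^ 2 / 4) in K by field.
    rewrite Hei in K; nra. }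
  nra.
Qed.

Lemma continuous_bounded (f : R -> R) (l : R) : 0 <= l ->
  (forall t, continuous f t) ->
  exists M, 0 <= M /\ forall t, - l <= t <= l -> Rabs (f t) <= M.
Proof.
  intros Hl H.
  destruct (continuity_ab_maj (fun t => Rabs (f t)) (- l) l ltac:(lra)) as [x [Hx _]].
  - intros c _; apply continuity_pt_filterlim.
    apply (continuous_comp f Rabs); auto; apply continuous_Rabs.
  - exists (Rabs (f x)); split; auto; apply Rabs_pos.
Qed.

Lemma Ccontinuous_bounded (f : R -> C) (l : R) : 0 <= l ->
  (forall t, Ccontinuous f t) ->
  exists M, 0 <= M /\ forall t, - l <= t <= l -> Cmod (f t) <= M.
Proof.
  intros Hl H.
  destruct (continuous_bounded (fun t => Re (f t)) l Hl (fun t => proj1 (H t))) as [a [Ha Ba]].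
  destruct (continuous_bounded (fun t => Im (f t)) l Hl (fun t => proj2 (H t))) as [b [Hb Bb]].
  exists (a + b); split; [lra|]; intros t Ht.
  specialize (Ba t Ht); specialize (Bb t Ht).
  eapply Rle_trans; [apply Cmod_le_components|]; simpl in *; lra.
Qed.

(** The vector to [x + h n] from the curve point at parameter distance [t], the curve being given by
    its exact Taylor form with variable coefficient [kap]. *)
Definition layer_pt (n tau : plane) (kap : R -> plane) (h t : R) : plane :=
  (h * fst n - (t * fst tau + t ^ 2 * fst (kap t)),
   h * snd n - (t * snd tau + t ^ 2 * snd (kap t))).

Section Jump.
Variables (e1 e2 : C) (n tau : plane) (kap : R -> plane) (l : R).
Hypotheses (Hre : Re e1 * Re e2 < 0) (Hi1 : 0 < Im e1) (Hi2 : 0 < Im e2).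
Hypotheses (Hn : Cmod n = 1) (Hnt : pdot n tau = 0) (Hl : 0 < l).
Hypothesis kap_fst : forall t, continuous (fun s => fst (kap s)) t.
Hypothesis kap_snd : forall t, continuous (fun s => snd (kap s)) t.
Hypothesis nondegenerate : forall t, - l <= t <= l ->
  (fst tau + t * fst (kap t), snd tau + t * snd (kap t)) <> (0, 0).

(** The difference quotient of the curve at [x], completed by the tangent at [t = 0]; being
    continuous and nonzero on a compact interval, it is bounded away from [0]. *)
Let chord (t : R) : plane := (fst tau + t * fst (kap t), snd tau + t * snd (kap t)).

Lemma kap_bounded : exists M, 0 <= M /\ forall t, - l <= t <= l -> Cmod (kap t) <= M.
Proof.
  apply (Ccontinuous_bounded kap l); [lra|]; intros t; split; [apply kap_fst|apply kap_snd].
Qed.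

Lemma chord_lower : exists c, 0 < c /\ forall t, - l <= t <= l -> c <= Cmod (chord t) ^ 2.
Proof.
  destruct (continuity_ab_min (fun t => Cmod (chord t) ^ 2) (- l) l ltac:(lra))
    as [x [Hx Hx']].
  - intros c _; apply continuity_pt_filterlim.
    apply (continuous_ext (fun t => fst (chord t) * fst (chord t) + snd (chord t) * snd (chord t)));
      [intros t; rewrite Cmod_sqr; simpl; ring|].
    assert (A : forall (f : R -> R) a, (forall t, continuous f t) -> forall t,
                continuous (fun s => a + s * f s) t).
    { intros f a Hf t; apply (continuous_plus (V := R_NormedModule)); [apply continuous_const|].
      apply (continuous_mult (K := R_AbsRing)); auto; apply continuous_id. }
    apply (continuous_plus (V := R_NormedModule)); apply (continuous_mult (K := R_AbsRing));
      simpl; first [apply (A (fun s => fst (kap s))), kap_fst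
                   |apply (A (fun s => snd (kap s))), kap_snd].
  - exists (Cmod (chord x) ^ 2); split; auto.
    apply pow_lt, Cmod_gt_0, (nondegenerate x Hx').
Qed.

(** Orthogonality removes the mixed term [h t (n . tau)], so that [|z|^2 = h^2 - 2 h t^2 (kap . n) +
    t^2 |chord|^2]. The bound [h0] keeps [2 h |kap . n|] below half of the lower bound for
    [|chord|^2]. *)
Lemma layer_pt_lower : exists c h0, 0 < c /\ 0 < h0 /\
  forall h t, 0 <= h < h0 -> - l <= t <= l ->
    c * (h ^ 2 + t ^ 2) <= Cmod (layer_pt n tau kap h t) ^ 2.
Proof.
  destruct kap_bounded as [M [HM BM]], chord_lower as [c [Hc Bc]].
  exists (Rmin 1 (c / 2)), (c / (4 * (M + 1))).
  split; [apply Rmin_pos; lra|].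
  split; [apply Rdiv_lt_0_compat; lra|].
  intros h t Hh Ht; specialize (BM t Ht); specialize (Bc t Ht).
  assert (E : Cmod (layer_pt n tau kap h t) ^ 2 =
    h ^ 2 - 2 * h * t ^ 2 * pdot (kap t) n + t ^ 2 * Cmod (chord t) ^ 2).
  { transitivity (h ^ 2 * Cmod n ^ 2 - 2 * h * t * pdot n tau - 2 * h * t ^ 2 * pdot (kap t) n
       + t ^ 2 * Cmod (chord t) ^ 2); [|rewrite Hn, Hnt; ring].
    rewrite !Cmod_sqr; unfold layer_pt, chord, pdot; simpl fst; simpl snd; ring. }
  rewrite E.
  pose proof (pdot_bound (kap t) n) as K; rewrite Hn, Rmult_1_r in K.
  apply Rabs_le_between in K.
  pose proof (pow2_ge_0 t); pose proof (pow2_ge_0 h).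
  pose proof (Rmin_l 1 (c / 2)); pose proof (Rmin_r 1 (c / 2)).
  assert (HhM : h * (M + 1) <= c / 4).
  { apply Rle_trans with (c / (4 * (M + 1)) * (M + 1)); [apply Rmult_le_compat_r; lra|].
    right; field; lra. }
  assert (Hp : h * pdot (kap t) n <= c / 4).
  { apply Rle_trans with (h * (M + 1)); auto; apply Rmult_le_compat_l; lra. }
  assert (t ^ 2 * (c / 2) <= t ^ 2 * (Cmod (chord t) ^ 2 - 2 * (h * pdot (kap t) n)))
    by (apply Rmult_le_compat_l; lra).
  assert (Rmin 1 (c / 2) * h ^ 2 <= 1 * h ^ 2) by (apply Rmult_le_compat_r; lra).
  assert (Rmin 1 (c / 2) * t ^ 2 <= c / 2 * t ^ 2) by (apply Rmult_le_compat_r; lra).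
  lra.
Qed.

Variables (A : C) (Kr : plane -> C) (psi g : R -> C) (Kg : C).
Hypothesis Kr_cont : forall z, Ccontinuous Kr z.
Hypothesis psi_cont : forall t, Ccontinuous psi t.

Definition layer_integrand (h t : R) : C :=
  let z := layer_pt n tau kap h t in
  ((A * (RtoC (pdot z n) / qform e1 e2 z) + Kr z) * psi t)%C.

(** At [t = 0] the boundary integrand is a derivative of [Phi] at coinciding points, whose value
    carries no information; [g 0] is left arbitrary. *)
Hypothesis g_off : forall t, - l <= t <= l -> t <> 0 -> g t = layer_integrand 0 t.
Hypothesis g_int : Cis_RInt g (- l) l Kg.

Lemma continuous_layer_pt (p : R * R) :
  continuous (fun s => layer_pt n tau kap (fst s) (snd s)) p.
Proof.
  assert (B : forall (f : R -> R) a b, (forall t, continuous f t) ->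
     continuous (fun s : R * R => fst s * a - (snd s * b + snd s ^ 2 * f (snd s))) p).
  { intros f a b Hf.
    pose proof (@continuous_fst_pt R_UniformSpace R_UniformSpace p).
    pose proof (@continuous_snd_pt R_UniformSpace R_UniformSpace p).
    apply (continuous_minus (V := R_NormedModule)).
    - apply (continuous_mult (K := R_AbsRing)); auto; apply continuous_const.
    - apply (continuous_plus (V := R_NormedModule)).
      + apply (continuous_mult (K := R_AbsRing)); auto; apply continuous_const.
      + apply (continuous_mult (K := R_AbsRing)).
        * now apply continuous_sqr.
        * apply (continuous_comp snd f); auto. }
  unfold layer_pt.
  apply (continuous_comp_2 (fun s : R * R => fst s * fst n - (snd s * fst tau + snd s ^ 2 * fst (kap (snd s))))
    (fun s : R * R => fst s * snd n - (snd s * snd tau + snd s ^ 2 * snd (kap (snd s)))) (fun a b : R => (a, b) : plane)).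
  - apply (B (fun s => fst (kap s))), kap_fst.
  - apply (B (fun s => snd (kap s))), kap_snd.
  - apply (continuous_ext (fun q : R * R => q)); [intros [u v]; reflexivity|apply continuous_id].
Qed.

(** Uniform continuity on the rectangle [[0, 1] x [- l, l]], which contains the point where
    [layer_pt] is the origin; hence the continuity of the regular kernel there. *)
Lemma Kr_uniform (eps : R) : 0 < eps ->
  exists eta, 0 < eta /\ forall h t, 0 <= h < eta -> - l <= t <= l ->
    Cmod (Kr (layer_pt n tau kap h t) - Kr (layer_pt n tau kap 0 t))%C <= eps.
Proof.
  intros He.
  assert (He2 : 0 < eps / 2) by lra.
  assert (HC : forall p : R * R, Ccontinuous (fun s => Kr (layer_pt n tau kap (fst s) (snd s))) p).
  { intros p; apply (Ccontinuous_comp (fun s : R * R => layer_pt n tau kap (fst s) (snd s)) Kr);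
      [apply continuous_layer_pt|apply Kr_cont]. }
  destruct (uniform_continuity_2d (fun h t => Re (Kr (layer_pt n tau kap h t))) 0 1 (- l) l)
    with (eps := mkposreal _ He2) as [d1 H1].
  { intros x y _ _; apply continuity_2d_pt_filterlim; apply (proj1 (HC (x, y))). }
  destruct (uniform_continuity_2d (fun h t => Im (Kr (layer_pt n tau kap h t))) 0 1 (- l) l)
    with (eps := mkposreal _ He2) as [d2 H2].
  { intros x y _ _; apply continuity_2d_pt_filterlim; apply (proj2 (HC (x, y))). }
  exists (Rmin 1 (Rmin d1 d2)); split; [repeat apply Rmin_pos; try apply cond_pos; lra|].
  intros h t Hh Ht.
  pose proof (Rmin_l 1 (Rmin d1 d2)); pose proof (Rmin_r 1 (Rmin d1 d2)).
  pose proof (Rmin_l d1 d2); pose proof (Rmin_r d1 d2).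
  assert (Hh' : Rabs (h - 0) = h) by (rewrite Rminus_0_r; apply Rabs_pos_eq; lra).
  assert (Ht' : Rabs (t - t) = 0) by (rewrite Rminus_diag; apply Rabs_R0).
  pose proof (cond_pos d1); pose proof (cond_pos d2).
  specialize (H1 0 t h t ltac:(lra) Ht ltac:(lra) Ht ltac:(lra) ltac:(lra)).
  specialize (H2 0 t h t ltac:(lra) Ht ltac:(lra) Ht ltac:(lra) ltac:(lra)).
  simpl in H1, H2.
  eapply Rle_trans; [apply Cmod_le_components|].
  unfold Re, Im in *; simpl; unfold Rminus in *; lra.
Qed.

(** Continuity at [0] in a form valid on the whole interval: away from [0] the crude bound [2 P] is
    dominated by a multiple of [t^2]. Against the Poisson kernel that term costs at most [M h],
    since [t^2 h / (h^2 + t^2) <= h]. *)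
Lemma psi_modulus (eps : R) : 0 < eps ->
  exists M, 0 <= M /\ forall t, - l <= t <= l -> Cmod (psi t - psi 0)%C <= eps + M * t ^ 2.
Proof.
  intros He.
  destruct (Ccontinuous_bounded psi l) as [P [HP BP]]; [lra|auto|].
  destruct (Ccontinuous_locally psi 0 (mkposreal _ He) (psi_cont 0)) as [d Hd].
  pose proof (cond_pos d) as Hd0.
  assert (Hd2 : 0 < d ^ 2) by now apply pow_lt.
  exists (2 * P / d ^ 2); split.
  { apply Rmult_le_pos; [lra|apply Rlt_le, Rinv_0_lt_compat; auto]. }
  intros t Ht; pose proof (pow2_ge_0 t).
  assert (0 <= 2 * P / d ^ 2 * t ^ 2).
  { apply Rmult_le_pos; auto; apply Rmult_le_pos; [lra|apply Rlt_le, Rinv_0_lt_compat; auto]. }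
  destruct (Rlt_le_dec (Rabs t) d) as [K|K].
  - assert (Cmod (psi t - psi 0)%C < eps); [|lra].
    apply (Hd t); unfold ball; simpl; unfold AbsRing_ball, abs, minus, plus, opp; simpl.
    now rewrite Ropp_0, Rplus_0_r.
  - assert (d ^ 2 <= t ^ 2).
    { rewrite <- (pow2_abs t); apply pow_incr; lra. }
    apply Rle_trans with (2 * P / d ^ 2 * t ^ 2); [|lra].
    apply Rle_trans with (2 * P / d ^ 2 * d ^ 2).
    + replace (2 * P / d ^ 2 * d ^ 2) with (P + P) by (field; lra).
      unfold Cminus; eapply Rle_trans; [apply Cmod_triangle|]; rewrite Cmod_opp.
      pose proof (BP t Ht); pose proof (BP 0 ltac:(lra)); lra.
    + apply Rmult_le_compat_l; auto.
      apply Rmult_le_pos; [lra|apply Rlt_le, Rinv_0_lt_compat; auto].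
Qed.

Lemma pdot_layer_pt (h t : R) :
  pdot (layer_pt n tau kap h t) n = h - t ^ 2 * pdot (kap t) n.
Proof.
  pose proof (Cmod_sqr n) as E; rewrite Hn in E.
  transitivity (h * (fst n ^ 2 + snd n ^ 2) - t * pdot n tau - t ^ 2 * pdot (kap t) n).
  - unfold pdot, layer_pt; simpl; ring.
  - rewrite <- E, Hnt; ring.
Qed.

Lemma Cmod_comb (a b c : R) (u v w : C) :
  Cmod (RtoC a * u + RtoC b * v + RtoC c * w)%C
    <= Rabs a * Cmod u + Rabs b * Cmod v + Rabs c * Cmod w.
Proof.
  eapply Rle_trans; [apply Cmod_triangle|].
  eapply Rle_trans; [apply Rplus_le_compat_r, Cmod_triangle|].
  rewrite !Cmod_mult, !Cmod_R; lra.
Qed.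

Lemma jump_difference_bound : exists m X h0, 0 < m /\ 0 <= X /\ 0 < h0 /\
  forall h t, 0 < h < h0 -> - l <= t <= l -> t <> 0 ->
    let z := layer_pt n tau kap h t in
    let z0 := layer_pt n tau kap 0 t in
    Cmod (RtoC (pdot z n) / qform e1 e2 z * psi t
          - RtoC (pdot z0 n) / qform e1 e2 z0 * psi t
          - RtoC h / qform e1 e2 (line_pt n tau h t) * psi 0)%C
      <= X * (h * (h + Rabs t) / (h ^ 2 + t ^ 2))
         + h / (m * (h ^ 2 + t ^ 2)) * Cmod (psi t - psi 0)%C.
Proof.
  destruct kap_bounded as [M [HM BM]].
  destruct layer_pt_lower as [c [h0 [Hc [Hh0 LB]]]].
  destruct (Ccontinuous_bounded psi l) as [P [HP BP]]; [lra|auto|].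
  assert (Htau : tau <> (0, 0)).
  { intros E; apply (nondegenerate 0); [lra|]; rewrite E; simpl; f_equal; ring. }
  set (s := Cmod tau).
  assert (Hs : 0 < s) by now apply Cmod_gt_0.
  assert (Hs2 : 0 < s ^ 2) by now apply pow_lt.
  set (mq := Rmin (Im e1) (Im e2)).
  assert (Hmq : 0 < mq) by now apply Rmin_pos.
  (* A common lower constant: [c] serves the curve, [1] and [s^2] serve the tangent line, where
     [|z|^2 = h^2 + s^2 t^2]. *)
  set (k := Rmin c (Rmin 1 (s ^ 2))).
  assert (Hk : 0 < k) by (repeat apply Rmin_pos; auto; lra).
  assert (Hkc : k <= c) by apply Rmin_l.
  assert (Hk1 : k <= 1) by (eapply Rle_trans; [apply Rmin_r|apply Rmin_l]).
  assert (Hks : k <= s ^ 2) by (eapply Rle_trans; [apply Rmin_r|apply Rmin_r]).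
  set (E := Cmod e1 + Cmod e2).
  assert (HE : 0 <= E) by (unfold E; pose proof (Cmod_ge_0 e1); pose proof (Cmod_ge_0 e2); lra).
  (* All the vectors involved have length at most [D (h + |t|)], because [t^2 |kap| <= l M |t|]. *)
  set (D := 1 + s + l * M).
  assert (HlM : 0 <= l * M) by (apply Rmult_le_pos; lra).
  assert (HD : 1 <= D) by (unfold D; lra).
  (* [M + 1] covers both displacements, [t^2 kap] between curve and tangent and [h n] between
     distance [h] and distance [0]; [2 D] bounds the sum of the two lengths. *)
  set (B := E * ((M + 1) * (2 * D))).
  assert (HB : 0 <= B) by (unfold B; repeat apply Rmult_le_pos; lra).
  exists (mq * k), (B * (1 + M) * P / (mq * k) ^ 2), h0.
  assert (Hm : 0 < mq * k) by now apply Rmult_lt_0_compat.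
  split; [auto|split].
  { apply Rmult_le_pos; [repeat apply Rmult_le_pos; lra|].
    now apply Rlt_le, Rinv_0_lt_compat, pow_lt. }
  split; auto; intros h t Hh Ht Ht0 z z0.
  specialize (BM t Ht); pose proof (Rabs_pos t) as Hat.
  pose proof (pow2_ge_0 h); pose proof (pow2_ge_0 t).
  assert (Htl : Rabs t <= l) by (apply Rabs_le; lra).
  assert (Et : t ^ 2 = Rabs t * Rabs t) by (rewrite <- (pow2_abs t); ring).
  assert (HtM : t ^ 2 * M <= Rabs t * (l * M)).
  { rewrite Et, Rmult_assoc; apply Rmult_le_compat_l; auto; now apply Rmult_le_compat_r. }
  assert (Bz : forall h', 0 <= h' -> Cmod (layer_pt n tau kap h' t) <= D * (h' + Rabs t)).
  { intros h' Hh'.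
    replace (layer_pt n tau kap h' t) with
      (RtoC h' * n + RtoC (- t) * tau + RtoC (- t ^ 2) * kap t)%C
      by (unfold layer_pt; apply injective_projections; simpl; ring).
    eapply Rle_trans; [apply Cmod_comb|].
    rewrite Hn, !Rabs_Ropp, (Rabs_pos_eq h'), (Rabs_pos_eq (t ^ 2)) by auto; fold s.
    assert (t ^ 2 * Cmod (kap t) <= t ^ 2 * M) by now apply Rmult_le_compat_l.
    assert (0 <= (s + l * M) * h') by (apply Rmult_le_pos; lra).
    unfold D; lra. }
  assert (Bl : Cmod (line_pt n tau h t) <= D * (h + Rabs t)).
  { replace (line_pt n tau h t) with (RtoC h * n + RtoC (- t) * tau + RtoC 0 * tau)%C
      by (unfold line_pt; apply injective_projections; simpl; ring).
    eapply Rle_trans; [apply Cmod_comb|].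
    rewrite Hn, Rabs_Ropp, (Rabs_pos_eq h), Rabs_R0 by lra; fold s.
    assert (0 <= (s + l * M) * h) by (apply Rmult_le_pos; lra).
    assert (0 <= (1 + l * M) * Rabs t) by (apply Rmult_le_pos; lra).
    unfold D; lra. }
  pose proof (Bz h ltac:(lra)) as Bz1; pose proof (Bz 0 ltac:(lra)) as Bz0.
  fold z in Bz1; fold z0 in Bz0.
  assert (Bz0' : Cmod z0 <= D * (h + Rabs t)).
  { eapply Rle_trans; [exact Bz0|]; apply Rmult_le_compat_l; lra. }
  unfold z at 1, z0 at 1; rewrite !pdot_layer_pt.
  replace (0 - t ^ 2 * pdot (kap t) n) with (- (t ^ 2 * pdot (kap t) n)) by ring.
  apply (jump_pointwise _ _ _ _ _ h t _ (mq * k) B M P); auto; try lra.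
  - eapply Rle_trans; [|apply qform_lower; auto]; fold mq.
    rewrite Rmult_assoc; apply Rmult_le_compat_l; [lra|].
    eapply Rle_trans; [|apply LB; lra]; apply Rmult_le_compat_r; lra.
  - eapply Rle_trans; [|apply qform_lower; auto]; fold mq.
    rewrite Rmult_assoc; apply Rmult_le_compat_l; [lra|].
    replace (Cmod (line_pt n tau h t) ^ 2) with (h ^ 2 + s ^ 2 * t ^ 2).
    + assert (k * h ^ 2 <= 1 * h ^ 2) by (apply Rmult_le_compat_r; lra).
      assert (k * t ^ 2 <= s ^ 2 * t ^ 2) by (apply Rmult_le_compat_r; lra). lra.
    + transitivity (h ^ 2 * Cmod n ^ 2 - 2 * h * t * pdot n tau + t ^ 2 * s ^ 2);
        [rewrite Hn, Hnt; ring|].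
      unfold s; rewrite !Cmod_sqr; unfold line_pt, pdot; simpl; ring.
  - eapply Rle_trans; [|apply qform_lower; auto]; fold mq.
    rewrite Rmult_assoc; apply Rmult_le_compat_l; [lra|].
    eapply Rle_trans; [|apply LB; lra].
    replace (0 ^ 2 + t ^ 2) with (t ^ 2) by ring; apply Rmult_le_compat_r; lra.
  - eapply Rle_trans; [apply qform_diff_bound|]; fold E.
    replace (psub (line_pt n tau h t) z) with (RtoC (t ^ 2) * kap t)%C
      by (unfold z, line_pt, layer_pt, psub; apply injective_projections; simpl; ring).
    rewrite Cmod_mult, Cmod_R, (Rabs_pos_eq (t ^ 2)) by auto.
    unfold B; rewrite (Rmult_assoc E); apply Rmult_le_compat_l; auto.
    apply Rle_trans with (t ^ 2 * (M + 1) * (2 * D * (h + Rabs t))); [|right; ring].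
    apply Rmult_le_compat.
    + apply Rmult_le_pos; auto; apply Cmod_ge_0.
    + pose proof (Cmod_ge_0 (line_pt n tau h t)); pose proof (Cmod_ge_0 z); lra.
    + apply Rmult_le_compat_l; lra.
    + lra.
  - eapply Rle_trans; [apply qform_diff_bound|]; fold E.
    replace (psub z0 z) with (RtoC (- h) * n)%C
      by (unfold z, z0, layer_pt, psub; apply injective_projections; simpl; ring).
    rewrite Cmod_mult, Cmod_R, Rabs_Ropp, (Rabs_pos_eq h), Hn by lra.
    unfold B; rewrite (Rmult_assoc E); apply Rmult_le_compat_l; auto.
    apply Rle_trans with (h * (M + 1) * (2 * D * (h + Rabs t))); [|right; ring].
    apply Rmult_le_compat; try lra.
    + pose proof (Cmod_ge_0 z0); pose proof (Cmod_ge_0 z); lra.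
    + apply Rmult_le_compat_l; lra.
  - rewrite Rabs_mult, (Rabs_pos_eq (t ^ 2)), Rmult_comm by auto.
    apply Rmult_le_compat_r; auto.
    eapply Rle_trans; [apply pdot_bound|]; rewrite Hn; lra.
Qed.

(** The constants are chosen in two rounds: [e] first, depending on [eps] alone, then [h], since the
    modulus of [psi] and the factor [1 + 1 / e] depend on [e]. *)
Lemma layer_jump (V : R -> C) (h1 : R) : 0 < h1 ->
  (forall h, 0 < h < h1 -> Cis_RInt (layer_integrand h) (- l) l (V h)) ->
  forall eps, 0 < eps -> exists eta, 0 < eta /\ forall h, 0 < h < eta ->
    Cmod (V h - (Kg + A * psi 0 * (RtoC (PI / Cmod tau) / Csqrt (e1 * e2))))%C <= eps.
Proof.
  intros Hh1 HV eps Heps.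
  destruct jump_difference_bound as [m [X [h0 [Hm [HX [Hh0 JB]]]]]].
  destruct (Ccontinuous_bounded psi l) as [P [HP BP]]; [lra|auto|].
  assert (Htau : tau <> (0, 0)).
  { intros E; apply (nondegenerate 0); [lra|]; rewrite E; simpl; f_equal; ring. }
  destruct (line_integral_limit e1 e2 tau n l Hre Hi1 Hi2 Hn Hnt Htau Hl) as [Lam [HLam LLam]].
  set (a := Cmod A).
  assert (Ha : 0 <= a) by apply Cmod_ge_0.
  pose proof PI_RGT_0 as Hpi.
  assert (Him : 0 < / m) by now apply Rinv_0_lt_compat.
  (* Collects everything that is multiplied by [e] in the final estimate; [S2] below does the same
     for [h]. *)
  set (S1 := 4 * l * (a * X + P) + 2 * PI * (a * / m + 1) + a * P).
  assert (HaX : 0 <= a * X) by now apply Rmult_le_pos.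
  assert (HaP : 0 <= a * P) by now apply Rmult_le_pos.
  assert (Ham : 0 <= a * / m) by (apply Rmult_le_pos; lra).
  assert (HS1 : 0 <= S1).
  { unfold S1.
    assert (0 <= 4 * l * (a * X + P)) by (apply Rmult_le_pos; lra).
    assert (0 <= 2 * PI * (a * / m + 1)) by (apply Rmult_le_pos; lra). lra. }
  set (e := eps / (2 * (1 + S1))).
  assert (He : 0 < e) by (apply Rdiv_lt_0_compat; lra).
  assert (HeS : e * S1 <= eps / 2).
  { replace (eps / 2) with (e * (1 + S1)) by (unfold e; field; lra).
    apply Rmult_le_compat_l; lra. }
  clearbody e.
  assert (Hie : 0 < / e) by now apply Rinv_0_lt_compat.
  destruct (psi_modulus e He) as [N [HN BN]].
  destruct (Kr_uniform e He) as [h2 [Hh2 BK]].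
  destruct (LLam e He) as [h3 [Hh3 BL]].
  set (S2 := 4 * l * (a * (N * / m)) + 2 * PI * (a * X * (1 + / e))).
  assert (HaN : 0 <= a * (N * / m)) by (repeat apply Rmult_le_pos; lra).
  assert (HaXe : 0 <= a * X * (1 + / e)) by (apply Rmult_le_pos; lra).
  assert (HS2 : 0 <= S2).
  { unfold S2.
    assert (0 <= 4 * l * (a * (N * / m))) by (apply Rmult_le_pos; lra).
    assert (0 <= 2 * PI * (a * X * (1 + / e))) by (apply Rmult_le_pos; lra). lra. }
  (* Bounds the integrand at [t = 0], where the value [g 0] is arbitrary. The Poisson kernel equals
     [1 / h] there, so [h < h5] gives [G <= e / h] and the pointwise bound needs no exceptional
     point. *)
  set (G := (Cmod (Kr (layer_pt n tau kap 0 0)) + e) * P + Cmod (g 0)).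
  assert (HG : 0 <= G).
  { unfold G; pose proof (Cmod_ge_0 (g 0)); pose proof (Cmod_ge_0 (Kr (layer_pt n tau kap 0 0))).
    apply Rplus_le_le_0_compat; auto; apply Rmult_le_pos; lra. }
  set (h4 := eps / (2 * (1 + S2))); set (h5 := e / (G + 1)).
  assert (Hh4 : 0 < h4) by (apply Rdiv_lt_0_compat; lra).
  assert (Hh5 : 0 < h5) by (apply Rdiv_lt_0_compat; lra).
  set (eta := Rmin h0 (Rmin h1 (Rmin h2 (Rmin h3 (Rmin h4 h5))))).
  exists eta; split; [repeat apply Rmin_pos; auto|]; intros h [Hh Hhe].
  pose proof (Rmin_l h0 (Rmin h1 (Rmin h2 (Rmin h3 (Rmin h4 h5))))).
  pose proof (Rmin_r h0 (Rmin h1 (Rmin h2 (Rmin h3 (Rmin h4 h5))))).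
  pose proof (Rmin_l h1 (Rmin h2 (Rmin h3 (Rmin h4 h5)))).
  pose proof (Rmin_r h1 (Rmin h2 (Rmin h3 (Rmin h4 h5)))).
  pose proof (Rmin_l h2 (Rmin h3 (Rmin h4 h5))); pose proof (Rmin_r h2 (Rmin h3 (Rmin h4 h5))).
  pose proof (Rmin_l h3 (Rmin h4 h5)); pose proof (Rmin_r h3 (Rmin h4 h5)).
  pose proof (Rmin_l h4 h5); pose proof (Rmin_r h4 h5).
  fold eta in H, H0.
  specialize (BL h ltac:(lra)).
  specialize (HV h ltac:(lra)); specialize (HLam h Hh).
  (* [E1] is the constant part of the pointwise bound and [E2] the coefficient of the Poisson
     kernel; the last [e] in [E2] pays for [t = 0]. *)
  set (E1 := a * (X * e + N * / m * h) + e * P).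
  set (E2 := a * (X * (1 + / e) * h + e * / m) + e).
  assert (HE2a : 0 <= a * (X * (1 + / e) * h + e * / m)).
  { apply Rmult_le_pos; auto; apply Rplus_le_le_0_compat; repeat apply Rmult_le_pos; lra. }
  assert (HE2 : 0 <= E2) by (unfold E2; lra).
  assert (HE1 : 0 <= E1).
  { unfold E1; apply Rplus_le_le_0_compat; [apply Rmult_le_pos; auto;
      apply Rplus_le_le_0_compat|]; repeat apply Rmult_le_pos; lra. }
  pose proof (Cis_RInt_minus _ _ _ _ _ _ (Cis_RInt_minus _ _ _ _ _ _ HV g_int)
    (Cis_RInt_scal (A * psi 0)%C _ _ _ _ HLam)) as HI.
  assert (HB : Cmod (V h - Kg - A * psi 0 * Lam h)%C <= 4 * l * E1 + 2 * PI * E2).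
  { apply (Cis_RInt_kernel_bound _ _ h l E1 E2 Hh ltac:(lra) HE2) in HI; auto.
    intros t Ht; pose proof (pow2_ge_0 t) as Ht2.
    assert (Hh2' : 0 < h ^ 2) by now apply pow_lt.
    set (r2 := h ^ 2 + t ^ 2); assert (Hr : 0 < r2) by (unfold r2; lra).
    set (kr := h / r2).
    assert (Hkr : 0 <= kr) by (apply Rmult_le_pos; [lra|apply Rlt_le, Rinv_0_lt_compat; auto]).
    pose proof (BK h t ltac:(lra) Ht) as BKt.
    pose proof (BP t Ht) as BPt.
    destruct (Req_dec t 0) as [E|Ht0].
    - subst t.
      assert (El : line_pt n tau h 0 = layer_pt n tau kap h 0)
        by (unfold line_pt, layer_pt; f_equal; ring).
      unfold layer_integrand; rewrite pdot_layer_pt, El.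
      replace (h - 0 ^ 2 * pdot (kap 0) n) with h by ring.
      replace (_ - _ - _)%C with (Kr (layer_pt n tau kap h 0) * psi 0 - g 0)%C
        by (unfold Cdiv; ring).
      apply Rle_trans with G.
      + unfold Cminus; eapply Rle_trans; [apply Cmod_triangle|]; rewrite Cmod_opp, Cmod_mult.
        unfold G; apply Rplus_le_compat_r; apply Rmult_le_compat; auto; try apply Cmod_ge_0.
        replace (Kr (layer_pt n tau kap h 0)) with
          (Kr (layer_pt n tau kap 0 0) +
           (Kr (layer_pt n tau kap h 0) - Kr (layer_pt n tau kap 0 0)))%C by ring.
        eapply Rle_trans; [apply Cmod_triangle|]; lra.
      + assert (Ek : kr = / h) by (unfold kr, r2; field; lra).
        assert (G <= e * kr).
        { rewrite Ek; apply Rmult_le_reg_r with h; auto.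
          rewrite Rmult_assoc, Rinv_l, Rmult_1_r by lra.
          apply Rle_trans with ((G + 1) * h5); [apply Rmult_le_compat; lra|].
          right; unfold h5; field; lra. }
        assert (e * kr <= E2 * kr) by (apply Rmult_le_compat_r; unfold E2; lra).
        lra.
    - specialize (JB h t ltac:(lra) Ht Ht0); specialize (BN t Ht).
      cbv zeta in JB.
      rewrite (g_off t Ht Ht0); unfold layer_integrand.
      set (z := layer_pt n tau kap h t) in *; set (z0 := layer_pt n tau kap 0 t) in *.
      set (J := (_ - _ - _)%C) in JB.
      replace (_ - _ - _)%C with (A * J + (Kr z - Kr z0) * psi t)%C
        by (unfold J, Cdiv; ring).
      eapply Rle_trans; [apply Cmod_triangle|]; rewrite !Cmod_mult; fold a.
      assert (K1 : Cmod (Kr z - Kr z0)%C * Cmod (psi t) <= e * P)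
        by (apply Rmult_le_compat; auto; apply Cmod_ge_0).
      pose proof (Rabs_mixed_bound h t e Hh He) as MB; fold r2 kr in MB, JB.
      assert (Ek : h / (m * r2) = / m * kr) by (unfold kr; field; lra).
      rewrite Ek in JB.
      assert (K2 : kr * t ^ 2 <= h).
      { unfold kr; apply Rmult_le_reg_r with r2; auto.
        replace (h / r2 * t ^ 2 * r2) with (h * t ^ 2) by (field; lra).
        apply Rmult_le_compat_l; unfold r2; lra. }
      assert (K3 : Cmod J <= X * e + N * / m * h + (X * (1 + / e) * h + e * / m) * kr).
      { eapply Rle_trans; [exact JB|].
        assert (X * (h * (h + Rabs t) / r2) <= X * (e + (1 + / e) * h * kr))
          by now apply Rmult_le_compat_l.
        assert (/ m * kr * Cmod (psi t - psi 0)%C <= / m * kr * (e + N * t ^ 2))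
          by (apply Rmult_le_compat_l; auto; apply Rmult_le_pos; lra).
        assert (N * / m * (kr * t ^ 2) <= N * / m * h)
          by (apply Rmult_le_compat_l; auto; apply Rmult_le_pos; lra).
        lra. }
      assert (K4 : a * Cmod J <= a * (X * e + N * / m * h + (X * (1 + / e) * h + e * / m) * kr))
        by now apply Rmult_le_compat_l.
      assert (0 <= e * kr) by (apply Rmult_le_pos; lra).
      unfold E1, E2; lra. }
  replace (_ - _)%C with ((V h - Kg - A * psi 0 * Lam h)
    + A * psi 0 * (Lam h - RtoC (PI / Cmod tau) / Csqrt (e1 * e2)))%C by ring.
  eapply Rle_trans; [apply Cmod_triangle|]; rewrite (Cmod_mult (A * psi 0)%C), Cmod_mult; fold a.
  assert (B2 : a * Cmod (psi 0) * Cmod (Lam h - RtoC (PI / Cmod tau) / Csqrt (e1 * e2))%C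
             <= a * P * e).
  { apply Rmult_le_compat; auto; try apply Cmod_ge_0.
    - apply Rmult_le_pos; auto; apply Cmod_ge_0.
    - apply Rmult_le_compat_l; auto; apply BP; lra. }
  assert (Esum : 4 * l * E1 + 2 * PI * E2 + a * P * e = e * S1 + S2 * h)
    by (unfold E1, E2, S1, S2; ring).
  assert (S2 * h <= eps / 2).
  { apply Rle_trans with ((1 + S2) * h4); [apply Rmult_le_compat; lra|].
    right; unfold h4; field; lra. }
  lra.
Qed.

End Jump.

(** * Differentiation of the potential *)

(** The real theorem is used once for an abstract projection [pr], then specialized to [Re] and
    [Im]. *)
Lemma Cis_derive_RInt_param (F dF : R -> R -> C) (v : R -> C) (a b s0 : R) (J : C) :
  locally s0 (fun s => forall t, Cis_derive (fun u => F u t) s (dF s t)) ->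
  (forall t, Rmin a b <= t <= Rmax a b ->
     Ccontinuous (fun p : R * R => dF (fst p) (snd p)) (s0, t)) ->
  locally s0 (fun s => Cis_RInt (F s) a b (v s)) ->
  Cis_RInt (dF s0) a b J ->
  Cis_derive v s0 J.
Proof.
  intros HD HC HI [J1 J2].
  assert (P : forall pr : C -> R,
    (forall f t l, Cis_derive f t l -> is_derive (fun s => pr (f s)) t (pr l)) ->
    (forall t, Rmin a b <= t <= Rmax a b ->
       continuous (fun p : R * R => pr (dF (fst p) (snd p))) (s0, t)) ->
    locally s0 (fun s => is_RInt (fun t => pr (F s t)) a b (pr (v s))) ->
    is_RInt (fun t => pr (dF s0 t)) a b (pr J) ->
    is_derive (fun s => pr (v s)) s0 (pr J)).
  { intros pr Hpr Hc Hi Hj.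
    apply (is_derive_ext_loc (fun s => RInt (fun t => pr (F s t)) a b)).
    { revert Hi; apply filter_imp; intros s Hs; now apply is_RInt_unique. }
    assert (E : RInt (fun t => Derive (fun u => pr (F u t)) s0) a b = pr J).
    { apply is_RInt_unique; revert Hj; apply is_RInt_ext; intros t _; symmetry.
      apply is_derive_unique, Hpr; apply (locally_singleton _ _ HD). }
    rewrite <- E; apply (is_derive_RInt_param (fun s t => pr (F s t))).
    - revert HD; apply filter_imp; intros s Hs t _.
      exists (pr (dF s t)); apply (Hpr (fun u => F u t)), Hs.
    - intros t Ht; apply (continuity_2d_pt_ext_loc (fun u w => pr (dF u w))).
      + destruct HD as [d Hd]; exists d; intros u w Hu Hw; symmetry.
        apply is_derive_unique, (Hpr (fun y => F y w)), Hd; exact Hu.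
      + apply continuity_2d_pt_filterlim, (Hc t Ht).
    - revert Hi; apply filter_imp; intros s Hs; now exists (pr (v s)). }
  split.
  - apply (P Re); auto.
    + intros f t l H; apply H.
    + intros t Ht; apply (HC t Ht).
    + revert HI; apply filter_imp; intros s Hs; apply Hs.
  - apply (P Im); auto.
    + intros f t l H; apply H.
    + intros t Ht; apply (HC t Ht).
    + revert HI; apply filter_imp; intros s Hs; apply Hs.
Qed.

Lemma Cis_derive_ex_derive (f : R -> C) (t : R) (l : C) :
  Cis_derive f t l -> ex_derive (V := C_R_NormedModule) f t.
Proof.
  intros [H1 H2].
  apply (ex_derive_ext (V := C_R_NormedModule)
    (fun s => plus (scal (Re (f s)) (RtoC 1 : C_R_NormedModule))
                   (scal (Im (f s)) (Ci : C_R_NormedModule)))).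
  - intros s; apply injective_projections.
    + change (fst (f s) * 1 + snd (f s) * 0 = fst (f s)); ring.
    + change (fst (f s) * 0 + snd (f s) * 1 = snd (f s)); ring.
  - apply (ex_derive_plus (V := C_R_NormedModule)).
    + eexists; apply (is_derive_scal_l (V := C_R_NormedModule)); exact H1.
    + eexists; apply (is_derive_scal_l (V := C_R_NormedModule)); exact H2.
Qed.

Section GradSingleLayer.
Variables (k0 : R) (e1 e2 : C) (gam : R -> plane) (L : R) (phi : plane -> C).
Hypotheses (Hk : 0 < k0) (Hi1 : 0 < Im e1) (Hi2 : 0 < Im e2).
Hypothesis gam_fst : forall t, continuous (fun s => fst (gam s)) t.
Hypothesis gam_snd : forall t, continuous (fun s => snd (gam s)) t.
Hypothesis density : forall t, Ccontinuous (fun s => phi (gam s) * RtoC (speed gam s))%C t.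

Let c := (Ci / 4 * Csqrt (e1 * e2))%C.
Let w (t : R) : C := (phi (gam t) * RtoC (speed gam t))%C.

Lemma Ccontinuous_psub_qform {U : UniformSpace} (z : U -> plane) (f : U -> R) (u : U) :
  continuous (fun s => fst (z s)) u -> continuous (fun s => snd (z s)) u -> continuous f u ->
  Ccontinuous (fun s => qform e1 e2 (psub (z s) (gam (f s)))) u.
Proof.
  intros H1 H2 Hf; apply (Ccontinuous_qform e1 e2 (fun s => psub (z s) (gam (f s))));
    simpl; apply (continuous_minus (V := R_NormedModule)); auto.
  - now apply (continuous_comp f (fun s => fst (gam s))).
  - now apply (continuous_comp f (fun s => snd (gam s))).
Qed.

Lemma single_layer_RInt (z : plane) : (forall t, gam t <> z) ->
  Cis_RInt (fun t => Phi k0 e1 e2 z (gam t) * w t)%C 0 L (single_layer k0 e1 e2 gam L phi z).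
Proof.
  intros Hz.
  destruct (Cis_RInt_continuous (fun t => Phi k0 e1 e2 z (gam t) * w t)%C 0 L) as [I HI].
  - intros t _; apply Ccontinuous_mult; [|apply density].
    apply (Ccontinuous_ext (fun s => c * hankel_sqrt k0 (qform e1 e2 (psub z (gam s))))%C).
    { intros s; symmetry; apply Phi_hankel_sqrt; auto; intros E; now apply (Hz s). }
    apply Ccontinuous_mult; [apply Ccontinuous_const|].
    apply Ccontinuous_hankel_sqrt.
    + apply Im_qform_pos; auto; apply psub_neq_0; intros E; now apply (Hz t).
    + apply (Ccontinuous_psub_qform (fun _ => z) (fun s => s));
        [apply continuous_const|apply continuous_const|apply continuous_id].
  - replace (single_layer k0 e1 e2 gam L phi z) with I; auto.
    symmetry; unfold single_layer, curve_int.
    apply (is_RInt_unique (V := C_R_CompleteNormedModule)), Cis_RInt_spec.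
    revert HI; apply Cis_RInt_ext; intros t _; unfold w; ring.
Qed.

(** All points closer to [z] than [d] are off the curve, so on a neighbourhood the integrand is
    differentiable with jointly continuous derivative, and differentiation under the integral is
    justified. *)
Lemma grad_single_layer (z : plane) (d : R) : 0 < d ->
  (forall t, d <= Cmod (psub z (gam t))) ->
  ex_grad (single_layer k0 e1 e2 gam L phi) z /\
  forall n, Cis_RInt (fun t => dPhi k0 e1 e2 n z (gam t) * w t)%C 0 L
    (cdot (grad (single_layer k0 e1 e2 gam L phi) z) (conormal e1 e2 n)).
Proof.
  intros Hd Hz.
  assert (Hoff : forall z', Cmod (psub z z') < d -> forall t, gam t <> z').
  { intros z' Hz' t E; specialize (Hz t); rewrite E in Hz; lra. }
  assert (Hloc1 : locally (fst z) (fun s => forall t, gam t <> (s, snd z))).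
  { exists (mkposreal d Hd); intros s Hs t; apply Hoff.
    unfold ball in Hs; simpl in Hs; unfold AbsRing_ball, abs, minus, plus, opp in Hs; simpl in Hs.
    eapply Rle_lt_trans; [apply Cmod_le_components|]; simpl.
    rewrite Rminus_diag, Rabs_R0, Rplus_0_r, Rabs_minus_sym; exact Hs. }
  assert (Hloc2 : locally (snd z) (fun s => forall t, gam t <> (fst z, s))).
  { exists (mkposreal d Hd); intros s Hs t; apply Hoff.
    unfold ball in Hs; simpl in Hs; unfold AbsRing_ball, abs, minus, plus, opp in Hs; simpl in Hs.
    eapply Rle_lt_trans; [apply Cmod_le_components|]; simpl.
    rewrite Rminus_diag, Rabs_R0, Rplus_0_l, Rabs_minus_sym; exact Hs. }
  assert (Hz0 : forall t, gam t <> z).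
  { apply Hoff; unfold psub; rewrite !Rminus_diag.
    change (Cmod (RtoC 0) < d); now rewrite Cmod_0. }
  set (D := fun z' t => (c * hankel_sqrt_deriv k0 (qform e1 e2 (psub z' (gam t))))%C).
  set (dF1 := fun s t => (D (s, snd z) t * (e1 * RtoC (2 * (s - fst (gam t)))) * w t)%C).
  set (dF2 := fun s t => (D (fst z, s) t * (e2 * RtoC (2 * (s - snd (gam t)))) * w t)%C).
  assert (HDc : forall (U : UniformSpace) (zz : U -> plane) (f : U -> R) u,
     continuous (fun s => fst (zz s)) u -> continuous (fun s => snd (zz s)) u ->
     continuous f u -> zz u = z ->
     Ccontinuous (fun s => D (zz s) (f s)) u).
  { intros U zz f u H1 H2 H3 E; unfold D.
    apply Ccontinuous_mult; [apply Ccontinuous_const|].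
    apply Ccontinuous_hankel_sqrt_deriv; [|now apply Ccontinuous_psub_qform].
    apply Im_qform_pos; auto; apply psub_neq_0; rewrite E; intros E'; now apply (Hz0 (f u)). }
  assert (Hlin : forall (U : UniformSpace) (e : C) (p q : U -> R) u,
     continuous p u -> continuous q u ->
     Ccontinuous (fun s => e * RtoC (2 * (p s - q s)))%C u).
  { intros U e p q u Hp Hq; apply Ccontinuous_mult; [apply Ccontinuous_const|].
    apply Ccontinuous_RtoC, (continuous_mult (K := R_AbsRing)); [apply continuous_const|].
    now apply (continuous_minus (V := R_NormedModule)). }
  assert (Hdw : forall (U : UniformSpace) (f : U -> R) u, continuous f u ->
     Ccontinuous (fun s => w (f s)) u).
  { intros U f u Hf; apply (Ccontinuous_comp f w); auto; apply density. }
  assert (HC1 : forall t, Ccontinuous (fun p : R * R => dF1 (fst p) (snd p)) (fst z, t)).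
  { intros t; pose proof (@continuous_fst_pt R_UniformSpace R_UniformSpace (fst z, t)).
    pose proof (@continuous_snd_pt R_UniformSpace R_UniformSpace (fst z, t)).
    apply Ccontinuous_mult; [apply Ccontinuous_mult|].
    - apply (HDc _ (fun p : R * R => (fst p, snd z)) (fun p => snd p)); auto;
        [apply continuous_const|now destruct z].
    - apply (Hlin _ e1 (fun p : R * R => fst p) (fun p => fst (gam (snd p)))); auto.
      now apply (continuous_comp (fun p : R * R => snd p) (fun s => fst (gam s))).
    - now apply (Hdw _ (fun p : R * R => snd p)). }
  assert (HC2 : forall t, Ccontinuous (fun p : R * R => dF2 (fst p) (snd p)) (snd z, t)).
  { intros t; pose proof (@continuous_fst_pt R_UniformSpace R_UniformSpace (snd z, t)).
    pose proof (@continuous_snd_pt R_UniformSpace R_UniformSpace (snd z, t)).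
    apply Ccontinuous_mult; [apply Ccontinuous_mult|].
    - apply (HDc _ (fun p : R * R => (fst z, fst p)) (fun p => snd p)); auto;
        [apply continuous_const|now destruct z].
    - apply (Hlin _ e2 (fun p : R * R => fst p) (fun p => snd (gam (snd p)))); auto.
      now apply (continuous_comp (fun p : R * R => snd p) (fun s => snd (gam s))).
    - now apply (Hdw _ (fun p : R * R => snd p)). }
  assert (Hs : forall (F : R -> R -> C) s0,
     (forall t, Ccontinuous (fun p : R * R => F (fst p) (snd p)) (s0, t)) ->
     exists J, Cis_RInt (F s0) 0 L J).
  { intros F s0 H; apply Cis_RInt_continuous; intros t _.
    apply (Ccontinuous_comp (fun u : R => (s0, u)) (fun p : R * R => F (fst p) (snd p)));
      [|apply H].
    apply (continuous_comp_2 (fun _ : R => s0) (fun u : R => u) (fun a b : R => (a, b)));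
      [apply continuous_const|apply continuous_id|].
    apply (continuous_ext (fun q : R * R => q)); [intros [x y]; reflexivity|apply continuous_id]. }
  destruct (Hs dF1 (fst z) HC1) as [J1 HJ1]; destruct (Hs dF2 (snd z) HC2) as [J2 HJ2].
  assert (G1 : Cis_derive (fun s => single_layer k0 e1 e2 gam L phi (s, snd z)) (fst z) J1).
  { apply (Cis_derive_RInt_param (fun s t => Phi k0 e1 e2 (s, snd z) (gam t) * w t)%C dF1 _ 0 L);
      auto.
    - revert Hloc1; apply filter_imp; intros s H t.
      eapply Cis_derive_eq; [reflexivity| |apply Cis_derive_mult;
        [apply (Cis_derive_Phi_fst k0 e1 e2 Hk Hi1 Hi2 (s, snd z) (gam t))|
         apply (Cis_derive_const (w t))]].
      + rewrite Cmult_0_r, Cplus_0_r; reflexivity.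
      + intros E; now apply (H t).
    - revert Hloc1; apply filter_imp; intros s H; now apply single_layer_RInt. }
  assert (G2 : Cis_derive (fun s => single_layer k0 e1 e2 gam L phi (fst z, s)) (snd z) J2).
  { apply (Cis_derive_RInt_param (fun s t => Phi k0 e1 e2 (fst z, s) (gam t) * w t)%C dF2 _ 0 L);
      auto.
    - revert Hloc2; apply filter_imp; intros s H t.
      eapply Cis_derive_eq; [reflexivity| |apply Cis_derive_mult;
        [apply (Cis_derive_Phi_snd k0 e1 e2 Hk Hi1 Hi2 (fst z, s) (gam t))|
         apply (Cis_derive_const (w t))]].
      + rewrite Cmult_0_r, Cplus_0_r; reflexivity.
      + intros E; now apply (H t).
    - revert Hloc2; apply filter_imp; intros s H; now apply single_layer_RInt. }
  split.
  - split; [exact (Cis_derive_ex_derive _ _ _ G1)|exact (Cis_derive_ex_derive _ _ _ G2)].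
  - intros n; unfold cdot, grad; simpl fst; simpl snd.
    rewrite (CDerive_unique _ _ _ G1), (CDerive_unique _ _ _ G2).
    rewrite (Cmult_comm J1), (Cmult_comm J2).
    generalize (Cis_RInt_plus _ _ _ _ _ _ (Cis_RInt_scal (/ e1 * RtoC (fst n))%C _ _ _ _ HJ1)
      (Cis_RInt_scal (/ e2 * RtoC (snd n))%C _ _ _ _ HJ2)).
    apply Cis_RInt_ext; intros t _.
    assert (Ht : z <> gam t) by (intros E; now apply (Hz0 t)).
    unfold dPhi, cdot, grad; simpl fst; simpl snd.
    rewrite (CDerive_unique _ _ _ (Cis_derive_Phi_fst k0 e1 e2 Hk Hi1 Hi2 z (gam t) Ht)).
    rewrite (CDerive_unique _ _ _ (Cis_derive_Phi_snd k0 e1 e2 Hk Hi1 Hi2 z (gam t) Ht)).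
    unfold dF1, dF2, D, c; rewrite <- surjective_pairing; ring.
Qed.

End GradSingleLayer.

(** * The boundary curve *)

Lemma C2_is_derive (f : R -> R) (t : R) : C2 f -> is_derive f t (Derive f t).
Proof. intros H; apply Derive_correct, (proj1 (H t) 1%nat); lia. Qed.

Lemma C2_is_derive_Derive (f : R -> R) (t : R) :
  C2 f -> is_derive (Derive f) t (Derive_n f 2 t).
Proof. intros H; apply Derive_correct, (proj1 (H t) 2%nat); lia. Qed.

Lemma is_derive_continuous (f : R -> R) (t l : R) : is_derive f t l -> continuous f t.
Proof.
  intros H; apply (@ex_derive_continuous R_AbsRing R_NormedModule); now exists l.
Qed.

Lemma linear_growth (f df : R -> R) (d e : R) :
  f 0 = 0 -> (forall t, is_derive f t (df t)) ->
  (forall t, Rabs t < d -> Rabs (df t) <= e) ->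
  forall t, Rabs t < d -> Rabs (f t) <= e * Rabs t.
Proof.
  intros H0 Hf Hb t Ht.
  destruct (MVT_gen f 0 t df) as [s [Hs E]].
  - intros x _; apply Hf.
  - intros x _; apply continuity_pt_filterlim, (is_derive_continuous _ _ _ (Hf x)).
  - rewrite H0, !Rminus_0_r in E; rewrite E, Rabs_mult.
    apply Rmult_le_compat_r; [apply Rabs_pos|apply Hb].
    apply Rle_lt_trans with (Rabs t); auto.
    revert Hs; unfold Rmin, Rmax, Rabs.
    destruct (Rle_dec 0 t), (Rcase_abs s), (Rcase_abs t); lra.
Qed.

(** The content is continuity of the quotient at [t = 0], where it is given the value [f''(t0) / 2].
    The remainder [r0] has derivative [r1], and [r1] has derivative [f''(t0 + s) - f''(t0)], which
    is small near [0]; two applications of the mean value theorem yield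
    [|r0 s| <= (eps / 2) s^2]. *)
Lemma C2_taylor (f : R -> R) (t0 : R) : C2 f ->
  exists kap : R -> R, (forall t, continuous kap t) /\
    forall t, f (t0 + t) = f t0 + t * Derive f t0 + t ^ 2 * kap t.
Proof.
  intros H.
  set (a := f t0); set (b := Derive f t0); set (c := Derive_n f 2 t0).
  assert (Hsh : forall t, is_derive (fun s => t0 + s) t 1).
  { intros t; auto_derive; auto; ring. }
  exists (fun t => if Req_dec_T t 0 then c / 2 else (f (t0 + t) - a - t * b) / t ^ 2).
  split.
  - intros t; destruct (Req_dec_T t 0) as [->|Ht].
    + apply filterlim_locally; intros eps.
      set (r1 := fun s => Derive f (t0 + s) - b - c * s).
      set (r0 := fun s => f (t0 + s) - a - b * s - c / 2 * s ^ 2).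
      assert (D1 : forall s, is_derive r1 s (Derive_n f 2 (t0 + s) - c)).
      { intros s; unfold r1.
        pose proof (is_derive_comp (Derive f) (fun s => t0 + s) s _ _
          (C2_is_derive_Derive f (t0 + s) H) (Hsh s)) as K.
        apply (is_derive_ext (fun s => Derive f (t0 + s) - (b + c * s))); [intros y; match goal with |- ?u = ?v => change (@eq R u v) end; ring|].
        assert (K2 : is_derive (fun s => b + c * s) s c) by (auto_derive; auto; ring).
        evar_last; [apply (is_derive_minus (V := R_NormedModule) _ _ _ _ _ K K2)|].
        change (1 * Derive_n f 2 (t0 + s) - c = Derive_n f 2 (t0 + s) - c); ring. }
      assert (D0 : forall s, is_derive r0 s (r1 s)).
      { intros s; unfold r0.
        pose proof (is_derive_comp f (fun s => t0 + s) s _ _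
          (C2_is_derive f (t0 + s) H) (Hsh s)) as K.
        apply (is_derive_ext (fun s => f (t0 + s) - (a + b * s + c / 2 * s ^ 2))); [intros y; match goal with |- ?u = ?v => change (@eq R u v) end; ring|].
        assert (K2 : is_derive (fun s => a + b * s + c / 2 * s ^ 2) s (b + c * s))
          by (auto_derive; auto; field).
        evar_last; [apply (is_derive_minus (V := R_NormedModule) _ _ _ _ _ K K2)|].
        change (1 * Derive f (t0 + s) - (b + c * s) = r1 s); unfold r1; ring. }
      assert (He : 0 < eps / 2) by (pose proof (cond_pos eps); lra).
      assert (Hc : continuous (fun s => Derive_n f 2 (t0 + s)) 0).
      { apply (continuous_comp (fun s => t0 + s) (Derive_n f 2)).
        - apply (is_derive_continuous _ _ _ (Hsh 0)).
        - apply (proj2 (H (t0 + 0))). }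
      destruct (proj1 (filterlim_locally _ _) Hc (mkposreal _ He)) as [d Hd].
      assert (B2 : forall s, Rabs s < d -> Rabs (Derive_n f 2 (t0 + s) - c) <= eps / 2).
      { intros s Hs; specialize (Hd s).
        unfold ball in Hd; simpl in Hd; unfold AbsRing_ball, abs, minus, plus, opp in Hd; simpl in Hd.
        rewrite Ropp_0, !Rplus_0_r in Hd; apply Rlt_le, (Hd Hs). }
      assert (B1 : forall s, Rabs s < d -> Rabs (r1 s) <= eps / 2 * Rabs s).
      { apply (linear_growth r1 _ d (eps / 2)) with (2 := D1); auto.
        unfold r1; rewrite Rplus_0_r; unfold b; ring. }
      exists d; intros s Hs.
      unfold ball in Hs |- *; simpl in Hs |- *;
        unfold AbsRing_ball, abs, minus, plus, opp in Hs |- *; simpl in Hs |- *.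
      rewrite Ropp_0, Rplus_0_r in Hs.
      destruct (Req_dec_T 0 0) as [_|N]; [|lra].
      destruct (Req_dec_T s 0) as [_|Hs0]; [rewrite Rplus_opp_r, Rabs_R0; apply cond_pos|].
      assert (B0 : Rabs (r0 s) <= eps / 2 * Rabs s * Rabs s).
      { assert (Hs' : exists s', Rabs s < s' < d) by (exists ((Rabs s + d) / 2); lra).
        assert (K : forall u, Rabs u < d -> Rabs u <= Rabs s -> Rabs (r1 u) <= eps / 2 * Rabs s).
        { intros u Hu Hus; eapply Rle_trans; [apply B1, Hu|apply Rmult_le_compat_l; lra]. }
        destruct (MVT_gen r0 0 s r1) as [u [Hu E]].
        - intros; apply D0.
        - intros x _; apply continuity_pt_filterlim, (is_derive_continuous _ _ _ (D0 x)).
        - assert (R0 : r0 0 = 0) by (unfold r0; rewrite Rplus_0_r; unfold a; ring).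
          rewrite R0, !Rminus_0_r in E; rewrite E, Rabs_mult.
          apply Rmult_le_compat_r; [apply Rabs_pos|].
          assert (Rabs u <= Rabs s).
          { revert Hu; unfold Rmin, Rmax, Rabs.
            destruct (Rle_dec 0 s), (Rcase_abs u), (Rcase_abs s); lra. }
          apply K; lra. }
      assert (Hp : 0 < Rabs s) by now apply Rabs_pos_lt.
      replace (_ + - (c / 2)) with (r0 s / s ^ 2) by (unfold r0; field; auto).
      unfold Rdiv; rewrite Rabs_mult, Rabs_inv, <- RPow_abs.
      apply Rle_lt_trans with (eps / 2 * Rabs s * Rabs s * / Rabs s ^ 2).
      * apply Rmult_le_compat_r; auto; apply Rlt_le, Rinv_0_lt_compat, pow_lt, Hp.
      * replace (_ * _) with (eps / 2) by (field; lra); lra.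
    + apply (continuous_ext_loc _ (fun t => (f (t0 + t) - a - t * b) / t ^ 2)).
      * exists (mkposreal _ (Rabs_pos_lt _ Ht)); intros s Hs.
        destruct (Req_dec_T s 0) as [->|]; auto.
        unfold ball in Hs; simpl in Hs; unfold AbsRing_ball, abs, minus, plus, opp in Hs;
          simpl in Hs; rewrite Rplus_0_l, Rabs_Ropp in Hs; lra.
      * apply (@ex_derive_continuous R_AbsRing R_NormedModule); auto_derive.
        split; [eexists; apply C2_is_derive, H|].
        split; [rewrite Rmult_1_r; now apply Rmult_integral_contrapositive|auto].
  - intros t; cbv beta; destruct (Req_dec_T t 0) as [->|Ht].
    + rewrite Rplus_0_r; unfold a; ring.
    + field; auto.
Qed.

(** * Periodicity and integrals over one period *)

Lemma periodic_IZR {T : Type} (f : R -> T) (L : R) :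
  (forall t, f (t + L) = f t) -> forall (k : Z) t, f (t + IZR k * L) = f t.
Proof.
  intros H.
  assert (N : forall (n : nat) t, f (t + INR n * L) = f t).
  { induction n as [|n IH]; intros t; [f_equal; simpl; ring|].
    rewrite S_INR; replace (t + (INR n + 1) * L) with (t + INR n * L + L) by ring.
    now rewrite H, IH. }
  intros [|k|k] t.
  - f_equal; simpl; ring.
  - rewrite <- (positive_nat_Z k), <- INR_IZR_INZ; apply N.
  - rewrite <- (N (Pos.to_nat k) (t + _)); f_equal.
    rewrite INR_IZR_INZ, positive_nat_Z.
    change (Zneg k) with (- Zpos k)%Z; rewrite opp_IZR; ring.
Qed.

Lemma periodic_representative (L t : R) : 0 < L ->
  exists (k : Z) (r : R), t = r + IZR k * L /\ 0 <= r < L.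
Proof.
  intros HL; destruct (euclidian_division t L) as [k [r [E Hr]]]; [lra|].
  exists k, r; rewrite Rabs_pos_eq in Hr by lra; split; [lra|auto].
Qed.

(* The period window [a, a + L] meets [0, L] in one end and its complement, shifted by
   one period, is the other end. *)
Lemma is_RInt_periodic (f : R -> C_R_NormedModule) (L a : R) (I : C) :
  0 < L -> (forall t, f (t + L) = f t) -> - L <= a <= L ->
  is_RInt f a (a + L) I -> is_RInt f 0 L I.
Proof.
  intros HL Hp Ha HI.
  assert (Hsh : forall u v J, is_RInt f u v J -> is_RInt f (u + L) (v + L) J).
  { intros u v J HJ.
    apply (is_RInt_ext (fun y => scal 1 (f (1 * y + - L)))).
    - intros y _; etransitivity; [exact (scal_one (V := C_R_NormedModule) _)|]; rewrite <- Hp; f_equal; ring.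
    - apply (is_RInt_comp_lin f 1 (- L)).
      replace (1 * (u + L) + - L) with u by ring; replace (1 * (v + L) + - L) with v by ring.
      exact HJ. }
  assert (Hsh' : forall u v J, is_RInt f (u + L) (v + L) J -> is_RInt f u v J).
  { intros u v J HJ.
    apply (is_RInt_ext (fun y => scal 1 (f (1 * y + L)))).
    - intros y _; etransitivity; [exact (scal_one (V := C_R_NormedModule) _)|]; rewrite Rmult_1_l; apply Hp.
    - apply (is_RInt_comp_lin f 1 L); now rewrite !Rmult_1_l. }
  assert (HE : ex_RInt (V := C_R_CompleteNormedModule) f a (a + L)) by now exists I.
  assert (Step : forall m, a <= m <= a + L -> forall x y,
    (forall J1 J2, is_RInt f a m J1 -> is_RInt f m (a + L) J2 -> is_RInt f x y (plus J2 J1)) ->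
    is_RInt f x y I).
  { intros m Hm x y K.
    destruct (ex_RInt_Chasles_1 (V := C_R_CompleteNormedModule) f a m (a + L) Hm HE) as [J1 H1].
    destruct (ex_RInt_Chasles_2 (V := C_R_CompleteNormedModule) f a m (a + L) Hm HE) as [J2 H2].
    replace I with (plus (J2 : C_R_NormedModule) J1); [now apply K|].
    pose proof (is_RInt_Chasles _ _ _ _ _ _ H1 H2) as H3.
    transitivity (plus (J1 : C_R_NormedModule) J2); [apply plus_comm|].
    etransitivity; [symmetry; exact (is_RInt_unique (V := C_R_CompleteNormedModule) _ _ _ _ H3)|].
    exact (is_RInt_unique (V := C_R_CompleteNormedModule) _ _ _ _ HI). }
  destruct (Rle_dec a 0) as [H0|H0].
  - apply (Step 0); [lra|]; intros J1 J2 H1 H2.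
    apply (is_RInt_Chasles f 0 (a + L) L); auto.
    replace L with (0 + L) at 2 by ring; now apply Hsh.
  - apply (Step L); [lra|]; intros J1 J2 H1 H2.
    apply (is_RInt_Chasles f 0 a L); auto.
    apply Hsh'; now rewrite Rplus_0_l.
Qed.

(** Centres the period at the parameter of [x]. For the converse, integrability on [[- L, 2 L]] is
    assembled from three periods and restricted to the centred window; the value is then identified
    by the first direction and uniqueness. *)
Lemma Cis_RInt_periodic (f : R -> C) (L t0 : R) (I : C) :
  0 < L -> (forall t, f (t + L) = f t) -> 0 <= t0 <= L ->
  Cis_RInt (fun t => f (t0 + t)) (- (L / 2)) (L / 2) I <-> Cis_RInt f 0 L I.
Proof.
  intros HL Hp Ht0.
  assert (F : forall I, Cis_RInt (fun t => f (t0 + t)) (- (L / 2)) (L / 2) I -> Cis_RInt f 0 L I).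
  { intros J; rewrite !Cis_RInt_spec; intros H.
    apply (is_RInt_periodic f L (t0 - L / 2)); auto; [lra|].
    apply (is_RInt_ext (fun y => scal 1 ((fun t => f (t0 + t)) (1 * y + - t0)) : C_R_NormedModule)).
    - intros y _; etransitivity; [exact (scal_one (V := C_R_NormedModule) _)|]; f_equal; ring.
    - apply (is_RInt_comp_lin (fun t => f (t0 + t) : C_R_NormedModule) 1 (- t0)).
      replace (1 * (t0 - L / 2) + - t0) with (- (L / 2)) by ring.
      replace (1 * (t0 - L / 2 + L) + - t0) with (L / 2) by field. exact H. }
  split; auto.
  rewrite Cis_RInt_spec; intros H.
  assert (HE : ex_RInt (V := C_R_CompleteNormedModule) f 0 L) by now exists I.
  assert (Sh : forall a x y : R, x + a = 0 -> y + a = L -> (forall t, f (t + a) = f t) ->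
             ex_RInt (V := C_R_CompleteNormedModule) f x y).
  { intros a x y Ex Ey Ha.
    apply (ex_RInt_ext (V := C_R_CompleteNormedModule) (fun t => scal 1 (f (1 * t + a)))).
    - intros t _; rewrite Rmult_1_l, Ha; apply (scal_one (V:=C_R_NormedModule)).
    - apply (ex_RInt_comp_lin (V := C_R_CompleteNormedModule) f 1 a); now rewrite !Rmult_1_l, Ex, Ey. }
  assert (H1 : ex_RInt (V := C_R_CompleteNormedModule) f (- L) 0).
  { apply (Sh L); auto; ring. }
  assert (H2 : ex_RInt (V := C_R_CompleteNormedModule) f L (2 * L)).
  { apply (Sh (- L)); [ring|ring|]; intros t; rewrite <- (Hp (t + - L)); f_equal; ring. }
  pose proof (ex_RInt_Chasles _ _ _ _ (ex_RInt_Chasles _ _ _ _ H1 HE) H2) as H3.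
  apply (ex_RInt_Chasles_1 (V := C_R_CompleteNormedModule) f (- L) (t0 + L / 2)) in H3; [|lra].
  apply (ex_RInt_Chasles_2 (V := C_R_CompleteNormedModule) f (- L) (t0 - L / 2)) in H3; [|lra].
  destruct H3 as [J HJ].
  assert (HJ' : Cis_RInt (fun t => f (t0 + t)) (- (L / 2)) (L / 2) J).
  { apply Cis_RInt_spec.
    apply (is_RInt_ext (fun y => scal 1 (f (1 * y + t0)) : C_R_NormedModule)).
    - intros y _; etransitivity; [exact (scal_one (V := C_R_NormedModule) _)|]; f_equal; ring.
    - apply (is_RInt_comp_lin (f : R -> C_R_NormedModule) 1 t0).
      replace (1 * - (L / 2) + t0) with (t0 - L / 2) by ring.
      replace (1 * (L / 2) + t0) with (t0 + L / 2) by ring. exact HJ. }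
  replace I with J; auto.
  pose proof (proj1 (Cis_RInt_spec _ _ _ _) (F J HJ')) as HJ0.
  etransitivity; [symmetry; exact (is_RInt_unique (V := C_R_CompleteNormedModule) _ _ _ _ HJ0)|].
  exact (is_RInt_unique (V := C_R_CompleteNormedModule) _ _ _ _ H).
Qed.

Lemma Csqrt_prod_neq_0 (e1 e2 : C) :
  Re e1 * Re e2 < 0 -> 0 < Im e1 -> 0 < Im e2 -> Csqrt (e1 * e2) <> 0%C.
Proof.
  intros Hre Hi1 Hi2.
  destruct (sqrt_first_quadrant e1 Hi1) as [p [Ep [P1 P2]]].
  destruct (sqrt_first_quadrant e2 Hi2) as [r [Er [R1 R2]]].
  rewrite <- Ep, <- Er, Csqrt_mult_first_quadrant; auto; [|now rewrite Ep, Er].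
  apply Cmult_neq_0; now apply Im_pos_neq_0.
Qed.

Lemma dPhi_opp (k0 : R) (e1 e2 : C) (n x y : plane) :
  dPhi k0 e1 e2 (- fst n, - snd n) x y = (- dPhi k0 e1 e2 n x y)%C.
Proof. unfold dPhi, cdot, conormal; simpl fst; simpl snd; rewrite !RtoC_opp; ring. Qed.

Lemma cdot_conormal_opp (e1 e2 : C) (u : C * C) (n : plane) :
  cdot u (conormal e1 e2 (- fst n, - snd n)) = (- cdot u (conormal e1 e2 n))%C.
Proof. unfold cdot, conormal; simpl fst; simpl snd; rewrite !RtoC_opp; ring. Qed.

Lemma filterlim_at_right_C (f : R -> C) (l : C) :
  (forall eps, 0 < eps -> exists eta, 0 < eta /\
     forall h, 0 < h < eta -> Cmod (f h - l)%C <= eps) ->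
  filterlim f (at_right 0) (locally (T := C_UniformSpace) l).
Proof.
  intros H; apply filterlim_locally; intros eps.
  assert (He : 0 < eps / 2) by (pose proof (cond_pos eps); lra).
  destruct (H _ He) as [eta [Heta K]].
  exists (mkposreal _ Heta); intros h Hh Hp.
  unfold ball in Hh; simpl in Hh; unfold AbsRing_ball, abs, minus, plus, opp in Hh; simpl in Hh.
  rewrite Ropp_0, Rplus_0_r, Rabs_pos_eq in Hh by lra.
  specialize (K h ltac:(lra)).
  pose proof (re_le_Cmod (f h - l)%C) as A1; pose proof (Im_le_Cmod (f h - l)%C) as A2.
  pose proof (cond_pos eps).
  split; unfold ball; simpl; unfold AbsRing_ball, abs, minus, plus, opp; simpl.
  - eapply Rle_lt_trans; [exact A1|lra].
  - eapply Rle_lt_trans; [exact A2|lra].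
Qed.

Section Boundary.
Variables (G : plane -> Prop) (gam : R -> plane) (L : R).
Hypothesis curve : C2_closed_curve G gam L.

Let HL : 0 < L := curve_period_pos _ _ _ curve.

Lemma curve_on (t : R) : G (gam t).
Proof.
  destruct (periodic_representative L t HL) as [k [r [E Hr]]].
  apply (curve_trace _ _ _ curve); exists r; split; auto.
  rewrite E; symmetry; apply periodic_IZR, (curve_periodic _ _ _ curve).
Qed.

Lemma curve_fst_continuous (t : R) : continuous (fun s => fst (gam s)) t.
Proof. eapply is_derive_continuous, C2_is_derive, (curve_C2_fst _ _ _ curve). Qed.

Lemma curve_snd_continuous (t : R) : continuous (fun s => snd (gam s)) t.
Proof. eapply is_derive_continuous, C2_is_derive, (curve_C2_snd _ _ _ curve). Qed.

Lemma curve_continuous (t : R) : continuous gam t.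
Proof.
  apply (continuous_ext (fun s => (fst (gam s), snd (gam s))));
    [intros s; symmetry; apply surjective_pairing|].
  apply (continuous_comp_2 (fun s => fst (gam s)) (fun s => snd (gam s))
           (fun a b : R => (a, b) : plane)).
  - apply curve_fst_continuous.
  - apply curve_snd_continuous.
  - apply (continuous_ext (fun q : R * R => q)); [intros [u v]; reflexivity|apply continuous_id].
Qed.

Lemma speed_continuous (t : R) : continuous (speed gam) t.
Proof.
  assert (A : forall f : R -> R, C2 f -> continuous (fun s => Derive f s ^ 2) t).
  { intros f Hf; pose proof (is_derive_continuous _ _ _ (C2_is_derive_Derive f t Hf)) as K.
    now apply continuous_sqr. }
  apply (continuous_comp (fun s => fst (velocity gam s) ^ 2 + snd (velocity gam s) ^ 2) sqrt).
  - apply (continuous_plus (V := R_NormedModule)).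
    + apply (A (fun s => fst (gam s))), (curve_C2_fst _ _ _ curve).
    + apply (A (fun s => snd (gam s))), (curve_C2_snd _ _ _ curve).
  - apply continuous_sqrt.
Qed.

Lemma velocity_periodic (t : R) : velocity gam (t + L) = velocity gam t.
Proof.
  assert (A : forall f : R -> R, (forall s, f (s + L) = f s) -> Derive f (t + L) = Derive f t).
  { intros f Hf; unfold Derive; f_equal; apply Lim_ext; intros h.
    now replace (t + L + h) with (t + h + L) by ring; rewrite !Hf. }
  unfold velocity; f_equal; [apply (A (fun s => fst (gam s)))|apply (A (fun s => snd (gam s)))];
    intros s; now rewrite (curve_periodic _ _ _ curve).
Qed.

Lemma density_continuous (phi : plane -> C) (t : R) :
  continuous_on (U := C_UniformSpace) G phi ->
  Ccontinuous (fun s => phi (gam s) * RtoC (speed gam s))%C t.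
Proof.
  intros Hphi; apply Ccontinuous_mult; [|apply Ccontinuous_RtoC, speed_continuous].
  assert (K : filterlim (fun s => phi (gam s)) (locally t)
                (locally (T := C_UniformSpace) (phi (gam t)))).
  { apply (filterlim_comp _ _ _ gam phi _ (within G (locally (gam t)))); [|apply Hphi, curve_on].
    intros P HP; generalize (curve_continuous t _ HP); unfold filtermap.
    apply filter_imp; intros s Hs; apply Hs, curve_on. }
  apply Ccontinuous_of_locally; intros eps.
  assert (He : 0 < eps / 2) by (pose proof (cond_pos eps); lra).
  generalize (proj1 (filterlim_locally _ _) K (mkposreal _ He)).
  apply filter_imp; intros s [A B].
  eapply Rle_lt_trans; [apply Cmod_le_components|].
  unfold ball in A, B; simpl in A, B; unfold AbsRing_ball, abs, minus, plus, opp in A, B;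
    simpl in A, B; unfold Re, Im; simpl; lra.
Qed.

(** After a shift by at most one period [t0 + t] lies in [[0, L)]; simplicity then leaves [t = 0] or
    [|t| = L], and the window has only half that radius. *)
Lemma curve_injective_near (t0 t : R) : 0 <= t0 < L ->
  - (L / 2) <= t <= L / 2 -> gam (t0 + t) = gam t0 -> t = 0.
Proof.
  intros Ht0 Ht E.
  pose proof (curve_periodic _ _ _ curve) as Hp; pose proof (curve_simple _ _ _ curve) as Hs.
  destruct (Rlt_le_dec (t0 + t) 0) as [K|K]; [|destruct (Rlt_le_dec (t0 + t) L) as [K'|K']].
  - rewrite <- Hp in E; apply Hs in E; lra.
  - apply Hs in E; lra.
  - replace (t0 + t) with (t0 + t - L + L) in E by ring; rewrite Hp in E.
    apply Hs in E; lra.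
Qed.

(** * The trace from one side *)

Variables (k0 : R) (e1 e2 : C).
Hypotheses (Hk : 0 < k0) (Hre : Re e1 * Re e2 < 0) (Hi1 : 0 < Im e1) (Hi2 : 0 < Im e2).
Variable phi : plane -> C.
Hypothesis Hphi : continuous_on (U := C_UniformSpace) G phi.

(** The same vector [n] serves as direction of approach and of differentiation, so the sign of the
    jump does not depend on which of the two unit normals is taken. *)
Lemma conormal_trace_one_side (t0 : R) (n : plane) :
  0 <= t0 < L -> Cmod n = 1 -> pdot n (velocity gam t0) = 0 ->
  exists K : C,
    is_curve_int gam L (fun y => (dPhi k0 e1 e2 n (gam t0) y * phi y)%C) K /\
    is_directional_trace (single_layer k0 e1 e2 gam L phi) (gam t0) n
      (conormal e1 e2 n) (K - / 2 * phi (gam t0))%C.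
Proof.
  intros Ht0 Hn Hnt.
  set (x := gam t0) in *; set (tau := velocity gam t0) in *.
  destruct (C2_taylor _ t0 (curve_C2_fst _ _ _ curve)) as [kap1 [Hk1 T1]].
  destruct (C2_taylor _ t0 (curve_C2_snd _ _ _ curve)) as [kap2 [Hk2 T2]].
  set (kap := fun t => (kap1 t, kap2 t) : plane).
  set (l := L / 2); assert (Hl : 0 < l) by (unfold l; lra).
  assert (T : forall h t, psub (shift x n h) (gam (t0 + t)) = layer_pt n tau kap h t).
  { intros h t; unfold psub, layer_pt, shift.
    rewrite T1, T2; fold x; unfold tau, velocity, kap; simpl; f_equal; ring. }
  assert (T0 : forall t, psub x (gam (t0 + t)) = layer_pt n tau kap 0 t).
  { intros t; rewrite <- T; unfold shift, psub; simpl; f_equal; ring. }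
  set (chord := fun t => (fst tau + t * fst (kap t), snd tau + t * snd (kap t)) : plane).
  assert (Ech : forall t, layer_pt n tau kap 0 t = (- t * fst (chord t), - t * snd (chord t)))
    by (intros t; unfold layer_pt, chord; simpl; f_equal; ring).
  assert (Hreg : tau <> (0, 0)) by apply (curve_regular _ _ _ curve).
  (* At [t = 0] this is regularity of the curve, elsewhere its simplicity, since [t] times the chord
     is [gam (t0 + t) - x]. *)
  assert (Hnd : forall t, - l <= t <= l -> chord t <> (0, 0)).
  { intros t Ht E; destruct (Req_dec t 0) as [->|Ht1].
    - apply Hreg; revert E; unfold chord; rewrite !Rmult_0_l, !Rplus_0_r.
      now rewrite <- surjective_pairing.
    - apply Ht1, (curve_injective_near t0 t Ht0 Ht).
      specialize (T0 t); rewrite Ech, E in T0; simpl in T0; rewrite !Rmult_0_r in T0.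
      injection T0; intros; apply injective_projections; fold x; lra. }
  set (w := fun t => (phi (gam t) * RtoC (speed gam t))%C).
  assert (Hw : forall t, Ccontinuous w t) by (intros t; now apply density_continuous).
  set (psi := fun t => w (t0 + t)).
  assert (Hsh : forall t, continuous (fun s => t0 + s) t).
  { intros t; apply (continuous_plus (V := R_NormedModule)); [apply continuous_const|apply continuous_id]. }
  assert (Hpsi : forall t, Ccontinuous psi t).
  { intros t; apply (Ccontinuous_comp (fun s => t0 + s) w); auto. }
  set (A := (- RtoC (/ (2 * PI)) * Csqrt (e1 * e2))%C).
  set (Kr := dPhi_reg k0 e1 e2 n).
  assert (HKr : forall z, Ccontinuous Kr z) by (intros z; now apply Ccontinuous_dPhi_reg).
  assert (Hper : forall z t, (dPhi k0 e1 e2 n z (gam (t + L)%R) * w (t + L)%R)%C =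
                             (dPhi k0 e1 e2 n z (gam t) * w t)%C).
  { intros z t; unfold w, speed.
    now rewrite (curve_periodic _ _ _ curve), velocity_periodic. }
  set (g := fun t => (dPhi k0 e1 e2 n x (gam (t0 + t)) * psi t)%C).
  assert (Hkc1 : forall t, continuous (fun s => fst (kap s)) t) by exact Hk1.
  assert (Hkc2 : forall t, continuous (fun s => snd (kap s)) t) by exact Hk2.
  assert (Hoff : forall t, - l <= t <= l -> t <> 0 ->
            g t = layer_integrand e1 e2 n tau kap A Kr psi 0 t).
  { intros t Ht Ht1; unfold g, layer_integrand.
    rewrite dPhi_decomp, T0; auto.
    intros E; apply Ht1, (curve_injective_near t0 t Ht0 Ht); now rewrite <- E. }
  assert (Hg : exists I, Cis_RInt g (- l) l I).
  (* A continuous representative of [g]: the factor [t^2] common to [z . n] and [Q] is cancelled,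
     which replaces [Q(z)] by the nonzero [Q(chord)]. *)
  { set (ge := fun t => ((A * (RtoC (- pdot (kap t) n) / qform e1 e2 (chord t))
                           + Kr (layer_pt n tau kap 0 t)) * psi t)%C).
    assert (Ege : forall t, - l <= t <= l -> t <> 0 -> ge t = g t).
    { intros t Ht Ht1; rewrite Hoff by auto; unfold ge, layer_integrand.
      rewrite pdot_layer_pt by auto.
      assert (Eq : qform e1 e2 (layer_pt n tau kap 0 t) = (RtoC (t ^ 2) * qform e1 e2 (chord t))%C)
        by (rewrite Ech; unfold qform; apply injective_projections; simpl; ring).
      rewrite Eq; do 3 f_equal.
      replace (0 - t ^ 2 * pdot (kap t) n) with (t ^ 2 * - pdot (kap t) n) by ring.
      rewrite RtoC_mult; field; split.
      - apply Im_pos_neq_0, Im_qform_pos; auto.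
      - intros E; apply (f_equal fst) in E; simpl in E; apply Ht1; nra. }
    assert (Hge : forall t, - l <= t <= l -> Ccontinuous ge t).
    { intros t Ht; unfold ge; apply Ccontinuous_mult; auto.
      assert (Hc : forall (f : R -> R) a, (forall t, continuous f t) ->
                continuous (fun s => a + s * f s) t).
      { intros f a Hf; apply (continuous_plus (V := R_NormedModule)); [apply continuous_const|].
        apply (continuous_mult (K := R_AbsRing)); auto; apply continuous_id. }
      apply Ccontinuous_plus.
      - apply Ccontinuous_mult; [apply Ccontinuous_const|].
        apply Ccontinuous_mult.
        + apply Ccontinuous_RtoC, (continuous_opp (V := R_NormedModule)), continuous_pdot; auto.
        + apply Ccontinuous_inv; [apply Im_pos_neq_0, Im_qform_pos; auto|].
          apply Ccontinuous_qform; unfold chord; simpl; now apply Hc.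
      - apply (Ccontinuous_comp (fun s => layer_pt n tau kap 0 s) Kr); auto.
        apply (continuous_comp_2 (fun _ : R => 0) (fun s : R => s)
                 (fun h s => layer_pt n tau kap h s)); [apply continuous_const|apply continuous_id|].
        apply continuous_layer_pt; auto. }
    (* Splitting at [0] makes the exceptional point an endpoint, where the values of the integrand
       do not matter. *)
    destruct (Cis_RInt_continuous ge (- l) 0) as [I1 H1];
      [rewrite Rmin_left, Rmax_right by lra; intros t Ht; apply Hge; lra|].
    destruct (Cis_RInt_continuous ge 0 l) as [I2 H2];
      [rewrite Rmin_left, Rmax_right by lra; intros t Ht; apply Hge; lra|].
    exists (plus (I1 : C_R_NormedModule) I2); apply Cis_RInt_spec.
    apply (is_RInt_Chasles (V := C_R_NormedModule) g (- l) 0 l); apply Cis_RInt_spec.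
    - revert H1; apply Cis_RInt_ext; rewrite Rmin_left, Rmax_right by lra.
      intros t Ht; apply Ege; lra.
    - revert H2; apply Cis_RInt_ext; rewrite Rmin_left, Rmax_right by lra.
      intros t Ht; apply Ege; lra. }
  destruct Hg as [Kg HKg].
  exists Kg; split.
  { apply Cis_RInt_spec.
    apply (Cis_RInt_ext (fun t => dPhi k0 e1 e2 n x (gam t) * w t)%C);
      [intros t _; unfold w; ring|].
    apply (Cis_RInt_periodic _ L t0); auto; lra. }
  destruct (layer_pt_lower n tau kap l Hn Hnt Hl Hkc1 Hkc2 Hnd) as [c [h0 [Hc [Hh0 LB]]]].
  assert (Hfar : forall h, 0 < h < h0 -> exists d, 0 < d /\
            forall t, d <= Cmod (psub (shift x n h) (gam t))).
  (* The lower bound [c (h^2 + t^2)] for the squared distance, with [t^2] dropped; periodicity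
     brings every parameter into the centred window. *)
  { intros h Hh; exists (sqrt (c * h ^ 2)).
    assert (0 < h ^ 2) by (apply pow_lt; lra).
    split; [apply sqrt_lt_R0; now apply Rmult_lt_0_compat|]; intros t.
    destruct (periodic_representative L (t - (t0 - l)) HL) as [k [r [E Hr]]].
    replace t with (t0 + (r - l) + IZR k * L) by lra.
    rewrite (periodic_IZR gam L (curve_periodic _ _ _ curve)), T.
    rewrite <- (sqrt_pow2 (Cmod _)) by apply Cmod_ge_0.
    apply sqrt_le_1_alt; eapply Rle_trans; [|apply LB; unfold l in *; lra].
    apply Rmult_le_compat_l; [lra|pose proof (pow2_ge_0 (r - l)); lra]. }
  set (v := single_layer k0 e1 e2 gam L phi).
  assert (Hgrad : forall h, 0 < h < h0 -> ex_grad v (shift x n h) /\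
     Cis_RInt (layer_integrand e1 e2 n tau kap A Kr psi h) (- l) l
       (cdot (grad v (shift x n h)) (conormal e1 e2 n))).
  { intros h Hh; destruct (Hfar h Hh) as [d [Hd Hd']].
    destruct (grad_single_layer k0 e1 e2 gam L phi Hk Hi1 Hi2
      curve_fst_continuous curve_snd_continuous
      (fun t => density_continuous phi t Hphi) (shift x n h) d Hd Hd') as [G1 G2].
    split; [exact G1|].
    specialize (G2 n).
    apply (Cis_RInt_periodic _ L t0) in G2; auto; [|lra].
    revert G2; apply Cis_RInt_ext; intros t _.
    unfold layer_integrand; rewrite dPhi_decomp, T; auto.
    intros E; specialize (Hd' (t0 + t)); rewrite <- E in Hd'.
    unfold psub in Hd'; rewrite !Rminus_diag in Hd'.
    change (d <= Cmod (RtoC 0)) in Hd'; rewrite Cmod_0 in Hd'; lra. }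
  split.
  - exists (mkposreal _ Hh0); intros h Hh Hp.
    unfold ball in Hh; simpl in Hh; unfold AbsRing_ball, abs, minus, plus, opp in Hh; simpl in Hh.
    rewrite Ropp_0, Rplus_0_r, Rabs_pos_eq in Hh by lra.
    apply Hgrad; lra.
  - apply filterlim_at_right_C; intros eps Heps.
    replace (Kg - / 2 * phi x)%C with
      (Kg + A * psi 0 * (RtoC (PI / Cmod tau) / Csqrt (e1 * e2)))%C.
    + apply (layer_jump e1 e2 n tau kap l Hre Hi1 Hi2 Hn Hnt Hl Hkc1 Hkc2 Hnd
               A Kr psi g Kg HKr Hpsi Hoff HKg
               (fun h => cdot (grad v (shift x n h)) (conormal e1 e2 n)) h0 Hh0); auto.
      intros h Hh; now apply Hgrad.
    + pose proof (Csqrt_prod_neq_0 e1 e2 Hre Hi1 Hi2) as Hs.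
      assert (Hs0 : 0 < Cmod tau) by now apply Cmod_gt_0.
      unfold A, psi, w; rewrite Rplus_0_r; fold x.
      change (speed gam t0) with (Cmod tau).
      transitivity (Kg - RtoC (/ (2 * PI) * Cmod tau * (PI / Cmod tau)) * phi x)%C.
      * rewrite !RtoC_mult; field; auto.
      * replace (/ (2 * PI) * Cmod tau * (PI / Cmod tau)) with (/ 2)
          by (pose proof PI_RGT_0; field; lra).
        now rewrite RtoC_inv by lra.
Qed.

End Boundary.

Theorem proposition2p2 :
  forall (k0 : R) (e1 e2 : C),
    0 < k0 ->
    Re e1 * Re e2 < 0 -> 0 < Im e1 -> 0 < Im e2 ->
  forall (Omega : plane -> Prop) (gamma : R -> plane) (L : R)
         (nu : plane -> plane),
    domain Omega -> bounded Omega -> simply_connected Omega ->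
    C2_closed_curve (boundary Omega) gamma L ->
    outward_unit_normal Omega gamma nu ->
  forall phi : plane -> C,
    continuous_on (U := C_UniformSpace) (boundary Omega) phi ->
  let v := single_layer k0 e1 e2 gamma L phi in
  forall x : plane, boundary Omega x ->
    exists K : C,
      is_curve_int gamma L (fun y => (dPhi k0 e1 e2 (nu x) x y * phi y)%C) K /\
      is_directional_trace v x (nu x) (conormal e1 e2 (nu x))
        (K - / 2 * phi x)%C /\
      is_directional_trace v x (- fst (nu x), - snd (nu x))
        (conormal e1 e2 (nu x)) (K + / 2 * phi x)%C.
Proof.
  intros k0 e1 e2 Hk Hre Hi1 Hi2 Omega gamma L nu _ _ _ curve normal phi Hphi v x Hx.
  destruct (proj1 (curve_trace _ _ _ curve x) Hx) as [t0 [Ht0 Ex]].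
  destruct (normal x Hx) as [Hunit [Horth _]].
  specialize (Horth t0 Ex).
  set (n := nu x) in *; set (m := (- fst n, - snd n) : plane).
  assert (Hn : Cmod n = 1) by (unfold Cmod; now rewrite Hunit, sqrt_1).
  assert (Hm : Cmod m = 1).
  { unfold Cmod, m; simpl fst; simpl snd.
    replace ((- fst n) ^ 2 + (- snd n) ^ 2) with (fst n ^ 2 + snd n ^ 2) by ring.
    now rewrite Hunit, sqrt_1. }
  assert (Hmo : pdot m (velocity gamma t0) = 0) by (unfold pdot, m; cbn [fst snd]; lra).
  destruct (conormal_trace_one_side _ gamma L curve k0 e1 e2 Hk Hre Hi1 Hi2 phi Hphi
              t0 n Ht0 Hn Horth) as [K [HK HT]].
  destruct (conormal_trace_one_side _ gamma L curve k0 e1 e2 Hk Hre Hi1 Hi2 phi Hphi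
              t0 m Ht0 Hm Hmo) as [K' [HK' [HE' HT']]].
  rewrite Ex in *.
  exists K; split; [exact HK|split; [exact HT|]].
  (* The kernel is linear in the direction and integrals are unique. *)
  assert (EK : K' = (- K)%C).
  { assert (H : is_curve_int gamma L (fun y => (dPhi k0 e1 e2 m x y * phi y)%C) (- K)%C).
    { apply (is_RInt_ext (V := C_R_NormedModule)
        (fun t => opp ((dPhi k0 e1 e2 n x (gamma t) * phi (gamma t)
                        * RtoC (speed gamma t))%C : C_R_NormedModule))).
      - intros t _; unfold m; rewrite dPhi_opp.
        change (- (dPhi k0 e1 e2 n x (gamma t) * phi (gamma t) * RtoC (speed gamma t))
          = - dPhi k0 e1 e2 n x (gamma t) * phi (gamma t) * RtoC (speed gamma t))%C; ring.
      - apply (is_RInt_opp (V := C_R_NormedModule)), HK. }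
    etransitivity; [symmetry; exact (is_RInt_unique (V := C_R_CompleteNormedModule) _ _ _ _ HK')|].
    exact (is_RInt_unique (V := C_R_CompleteNormedModule) _ _ _ _ H). }
  split; [exact HE'|].
  (* Approach along [m = - n] gave the derivative in the direction [A m], the negative of the one
     wanted; negating its limit [- K - phi x / 2] yields [K + phi x / 2]. *)
  apply (filterlim_ext (fun h => opp (cdot (grad v (shift x m h)) (conormal e1 e2 m)
           : C_R_NormedModule))).
  - intros h; unfold m at 2; rewrite cdot_conormal_opp.
    change (- - cdot (grad v (shift x m h)) (conormal e1 e2 n)
      = cdot (grad v (shift x m h)) (conormal e1 e2 n))%C; ring.
  - replace (K + / 2 * phi x)%C with (- (K' - / 2 * phi x))%C by (rewrite EK; ring).
    eapply filterlim_comp; [exact HT'|].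
    apply (filterlim_opp (V := C_R_NormedModule)).
Qed.
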